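(* Let $\mathsf{P}:\mathscr{C}^{\mathrm{op}}\to\mathsf{InfSL}$ be a biased elementary doctrine with full weak comprehensions and comprehensive diagonals, and let $R:\mathscr{D}^{\mathrm{op}}\to\mathsf{InfSL}$ be an elementary doctrine in $\mathbf{QD}$. Then pre-composition with the canonical 1-arrow $(J,j):\mathsf{P}\to\overline{\mathsf{P}}$ induces an equivalence of categories $$(-)\circ(J,j):\ \mathbf{QD}(\overline{\mathsf{P}},R)\longrightarrow\mathbf{Lco}(\mathsf{P},R).$$
   Context: **Weak products.** A weak product of objects $X_1,\dots,X_n$ is an object $W$ with arrows $\mathsf{p}_i:W\to X_i$ such that for all arrows $f_i:Z\to X_i$ there is a (not necessarily unique) $h:Z\to W$ with $\mathsf{p}_ih=f_i$ for all $i$. $\mathscr{C}$ has weak finite products if every finite list of objects has a weak product (the empty list giving a weak terminal object). **Biased primary doctrine.** $\mathsf{InfSL}$ is the category of posets with finite meets and finite-meet-preserving maps. A biased primary doctrine is a functor $\mathsf{P}:\mathscr{C}^{\mathrm{op}}\to\mathsf{InfSL}$ with $\mathscr{C}$ having weak finite products. For $f:X\to Y$ write $\mathsf{P}_f:\mathsf{P}(Y)\to\mathsf{P}(X)$; $\top_X$ is the top of $\mathsf{P}(X)$. **Biased elementary doctrine.** A biased primary doctrine with, for every object $X$ and every weak product $X\xleftarrow{\mathsf{p}_1}W\xrightarrow{\mathsf{p}_2}X$, a (fixed) element $\delta^{(\mathsf{p}_1,\mathsf{p}_2)}\in\mathsf{P}(W)$ such that: 1. for every $d:X\to W$ with $\mathsf{p}_1d=\mathsf{p}_2d=1_X$,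 $\top_X\le\mathsf{P}_d\delta^{(\mathsf{p}_1,\mathsf{p}_2)}$; 2. for every $\alpha\in\mathsf{P}(X)$, $\mathsf{P}_{\mathsf{p}_1}\alpha\wedge\delta^{(\mathsf{p}_1,\mathsf{p}_2)}\le\mathsf{P}_{\mathsf{p}_2}\alpha$; 3. for every weak product $X'\xleftarrow{\mathsf{p}'_1}W'\xrightarrow{\mathsf{p}'_2}X'$ and arrows $f:X'\to X$, $g:W'\to W$ with $\mathsf{p}_ig=f\mathsf{p}'_i$ ($i=1,2$), $\delta^{(\mathsf{p}'_1,\mathsf{p}'_2)}\le\mathsf{P}_g\delta^{(\mathsf{p}_1,\mathsf{p}_2)}$; 4. for every weak product $W\xleftarrow{\mathsf{r}_1}U\xrightarrow{\mathsf{r}_2}W$ and $t,t':U\to W$ with $\mathsf{p}_1t=\mathsf{p}_1\mathsf{r}_1$, $\mathsf{p}_2t=\mathsf{p}_1\mathsf{r}_2$, $\mathsf{p}_1t'=\mathsf{p}_2\mathsf{r}_1$, $\mathsf{p}_2t'=\mathsf{p}_2\mathsf{r}_2$: $\mathsf{P}_{\mathsf{r}_1}\delta^{(\mathsf{p}_1,\mathsf{p}_2)}\wedge\mathsf{P}_t\delta^{(\mathsf{p}_1,\mathsf{p}_2)}\wedge\mathsf{P}_{t'}\delta^{(\mathsf{p}_1,\mathsf{p}_2)}\le\mathsf{P}_{\mathsf{r}_2}\delta^{(\mathsf{p}_1,\mathsf{p}_2)}$. **Proof-irrelevant elements.** Let $\mathsf{p}_i:W\to X_i$, $1\le i\le n$,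 be a weak product. An element $\alpha\in\mathsf{P}(W)$ is proof-irrelevant if for some (equivalently, every) choice of weak products $W\xleftarrow{\mathsf{r}_1}U\xrightarrow{\mathsf{r}_2}W$, $X_i\xleftarrow{\mathsf{q}^i_1}W_i\xrightarrow{\mathsf{q}^i_2}X_i$ and arrows $t_i:U\to W_i$ with $\mathsf{q}^i_jt_i=\mathsf{p}_i\mathsf{r}_j$ ($j=1,2$) one has $\mathsf{P}_{\mathsf{r}_1}\alpha\wedge\bigwedge_{i}\mathsf{P}_{t_i}\delta^{(\mathsf{q}^i_1,\mathsf{q}^i_2)}\le\mathsf{P}_{\mathsf{r}_2}\alpha$. **Product completion and strictification.** $\mathscr{C}_s$ has as objects finite lists $[X_1,\dots,X_n]$ of objects of $\mathscr{C}$; an arrow $[X_1,\dots,X_n]\to[Y_1,\dots,Y_m]$ is a pair $(f,s)$ with $s:\{1,\dots,m\}\to\{1,\dots,n\}$ a function and $f=[f_1,\dots,f_m]$, $f_j:X_{s(j)}\to Y_j$. Finite products are list concatenation; $[f]:[X]\to[Y]$ is the arrow given by $f:X\to Y$. The strictification $\mathsf{P}^{s}:\mathscr{C}_s^{\mathrm{op}}\to\mathsf{InfSL}$: for a non-empty list, $\mathsf{P}^{s}[X_1,\dots,X_n]$ is the inf-semilattice of proof-irrelevant elements of weak products of $X_1,\dots,X_n$, where those of different weak products $W,W'$ are identified via the isomorphisms $\mathsf{P}_h$ for any $h:W\to W'$ commuting with projections (independent of $h$); $\mathsf{P}^{s}([\ ])=\{*\}$. In particular $\mathsf{P}^{s}[X]=\mathsf{P}(X)$.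 For an arrow $(f,s):[X_1,\dots,X_n]\to[Y_1,\dots,Y_m]$ of $\mathscr{C}_s$ (with $s:\{1,\dots,m\}\to\{1,\dots,n\}$ and $f=[f_1,\dots,f_m]$, $f_j:X_{s(j)}\to Y_j$) with $m\ge1$, $\mathsf{P}^{s}_{(f,s)}$ sends the class of $\alpha\in\mathsf{P}(V)$ ($\mathsf{p}'_j:V\to Y_j$ a weak product) to the class of $\mathsf{P}_g\alpha$, for any $g:W\to V$ with $\mathsf{p}'_jg=f_j\mathsf{p}_{s(j)}$, $\mathsf{p}_i:W\to X_i$ a weak product; $*$ is sent to the top. $\delta_{[X]}\in\mathsf{P}^{s}[X,X]$ is the class of the elements $\delta^{(\mathsf{p}_1,\mathsf{p}_2)}$. **Equivalence relations.** For a functor $Q:\mathscr{D}^{\mathrm{op}}\to\mathsf{InfSL}$ on a category with strict finite products, a $Q$-equivalence relation on $X$ is $\rho\in Q(X\times X)$ with $\top_X\le Q_{\Delta_X}\rho$, $Q_{\langle p_2,p_1\rangle}\rho\le\rho$, $Q_{\langle p_1,p_2\rangle}\rho\wedge Q_{\langle p_2,p_3\rangle}\rho\le Q_{\langle p_1,p_3\rangle}\rho$; its descent data are $\mathrm{Des}_\rho=\{\alpha\in Q(X): Q_{p_1}\alpha\wedge\rho\le Q_{p_2}\alpha\}$. For a biased elementary doctrine $\mathsf{P}$, a $\mathsf{P}$-equivalence relation on $X\in\mathscr{C}$ is a $\mathsf{P}^{s}$-equivalence relation $\rho\in\mathsf{P}^{s}[X,X]$ on $[X]$, and $\mathrm{Des}_\rho\subseteq\mathsf{P}^s[X]=\mathsf{P}(X)$.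 **Biased elementary quotient completion.** Objects of $\overline{\mathscr{C}}$ are pairs $(X,\rho)$ with $\rho$ a $\mathsf{P}$-equivalence relation on $X\in\mathscr{C}$; arrows $(X,\rho)\to(Y,\sigma)$ are equivalence classes $\lfloor f\rceil$ of arrows $f:X\to Y$ of $\mathscr{C}$ with $\rho\le\mathsf{P}^{s}_{[f]\times[f]}\sigma$, where $f\sim f'$ iff $\rho\le\mathsf{P}^{s}_{[f]\times[f']}\sigma$. $\overline{\mathsf{P}}(X,\rho)=\mathrm{Des}_\rho$ and $\overline{\mathsf{P}}_{\lfloor f\rceil}=\mathsf{P}_f$. **The 1-arrow $(J,j)$.** $J:\mathscr{C}\to\overline{\mathscr{C}}$ sends $X$ to $(X,\delta_{[X]})$ and $f$ to $\lfloor f\rceil$; $j_X=1_{\mathsf{P}(X)}:\mathsf{P}(X)\to\overline{\mathsf{P}}(X,\delta_{[X]})=\mathsf{P}(X)$. **Elementary doctrine (strict).** A functor $R:\mathscr{D}^{\mathrm{op}}\to\mathsf{InfSL}$, $\mathscr{D}$ with strict finite products, such that for every $X$ there is $\delta_X\in R(X\times X)$ with: $\top_X\le R_{\Delta_X}\delta_X$; $R_{p_1}\alpha\wedge\delta_X\le R_{p_2}\alpha$ for all $\alpha\in R(X)$; $R_{\langle p_1,p_3\rangle}\delta_X\wedge R_{\langle p_2,p_4\rangle}\delta_Y\le\delta_{X\times Y}$ for all $X,Y$. **Quotients (in an elementary doctrine $R$).** A quotient of an $R$-equivalence relation $\rho$ on $X$ is $q:X\to C$ with $\rho\le R_{q\times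 q}\delta_C$ such that every $g:X\to Z$ with $\rho\le R_{g\times g}\delta_Z$ factors uniquely as $g=hq$. It is effective if $\rho=R_{q\times q}\delta_C$; of effective descent if $R_q:R(C)\to\mathrm{Des}_\rho$ is an isomorphism; stable if for every arrow $f:C'\to C$ and every pullback square of $q$ along $f$ the pulled back arrow $q':X'\to C'$ is a quotient of an $R$-equivalence relation. **Comprehensions.** For $\alpha\in\mathsf{P}(X)$, a comprehension of $\alpha$ is $c:C\to X$ with $\top_C\le\mathsf{P}_c\alpha$ such that every $f:Y\to X$ with $\top_Y\le\mathsf{P}_f\alpha$ factors as $f=ch$ for some $h:Y\to C$; it is strict if $h$ is always unique, weak if uniqueness is not required. It is full if $\alpha\le\beta$ whenever $\top_C\le\mathsf{P}_c\beta$. The doctrine ''has'' such comprehensions if every element of every fiber has one. **Comprehensive diagonals.** An elementary doctrine $R$ has comprehensive diagonals if for all $f,g:A\to X$: $\top_A\le R_{\langle f,g\rangle}\delta_X$ iff $f=g$. A biased elementary doctrine $\mathsf{P}$ has comprehensive diagonals if for all $f,g:A\to X$: $f=g$ iff there exist a weak product $X\xleftarrow{\mathsf{p}_1}W\xrightarrow{\mathsf{p}_2}X$ and $h:A\to W$ with $\mathsf{p}_1h=f$, $\mathsf{p}_2h=g$ and $\top_A\le\mathsf{P}_h\delta^{(\mathsf{p}_1,\mathsf{p}_2)}$. **The 2-category $\mathbf{QD}$.** Objects: elementary doctrines with full (strict) comprehensions, comprehensive diagonals, and in which every equivalence relation has a quotient, quotients being stable, effective and of effective descent. A 1-arrow $(G,g):Q\to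 R$ is a finite-product-preserving functor $G$ between the base categories and a natural transformation $g:Q\Rightarrow R\circ G^{\mathrm{op}}$ whose components preserve finite meets, such that $g_{X\times X}(\delta_X)=R_{\langle G(p_1),G(p_2)\rangle}\delta_{G(X)}$, and which preserves comprehensions and quotients. A 2-arrow $\theta:(G,g)\to(H,h)$ is a natural transformation $\theta:G\Rightarrow H$ with $g_X(\alpha)\le R_{\theta_X}(h_X(\alpha))$ for all $X$ and $\alpha\in Q(X)$. $\mathbf{QD}(Q,R)$ is the hom-category. **The category $\mathbf{Lco}(\mathsf{P},R)$.** Objects are left covering 1-arrows: pairs $(F,f)$ with $F:\mathscr{C}\to\mathscr{D}$ a functor and $f:\mathsf{P}\Rightarrow R\circ F^{\mathrm{op}}$ a natural transformation such that (a) for every weak product $X\xleftarrow{\mathsf{p}_1}W\xrightarrow{\mathsf{p}_2}Y$ in $\mathscr{C}$, the arrow $\langle F(\mathsf{p}_1),F(\mathsf{p}_2)\rangle:F(W)\to F(X)\times F(Y)$ is a quotient of an $R$-equivalence relation; likewise, for every weak terminal object $T$ of $\mathscr{C}$, the arrow $F(T)\to1$ is a quotient of an $R$-equivalence relation; (b) each $f_X$ preserves all the structure, namely finite meets, and for every weak product $X\xleftarrow{\mathsf{p}_1}W\xrightarrow{\mathsf{p}_2}X$, $f_W(\delta^{(\mathsf{p}_1,\mathsf{p}_2)})=R_{\langle F(\mathsf{p}_1),F(\mathsf{p}_2)\rangle}(\delta_{F(X)})$; (c) if $c:X\to A$ is a weak comprehension of $\alpha\in\mathsf{P}(A)$, then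 $F(c)$ factors through the comprehension of $f_A(\alpha)\in R(F(A))$ via a quotient of an $R$-equivalence relation. Arrows $(F,f)\to(F',f')$ are natural transformations $\theta:F\Rightarrow F'$ with $f_X(\alpha)\le R_{\theta_X}(f'_X(\alpha))$ for all $X$ and $\alpha\in\mathsf{P}(X)$. *)

(* Defs.v *)
From mathcomp Require Import all_boot.
From mathcomp Require Import boolp.

Set Implicit Arguments.
Unset Strict Implicit.
Unset Printing Implicit Defensive.

Declare Scope cat_scope.
Delimit Scope cat_scope with cat.
Local Open Scope cat_scope.

Record Category := MkCategory {
  Ob :> Type;
  Hom : Ob -> Ob -> Type;
  idm : forall X, Hom X X;
  cmp : forall X Y Z, Hom Y Z -> Hom X Y -> Hom X Z;
  cmp1m : forall X Y (f : Hom X Y), cmp (idm Y) f = f;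
  cmpm1 : forall X Y (f : Hom X Y), cmp f (idm X) = f;
  cmpA : forall X Y Z T (h : Hom Z T) (g : Hom Y Z) (f : Hom X Y),
    cmp h (cmp g f) = cmp (cmp h g) f }.

Arguments Hom {c} X Y.
Arguments idm {c} X.

Notation "g ∘ f" := (cmp g f) (at level 40, left associativity) : cat_scope.

Definition is_iso (C : Category) (X Y : C) (f : Hom X Y) : Prop :=
  exists g : Hom Y X, g ∘ f = idm X /\ f ∘ g = idm Y.

Definition is_pullback (C : Category) (X Y Z W : C) (f : Hom X Z) (g : Hom Y Z)
    (p : Hom W X) (q : Hom W Y) : Prop :=
  f ∘ p = g ∘ q /\
  forall (V : C) (a : Hom V X) (b : Hom V Y), f ∘ a = g ∘ b ->
    exists! h : Hom V W, p ∘ h = a /\ q ∘ h = b.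

Record Functor (C D : Category) := MkFunctor {
  fob :> C -> D;
  fmap : forall X Y : C, Hom X Y -> Hom (fob X) (fob Y);
  fmap1 : forall X : C, fmap (idm X) = idm (fob X);
  fmapM : forall (X Y Z : C) (g : Hom Y Z) (f : Hom X Y),
    fmap (g ∘ f) = fmap g ∘ fmap f }.

Record NatTrans (C D : Category) (F G : Functor C D) := MkNatTrans {
  ntc :> forall X : C, Hom (F X) (G X);
  ntN : forall (X Y : C) (f : Hom X Y), ntc Y ∘ fmap F f = fmap G f ∘ ntc X }.

Lemma nat_eq (C D : Category) (F G : Functor C D) (s t : NatTrans F G) :
  (forall X, s X = t X) -> s = t.
Proof.
case: s t => [s sN] [t tN] /= st.
have {}st : s = t by apply: functional_extensionality_dep.
by subst t; congr MkNatTrans; apply: Prop_irrelevance.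
Qed.

Definition idF (C : Category) : Functor C C :=
  @MkFunctor C C (fun X => X) (fun _ _ f => f)
    (fun _ => erefl) (fun _ _ _ _ _ => erefl).

Program Definition compF (C D E : Category) (G : Functor D E) (F : Functor C D)
    : Functor C E :=
  @MkFunctor C E (fun X => G (F X)) (fun _ _ f => fmap G (fmap F f)) _ _.
Next Obligation. by rewrite !fmap1. Qed.
Next Obligation. by rewrite !fmapM. Qed.

Program Definition nat_id (C D : Category) (F : Functor C D) : NatTrans F F :=
  @MkNatTrans C D F F (fun X => idm (F X)) _.
Next Obligation. by rewrite cmp1m cmpm1. Qed.

Program Definition nat_comp (C D : Category) (F G H : Functor C D)
    (t : NatTrans G H) (s : NatTrans F G) : NatTrans F H :=
  @MkNatTrans C D F H (fun X => t X ∘ s X) _.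
Next Obligation. by rewrite -cmpA ntN cmpA ntN cmpA. Qed.

Program Definition nat_whisker (B C D : Category) (F G : Functor C D)
    (t : NatTrans F G) (K : Functor B C) : NatTrans (compF F K) (compF G K) :=
  @MkNatTrans B D (compF F K) (compF G K) (fun X => t (K X)) _.
Next Obligation. exact: ntN. Qed.

Definition nat_iso (C D : Category) (F G : Functor C D) : Prop :=
  exists t : NatTrans F G, forall X, is_iso (t X).

Definition is_equivalence (C D : Category) (F : Functor C D) : Prop :=
  exists G : Functor D C,
    nat_iso (idF C) (compF G F) /\ nat_iso (compF F G) (idF D).

Program Definition full_sub (A : Category) (S : A -> Prop) : Category :=
  @MkCategory {X : A | S X} (fun X Y => Hom (sval X) (sval Y))
    (fun X => idm (sval X)) (fun _ _ _ g f => g ∘ f) _ _ _.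
Next Obligation. exact: cmp1m. Qed.
Next Obligation. exact: cmpm1. Qed.
Next Obligation. exact: cmpA. Qed.

Program Definition restrictF (A B : Category) (F : Functor A B)
    (S : A -> Prop) (T : B -> Prop) (FST : forall X, S X -> T (F X))
    : Functor (full_sub S) (full_sub T) :=
  @MkFunctor (full_sub S) (full_sub T)
    (fun X => exist _ (F (sval X)) (FST _ (proj2_sig X)))
    (fun X Y f => fmap F f) _ _.
Next Obligation. exact: fmap1. Qed.
Next Obligation. exact: fmapM. Qed.

Record FinProd (C : Category) := MkFinProd {
  one : C;
  bang : forall X : C, Hom X one;
  bang_uniq : forall (X : C) (f : Hom X one), f = bang X;
  prd : C -> C -> C;
  pr1 : forall X Y : C, Hom (prd X Y) X;
  pr2 : forall X Y : C, Hom (prd X Y) Y;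
  pair : forall Z X Y : C, Hom Z X -> Hom Z Y -> Hom Z (prd X Y);
  pair1 : forall (Z X Y : C) (f : Hom Z X) (g : Hom Z Y),
    pr1 X Y ∘ pair f g = f;
  pair2 : forall (Z X Y : C) (f : Hom Z X) (g : Hom Z Y),
    pr2 X Y ∘ pair f g = g;
  pair_uniq : forall (Z X Y : C) (h : Hom Z (prd X Y)),
    h = pair (pr1 X Y ∘ h) (pr2 X Y ∘ h) }.

Definition diag (C : Category) (FP : FinProd C) (X : C) : Hom X (prd FP X X) :=
  pair FP (idm X) (idm X).

Definition pmap (C : Category) (FP : FinProd C) (X Y X' Y' : C)
    (f : Hom X X') (g : Hom Y Y') : Hom (prd FP X Y) (prd FP X' Y') :=
  pair FP (f ∘ pr1 FP X Y) (g ∘ pr2 FP X Y).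

(** The orders of the library are boolean and live on choice types; the posets
    here are arbitrary. *)

Record InfSL := MkInfSL {
  car :> Type;
  ile : car -> car -> Prop;
  itop : car;
  imeet : car -> car -> car;
  ile_refl : forall x, ile x x;
  ile_trans : forall y x z, ile x y -> ile y z -> ile x z;
  ile_anti : forall x y, ile x y -> ile y x -> x = y;
  ile_top : forall x, ile x itop;
  imeet_l : forall x y, ile (imeet x y) x;
  imeet_r : forall x y, ile (imeet x y) y;
  imeet_glb : forall x y z, ile z x -> ile z y -> ile z (imeet x y) }.

Arguments ile {i} x y.
Arguments itop {i}.
Arguments imeet {i} x y.

Notation "x ⊑ y" := (ile x y) (at level 70, no associativity) : cat_scope.
Notation "x ⊓ y" := (imeet x y) (at level 50, left associativity) : cat_scope.

Definition isl_hom (L M : InfSL) (f : L -> M) : Prop :=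
  f itop = itop /\ forall x y, f (x ⊓ y) = f x ⊓ f y.

Definition isl_iso (L M : InfSL) (f : L -> M) : Prop :=
  isl_hom f /\ exists g : M -> L, isl_hom g /\ cancel f g /\ cancel g f.

Definition unit_isl : InfSL.
Proof.
by exists unit (fun _ _ => True) tt (fun _ _ => tt); repeat case.
Defined.

Program Definition sub_isl (L : InfSL) (S : L -> Prop) (S1 : S itop)
    (SM : forall x y, S x -> S y -> S (x ⊓ y)) : InfSL :=
  @MkInfSL {x : L | S x} (fun x y => sval x ⊑ sval y)
    (exist _ itop S1)
    (fun x y => exist _ (sval x ⊓ sval y)
                  (SM _ _ (proj2_sig x) (proj2_sig y))) _ _ _ _ _ _ _.
Next Obligation. exact: ile_refl. Qed.
Next Obligation. exact: ile_trans H H0. Qed.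
Next Obligation. by apply: eq_exist; apply: ile_anti. Qed.
Next Obligation. exact: ile_top. Qed.
Next Obligation. exact: imeet_l. Qed.
Next Obligation. exact: imeet_r. Qed.
Next Obligation. exact: imeet_glb. Qed.

Section InfSLTheory.
Variable L : InfSL.
Implicit Types x y z t : L.

Lemma ile_eq x y : x = y -> x ⊑ y.
Proof. by move=> ->; apply: ile_refl. Qed.

Lemma imeetS x y z t : x ⊑ z -> y ⊑ t -> x ⊓ y ⊑ z ⊓ t.
Proof.
move=> xz yt; apply: imeet_glb.
  exact: ile_trans (imeet_l _ _) xz.
exact: ile_trans (imeet_r _ _) yt.
Qed.

Lemma ile_meetl x y z : x ⊑ z -> x ⊓ y ⊑ z.
Proof. exact: ile_trans (imeet_l _ _). Qed.

Lemma ile_meetr x y z : y ⊑ z -> x ⊓ y ⊑ z.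
Proof. exact: ile_trans (imeet_r _ _). Qed.

Lemma ile_top_trans x y : itop ⊑ y -> x ⊑ y.
Proof. exact: ile_trans (ile_top _). Qed.

Lemma ile_bigP (I : finType) (F : I -> L) x :
  x ⊑ \big[imeet/itop]_(i : I) F i <-> forall i, x ⊑ F i.
Proof.
split=> [xF i | xF].
  apply: (ile_trans xF); rewrite unlock.
  have : i \in index_enum I by apply: mem_index_enum.
  elim: (index_enum I) => //= j r IHr; rewrite inE => /predU1P[->|/IHr].
    exact: imeet_l.
  by move=> rF; apply: ile_meetr.
by elim/big_rec: _ => [|i y _ xy]; [apply: ile_top | apply: imeet_glb].
Qed.

Lemma big_ile (I : finType) (F : I -> L) i :
  \big[imeet/itop]_(i : I) F i ⊑ F i.
Proof. by move: i; apply/ile_bigP/ile_refl. Qed.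

End InfSLTheory.

Lemma isl_hom_mono (L M : InfSL) (f : L -> M) (x y : L) :
  isl_hom f -> x ⊑ y -> f x ⊑ f y.
Proof.
move=> [_ fM] xy.
have <- : x ⊓ y = x.
  by apply: ile_anti; [apply: imeet_l | apply: imeet_glb => //; apply: ile_refl].
by rewrite fM; apply: imeet_r.
Qed.

Record Doctrine (C : Category) := MkDoctrine {
  fib :> C -> InfSL;
  rx : forall X Y : C, Hom X Y -> fib Y -> fib X;
  rx_hom : forall (X Y : C) (f : Hom X Y), isl_hom (rx f);
  rx1 : forall (X : C) (a : fib X), rx (idm X) a = a;
  rxM : forall (X Y Z : C) (g : Hom Y Z) (f : Hom X Y) (a : fib Z),
    rx (g ∘ f) a = rx f (rx g a) }.

Arguments rx {C} d {X Y} f a.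

Section DoctrineTheory.
Variables (C : Category) (P : Doctrine C).

Lemma rx_top (X Y : C) (f : Hom X Y) : rx P f itop = itop.
Proof. by case: (rx_hom P f). Qed.

Lemma rx_meet (X Y : C) (f : Hom X Y) (a b : P Y) :
  rx P f (a ⊓ b) = rx P f a ⊓ rx P f b.
Proof. by case: (rx_hom P f) => _ ->. Qed.

Lemma rx_mono (X Y : C) (f : Hom X Y) (a b : P Y) :
  a ⊑ b -> rx P f a ⊑ rx P f b.
Proof. exact: isl_hom_mono (rx_hom P f). Qed.

Lemma rx_ge_top (X Y : C) (f : Hom X Y) (a : P Y) :
  itop ⊑ a -> itop ⊑ rx P f a.
Proof. by move=> a1; rewrite -(rx_top f); apply: rx_mono. Qed.

Lemma rx_big (X Y : C) (f : Hom X Y) (I : finType) (F : I -> P Y) :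
  rx P f (\big[imeet/itop]_(i : I) F i) = \big[imeet/itop]_(i : I) rx P f (F i).
Proof.
by elim/big_rec2: _ => [|i y z _ <-]; rewrite ?rx_top // rx_meet.
Qed.

End DoctrineTheory.

Definition is_weak_comprehension (C : Category) (P : Doctrine C) (X A : C)
    (a : P A) (c : Hom X A) : Prop :=
  itop ⊑ rx P c a /\
  forall (Y : C) (f : Hom Y A), itop ⊑ rx P f a -> exists h, f = c ∘ h.

Definition is_comprehension (C : Category) (P : Doctrine C) (X A : C)
    (a : P A) (c : Hom X A) : Prop :=
  itop ⊑ rx P c a /\
  forall (Y : C) (f : Hom Y A), itop ⊑ rx P f a -> exists! h, f = c ∘ h.

Definition is_full (C : Category) (P : Doctrine C) (X A : C)
    (a : P A) (c : Hom X A) : Prop :=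
  forall b : P A, itop ⊑ rx P c b -> a ⊑ b.

Definition has_full_weak_comprehensions (C : Category) (P : Doctrine C) : Prop :=
  forall (A : C) (a : P A), exists (X : C) (c : Hom X A),
    is_weak_comprehension a c /\ is_full a c.

Definition has_full_comprehensions (C : Category) (P : Doctrine C) : Prop :=
  forall (A : C) (a : P A), exists (X : C) (c : Hom X A),
    is_comprehension a c /\ is_full a c.

(** The triple product is taken as [(X * X) * X]. *)

Section EquivalenceRelations.
Variables (C : Category) (FP : FinProd C) (Q : Doctrine C).

Record is_eqrel (X : C) (r : Q (prd FP X X)) : Prop := MkEqrel {
  eqrel_refl : itop ⊑ rx Q (diag FP X) r;
  eqrel_sym : rx Q (pair FP (pr2 FP X X) (pr1 FP X X)) r ⊑ r;
  eqrel_trans :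
    let p1 := pr1 FP X X ∘ pr1 FP (prd FP X X) X in
    let p2 := pr2 FP X X ∘ pr1 FP (prd FP X X) X in
    let p3 := pr2 FP (prd FP X X) X in
    rx Q (pair FP p1 p2) r ⊓ rx Q (pair FP p2 p3) r ⊑ rx Q (pair FP p1 p3) r }.

Definition is_des (X : C) (r : Q (prd FP X X)) (a : Q X) : Prop :=
  rx Q (pr1 FP X X) a ⊓ r ⊑ rx Q (pr2 FP X X) a.

Lemma is_des_top (X : C) (r : Q (prd FP X X)) : is_des r itop.
Proof. by rewrite /is_des !rx_top; apply: ile_top. Qed.

Lemma is_des_meet (X : C) (r : Q (prd FP X X)) (a b : Q X) :
  is_des r a -> is_des r b -> is_des r (a ⊓ b).
Proof.
rewrite /is_des !rx_meet => da db; apply: imeet_glb.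
  apply: ile_trans da; apply: imeetS; [exact: imeet_l | exact: ile_refl].
apply: ile_trans db; apply: imeetS; [exact: imeet_r | exact: ile_refl].
Qed.

Definition Des (X : C) (r : Q (prd FP X X)) : InfSL :=
  sub_isl (is_des_top r) (@is_des_meet X r).

End EquivalenceRelations.

Record ElemDoctrine (C : Category) := MkElemDoctrine {
  ed_doc :> Doctrine C;
  ed_fp : FinProd C;
  eqd : forall X : C, ed_doc (prd ed_fp X X);
  eqd_refl : forall X : C, itop ⊑ rx ed_doc (diag ed_fp X) (eqd X);
  eqd_subst : forall (X : C) (a : ed_doc X),
    rx ed_doc (pr1 ed_fp X X) a ⊓ eqd X ⊑ rx ed_doc (pr2 ed_fp X X) a;
  eqd_prod : forall X Y : C,
    let XY := prd ed_fp X Y in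
    let p1 := pr1 ed_fp X Y ∘ pr1 ed_fp XY XY in
    let p2 := pr2 ed_fp X Y ∘ pr1 ed_fp XY XY in
    let p3 := pr1 ed_fp X Y ∘ pr2 ed_fp XY XY in
    let p4 := pr2 ed_fp X Y ∘ pr2 ed_fp XY XY in
    rx ed_doc (pair ed_fp p1 p3) (eqd X) ⊓ rx ed_doc (pair ed_fp p2 p4) (eqd Y)
      ⊑ eqd XY }.

Section Quotients.
Variables (C : Category) (R : ElemDoctrine C).
Let FP := ed_fp R.

Definition is_quotient (X Y : C) (r : R (prd FP X X)) (q : Hom X Y) : Prop :=
  r ⊑ rx R (pmap FP q q) (eqd R Y) /\
  forall (Z : C) (g : Hom X Z), r ⊑ rx R (pmap FP g g) (eqd R Z) ->
    exists! h : Hom Y Z, g = h ∘ q.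

Definition is_quotient_map (X Y : C) (q : Hom X Y) : Prop :=
  exists r : R (prd FP X X), is_eqrel r /\ is_quotient r q.

Definition is_effective (X Y : C) (r : R (prd FP X X)) (q : Hom X Y) : Prop :=
  r = rx R (pmap FP q q) (eqd R Y).

Definition is_effective_descent (X Y : C) (r : R (prd FP X X)) (q : Hom X Y)
    : Prop :=
  exists qdes : forall b : R Y, is_des r (rx R q b),
    isl_iso (fun b : R Y => exist _ (rx R q b) (qdes b) : Des r).

Definition is_stable (X Y : C) (q : Hom X Y) : Prop :=
  forall (X' Y' : C) (f : Hom Y' Y) (f' : Hom X' X) (q' : Hom X' Y'),
    is_pullback q f f' q' -> is_quotient_map q'.

Definition comprehensive_diagonals : Prop :=
  forall (A X : C) (f g : Hom A X),
    itop ⊑ rx R (pair FP f g) (eqd R X) <-> f = g.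

Record in_QD : Prop := MkInQD {
  QD_comprehension : has_full_comprehensions R;
  QD_diagonals : comprehensive_diagonals;
  QD_quotient : forall (X : C) (r : R (prd FP X X)), is_eqrel r ->
    exists (Y : C) (q : Hom X Y), is_quotient r q;
  QD_good_quotient : forall (X Y : C) (r : R (prd FP X X)) (q : Hom X Y),
    is_eqrel r -> is_quotient r q ->
    [/\ is_stable q, is_effective r q & is_effective_descent r q] }.

End Quotients.

Record OneArrow (C D : Category) (P : Doctrine C) (R : Doctrine D) :=
  MkOneArrow {
  oa_fun :> Functor C D;
  oa_map : forall X : C, P X -> R (oa_fun X);
  oa_hom : forall X : C, isl_hom (@oa_map X);
  oa_nat : forall (X Y : C) (f : Hom X Y) (a : P Y),
    oa_map (rx P f a) = rx R (fmap oa_fun f) (oa_map a) }.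

Arguments oa_map {C D P R} o {X} a.

Record TwoArrow (C D : Category) (P : Doctrine C) (R : Doctrine D)
    (G H : OneArrow P R) := MkTwoArrow {
  ta_nat :> NatTrans G H;
  ta_le : forall (X : C) (a : P X), oa_map G a ⊑ rx R (ta_nat X) (oa_map H a) }.

Lemma ta_eq (C D : Category) (P : Doctrine C) (R : Doctrine D)
    (G H : OneArrow P R) (s t : TwoArrow G H) :
  (forall X, s X = t X) -> s = t.
Proof.
case: s t => [s sP] [t tP] /= /nat_eq st.
by subst t; congr MkTwoArrow; apply: Prop_irrelevance.
Qed.

Section OneArrowCategory.
Variables (C D : Category) (P : Doctrine C) (R : Doctrine D).

Program Definition ta_id (G : OneArrow P R) : TwoArrow G G :=
  @MkTwoArrow C D P R G G (nat_id G) _.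
Next Obligation. by rewrite rx1; apply: ile_refl. Qed.

Program Definition ta_comp (G H K : OneArrow P R)
    (t : TwoArrow H K) (s : TwoArrow G H) : TwoArrow G K :=
  @MkTwoArrow C D P R G K (nat_comp t s) _.
Next Obligation.
rewrite rxM; apply: (ile_trans (ta_le s a)).
exact: rx_mono (ta_le t a).
Qed.

Program Definition OneArrowCat : Category :=
  @MkCategory (OneArrow P R) (@TwoArrow C D P R) ta_id ta_comp _ _ _.
Next Obligation. by apply: ta_eq => Z /=; rewrite cmp1m. Qed.
Next Obligation. by apply: ta_eq => Z /=; rewrite cmpm1. Qed.
Next Obligation. by apply: ta_eq => U /=; rewrite cmpA. Qed.

End OneArrowCategory.

Section Precomposition.
Variables (B C D : Category).
Variables (P : Doctrine B) (Q : Doctrine C) (R : Doctrine D).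

Program Definition oa_comp (G : OneArrow Q R) (K : OneArrow P Q)
    : OneArrow P R :=
  @MkOneArrow B D P R (compF G K) (fun X a => oa_map G (oa_map K a)) _ _.
Next Obligation.
have [G1 GM] := oa_hom G (K X); have [K1 KM] := oa_hom K X.
by split=> [|x y]; rewrite ?K1 ?G1 // KM GM.
Qed.
Next Obligation. by rewrite !oa_nat. Qed.

Program Definition ta_whisker (G H : OneArrow Q R) (t : TwoArrow G H)
    (K : OneArrow P Q) : TwoArrow (oa_comp G K) (oa_comp H K) :=
  @MkTwoArrow B D P R (oa_comp G K) (oa_comp H K) (nat_whisker t K) _.
Next Obligation. exact: ta_le. Qed.

Program Definition precomp (K : OneArrow P Q)
    : Functor (OneArrowCat Q R) (OneArrowCat P R) :=
  @MkFunctor (OneArrowCat Q R) (OneArrowCat P R)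
    (fun G => oa_comp G K) (fun _ _ t => ta_whisker t K) _ _.
Next Obligation. exact: ta_eq. Qed.
Next Obligation. exact: ta_eq. Qed.

End Precomposition.

Record QD := MkQD {
  QD_base : Category;
  QD_doc :> ElemDoctrine QD_base;
  QD_ok : in_QD QD_doc }.

Section QDArrows.
Variables (C D : Category) (Q : ElemDoctrine C) (R : ElemDoctrine D).

Definition prod_cmp (G : Functor C D) (X Y : C)
    : Hom (G (prd (ed_fp Q) X Y)) (prd (ed_fp R) (G X) (G Y)) :=
  pair (ed_fp R) (fmap G (pr1 (ed_fp Q) X Y)) (fmap G (pr2 (ed_fp Q) X Y)).

Definition preserves_products (G : Functor C D) : Prop :=
  is_iso (bang (ed_fp R) (G (one (ed_fp Q)))) /\
  forall X Y : C, is_iso (prod_cmp G X Y).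

(** Reindexing along the comparison arrow identifies an element of
    [R (G X * G X)] with one of [R (G (X * X))]; through it [G r] is a relation
    on [G X] in [oa_quotient]. *)
Record is_QD_arrow (G : OneArrow Q R) : Prop := MkIsQDArrow {
  oa_products : preserves_products G;
  oa_eqd : forall X : C,
    oa_map G (eqd Q X) = rx R (prod_cmp G X X) (eqd R (G X));
  oa_comprehension : forall (X A : C) (a : Q A) (c : Hom X A),
    is_comprehension a c -> is_comprehension (oa_map G a) (fmap G c);
  oa_quotient : forall (X Y : C) (r : Q (prd (ed_fp Q) X X)) (q : Hom X Y),
    is_eqrel r -> is_quotient r q ->
    forall s : R (prd (ed_fp R) (G X) (G X)),
      rx R (prod_cmp G X X) s = oa_map G r ->
      is_quotient s (fmap G q) }.

End QDArrows.

Definition QD_hom (Q R : QD) : Category := 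
  full_sub (A := OneArrowCat Q R) (@is_QD_arrow _ _ Q R).

Section Lists.
Variable T : Type.

Fixpoint pos (l : seq T) : finType :=
  if l is _ :: l' then (option (pos l') : finType) else (void : finType).

Fixpoint at_ (l : seq T) : pos l -> T :=
  match l return pos l -> T with
  | [::] => fun i : void => match i with end
  | x :: l' => fun i : option (pos l') => if i is Some j then at_ j else x
  end.

End Lists.

Record weak_prod (C : Category) (l : seq C) := MkWeakProd {
  wp_ob :> C;
  wpr : forall i : pos l, Hom wp_ob (at_ i);
  wp_ex : forall (Z : C) (f : forall i : pos l, Hom Z (at_ i)),
    exists h : Hom Z wp_ob, forall i, wpr i ∘ h = f i }.

Definition wp1 (C : Category) (X Y : C) (w : weak_prod [:: X; Y]) : Hom w X :=
  @wpr C [:: X; Y] w None.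
Definition wp2 (C : Category) (X Y : C) (w : weak_prod [:: X; Y]) : Hom w Y :=
  @wpr C [:: X; Y] w (Some None).

Definition has_weak_finite_products (C : Category) : Prop :=
  forall l : seq C, inhabited (weak_prod l).

Record BiasedPrimary (C : Category) := MkBiasedPrimary {
  bp_doc :> Doctrine C;
  bp_wp : has_weak_finite_products C }.

Record BiasedElem (C : Category) := MkBiasedElem {
  be_doc :> BiasedPrimary C;
  bd : forall (X : C) (w : weak_prod [:: X; X]), be_doc w;
  bd_refl : forall (X : C) (w : weak_prod [:: X; X]) (d : Hom X w),
    wp1 w ∘ d = idm X -> wp2 w ∘ d = idm X -> itop ⊑ rx be_doc d (bd w);
  bd_subst : forall (X : C) (w : weak_prod [:: X; X]) (a : be_doc X),
    rx be_doc (wp1 w) a ⊓ bd w ⊑ rx be_doc (wp2 w) a;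
  bd_arr : forall (X X' : C) (w : weak_prod [:: X; X])
      (w' : weak_prod [:: X'; X']) (f : Hom X' X) (g : Hom w' w),
    wp1 w ∘ g = f ∘ wp1 w' -> wp2 w ∘ g = f ∘ wp2 w' ->
    bd w' ⊑ rx be_doc g (bd w);
  bd_irr : forall (X : C) (w : weak_prod [:: X; X])
      (u : weak_prod [:: wp_ob w; wp_ob w]) (t t' : Hom u w),
    wp1 w ∘ t = wp1 w ∘ wp1 u -> wp2 w ∘ t = wp1 w ∘ wp2 u ->
    wp1 w ∘ t' = wp2 w ∘ wp1 u -> wp2 w ∘ t' = wp2 w ∘ wp2 u ->
    rx be_doc (wp1 u) (bd w) ⊓ rx be_doc t (bd w) ⊓ rx be_doc t' (bd w)
      ⊑ rx be_doc (wp2 u) (bd w) }.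

Definition biased_comprehensive_diagonals (C : Category) (P : BiasedElem C)
    : Prop :=
  forall (A X : C) (f g : Hom A X),
    f = g <-> exists (w : weak_prod [:: X; X]) (h : Hom A w),
      [/\ wp1 w ∘ h = f, wp2 w ∘ h = g & itop ⊑ rx P h (bd P w)].

Definition proof_irrelevant (C : Category) (P : BiasedElem C) (l : seq C)
    (w : weak_prod l) (a : P w) : Prop :=
  exists (u : weak_prod [:: wp_ob w; wp_ob w])
         (v : forall i : pos l, weak_prod [:: at_ i; at_ i])
         (t : forall i : pos l, Hom u (v i)),
    (forall i, wp1 (v i) ∘ t i = wpr w i ∘ wp1 u) /\
    (forall i, wp2 (v i) ∘ t i = wpr w i ∘ wp2 u) /\
    rx P (wp1 u) a ⊓ \big[imeet/itop]_(i : pos l) rx P (t i) (bd P (v i))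
      ⊑ rx P (wp2 u) a.

Section Lifts.
Variable C : Category.

Definition two (X Y Z : C) (f : Hom Z X) (g : Hom Z Y) (i : pos [:: X; Y])
    : Hom Z (at_ i) :=
  match i as i0 return Hom Z (@at_ C [:: X; Y] i0) with
  | None => f
  | Some None => g
  | Some (Some v) => match v with end
  end.

Lemma pos2P (X Y : C) (S : pos [:: X; Y] -> Prop) :
  S None -> S (Some None) -> forall i, S i.
Proof. by move=> S1 S2 [[[]|]|]. Qed.

Definition wlift (l : seq C) (w : weak_prod l) (Z : C)
    (f : forall i : pos l, Hom Z (at_ i)) : Hom Z w := sval (cid (wp_ex w f)).

Lemma wliftE (l : seq C) (w : weak_prod l) (Z : C)
    (f : forall i : pos l, Hom Z (at_ i)) (i : pos l) :
  wpr w i ∘ wlift w f = f i.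
Proof. by rewrite /wlift; case: cid. Qed.

Definition wlift2 (X Y : C) (w : weak_prod [:: X; Y]) (Z : C)
    (f : Hom Z X) (g : Hom Z Y) : Hom Z w := wlift w (two f g).

Lemma wlift21 (X Y : C) (w : weak_prod [:: X; Y]) (Z : C)
    (f : Hom Z X) (g : Hom Z Y) : wp1 w ∘ wlift2 w f g = f.
Proof. exact: (wliftE w (two f g) None). Qed.

Lemma wlift22 (X Y : C) (w : weak_prod [:: X; Y]) (Z : C)
    (f : Hom Z X) (g : Hom Z Y) : wp2 w ∘ wlift2 w f g = g.
Proof. exact: (wliftE w (two f g) (Some None)). Qed.

End Lifts.

Section BiasedTheory.
Variables (C : Category) (P : BiasedElem C).

Definition wpc (l : seq C) : weak_prod l :=
  sval (cid (let: inhabits w := bp_wp P l in ex_intro (fun=> True) w I)).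

Lemma bd_diag (X : C) (w : weak_prod [:: X; X]) (A : C)
    (v : weak_prod [:: A; A]) (d : Hom A v) (f : Hom A X) (g : Hom v w) :
  wp1 v ∘ d = idm A -> wp2 v ∘ d = idm A ->
  wp1 w ∘ g = f ∘ wp1 v -> wp2 w ∘ g = f ∘ wp2 v ->
  itop ⊑ rx P (g ∘ d) (bd P w).
Proof.
move=> d1 d2 g1 g2; rewrite rxM; apply: ile_trans (rx_mono d (bd_arr P g1 g2)).
exact: bd_refl.
Qed.

(** The pairing [m] of [s] and [s'] is taken over [A * A] and then restricted to
    the diagonal [d]: this is what makes [bd_diag] applicable to [t ∘ m ∘ d] and
    [t' ∘ m ∘ d] for any choice of [t] and [t']. *)
Lemma bd_le (X : C) (w : weak_prod [:: X; X]) (A : C) (s s' : Hom A w) :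
  wp1 w ∘ s = wp1 w ∘ s' -> wp2 w ∘ s = wp2 w ∘ s' ->
  rx P s (bd P w) ⊑ rx P s' (bd P w).
Proof.
move=> s1 s2.
pose v := wpc [:: A; A]; pose d := wlift2 v (idm A) (idm A).
pose u := wpc [:: wp_ob w; wp_ob w].
pose m := wlift2 u (s ∘ wp1 v) (s' ∘ wp2 v).
pose t := wlift2 w (wp1 w ∘ wp1 u) (wp1 w ∘ wp2 u).
pose t' := wlift2 w (wp2 w ∘ wp1 u) (wp2 w ∘ wp2 u).
have d1 : wp1 v ∘ d = idm A by apply: wlift21.
have d2 : wp2 v ∘ d = idm A by apply: wlift22.
have m1 : wp1 u ∘ m = s ∘ wp1 v by apply: wlift21.
have m2 : wp2 u ∘ m = s' ∘ wp2 v by apply: wlift22.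
have := @bd_irr C P X w u t t' (wlift21 _ _ _) (wlift22 _ _ _)
  (wlift21 _ _ _) (wlift22 _ _ _).
move/(rx_mono (m ∘ d)); rewrite !rx_meet -!rxM !cmpA m1 m2 -!cmpA d1 d2 !cmpm1.
apply: ile_trans; apply: imeet_glb; first apply: imeet_glb.
- exact: ile_refl.
- apply: ile_top_trans; rewrite cmpA.
  apply: (@bd_diag _ _ _ _ _ (wp1 w ∘ s)) => //; rewrite cmpA.
    by rewrite wlift21 -cmpA m1 !cmpA.
  by rewrite wlift22 -cmpA m2 !cmpA s1.
- apply: ile_top_trans; rewrite cmpA.
  apply: (@bd_diag _ _ _ _ _ (wp2 w ∘ s)) => //; rewrite cmpA.
    by rewrite wlift21 -cmpA m1 !cmpA.
  by rewrite wlift22 -cmpA m2 !cmpA s2.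
Qed.

Definition deq (A X : C) (f g : Hom A X) : P A :=
  rx P (wlift2 (wpc [:: X; X]) f g) (bd P (wpc [:: X; X])).

Lemma deqE (A X : C) (w : weak_prod [:: X; X]) (h : Hom A w) :
  rx P h (bd P w) = deq (wp1 w ∘ h) (wp2 w ∘ h).
Proof.
rewrite /deq; set w' := wpc _; set h' := wlift2 _ _ _.
suff le (v v' : weak_prod [:: X; X]) (k : Hom A v) (k' : Hom A v') :
    wp1 v ∘ k = wp1 v' ∘ k' -> wp2 v ∘ k = wp2 v' ∘ k' ->
    rx P k (bd P v) ⊑ rx P k' (bd P v').
  by apply: ile_anti; apply: le; rewrite ?wlift21 ?wlift22.
move=> k1 k2; pose m := wlift2 v' (wp1 v) (wp2 v).
have m1 : wp1 v' ∘ m = wp1 v by apply: wlift21.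
have m2 : wp2 v' ∘ m = wp2 v by apply: wlift22.
have /(rx_mono k) : bd P v ⊑ rx P m (bd P v').
  by apply: (@bd_arr _ _ _ _ _ _ (idm X)); rewrite cmp1m.
move/ile_trans; apply; rewrite -rxM; apply: bd_le; rewrite cmpA ?m1 ?m2 //.
Qed.

Lemma deq_rx (A B X : C) (k : Hom B A) (f g : Hom A X) :
  rx P k (deq f g) = deq (f ∘ k) (g ∘ k).
Proof. by rewrite {1}/deq -rxM deqE !cmpA wlift21 wlift22. Qed.

Lemma deq_refl (A X : C) (f : Hom A X) : itop ⊑ deq f f.
Proof.
rewrite -{1 2}(cmp1m f) -deq_rx; apply: rx_ge_top.
by apply: bd_refl; rewrite ?wlift21 ?wlift22.
Qed.

Lemma deq_subst (A X : C) (f g : Hom A X) (a : P X) :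
  rx P f a ⊓ deq f g ⊑ rx P g a.
Proof.
have := rx_mono (wlift2 (wpc [:: X; X]) f g) (bd_subst (wpc [:: X; X]) a).
by rewrite rx_meet -!rxM wlift21 wlift22.
Qed.

Lemma deq_arr (A X Y : C) (f g : Hom A X) (k : Hom X Y) :
  deq f g ⊑ deq (k ∘ f) (k ∘ g).
Proof.
set w := wpc [:: X; X]; set w' := wpc [:: Y; Y].
pose m := wlift2 w' (k ∘ wp1 w) (k ∘ wp2 w).
have := @bd_arr _ P _ _ w' w k m (wlift21 _ _ _) (wlift22 _ _ _).
move/(rx_mono (wlift2 w f g))/ile_trans; apply.
by rewrite deqE deq_rx wlift21 wlift22 -!cmpA wlift21 wlift22; apply: ile_refl.
Qed.

Lemma deq_irr (A X : C) (a b a' b' : Hom A X) :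
  deq a b ⊓ deq a a' ⊓ deq b b' ⊑ deq a' b'.
Proof.
set w := wpc [:: X; X]; pose u := wpc [:: wp_ob w; wp_ob w].
pose t := wlift2 w (wp1 w ∘ wp1 u) (wp1 w ∘ wp2 u).
pose t' := wlift2 w (wp2 w ∘ wp1 u) (wp2 w ∘ wp2 u).
have := @bd_irr C P X w u t t' (wlift21 _ _ _) (wlift22 _ _ _)
  (wlift21 _ _ _) (wlift22 _ _ _).
move/(rx_mono (wlift2 u (wlift2 w a b) (wlift2 w a' b'))).
rewrite !rx_meet -!rxM wlift21 wlift22 !deqE !wlift21 !wlift22.
rewrite !cmpA /t /t' !wlift21 !wlift22 -!cmpA !wlift21 !wlift22.
by rewrite ?wlift21 ?wlift22.
Qed.

Lemma deq_sym (A X : C) (f g : Hom A X) : deq f g ⊑ deq g f.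
Proof.
apply: ile_trans (deq_irr f f g f).
apply: imeet_glb; first apply: imeet_glb; rewrite ?ile_refl //;
  do ?exact: ile_refl; exact: ile_top_trans (deq_refl _).
Qed.

Lemma deq_trans (A X : C) (f g h : Hom A X) : deq f g ⊓ deq g h ⊑ deq f h.
Proof.
apply: ile_trans (deq_irr f g f h); apply: imeetS; last exact: ile_refl.
by apply: imeet_glb; [apply: ile_refl | apply: ile_top_trans (deq_refl _)].
Qed.

Lemma proof_irrelevantP (l : seq C) (w : weak_prod l) (a : P w) :
  proof_irrelevant a <->
  forall (A : C) (g g' : Hom A w),
    rx P g a ⊓ \big[imeet/itop]_(i : pos l) deq (wpr w i ∘ g) (wpr w i ∘ g')
      ⊑ rx P g' a.
Proof.
split=> [[u [v [t [t1 [t2 irr]]]]] A g g' | irr].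
  have := rx_mono (wlift2 u g g') irr.
  rewrite rx_meet rx_big -!rxM wlift21 wlift22.
  under eq_bigr => i _ do
    rewrite deqE deq_rx t1 t2 -!cmpA wlift21 wlift22.
  exact.
pose u := wpc [:: wp_ob w; wp_ob w].
pose v i := wpc [:: at_ (l := l) i; at_ i].
exists u, v, (fun i => wlift2 (v i) (wpr w i ∘ wp1 u) (wpr w i ∘ wp2 u)).
split; [by move=> i; rewrite wlift21 | split; [by move=> i; rewrite wlift22 |]].
by under eq_bigr => i _ do rewrite deqE wlift21 wlift22.
Qed.

Lemma proof_irrelevant_every (l : seq C) (w : weak_prod l) (a : P w)
    (u : weak_prod [:: wp_ob w; wp_ob w])
    (v : forall i : pos l, weak_prod [:: at_ i; at_ i])
    (t : forall i : pos l, Hom u (v i)) :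
  proof_irrelevant a ->
  (forall i, wp1 (v i) ∘ t i = wpr w i ∘ wp1 u) ->
  (forall i, wp2 (v i) ∘ t i = wpr w i ∘ wp2 u) ->
  rx P (wp1 u) a ⊓ \big[imeet/itop]_(i : pos l) rx P (t i) (bd P (v i))
    ⊑ rx P (wp2 u) a.
Proof.
move=> /proof_irrelevantP irr t1 t2.
by under eq_bigr => i _ do rewrite deqE t1 t2; apply: irr.
Qed.

Lemma proof_irrelevant_eq (l : seq C) (w : weak_prod l) (a : P w)
    (A : C) (g g' : Hom A w) :
  proof_irrelevant a -> (forall i, wpr w i ∘ g = wpr w i ∘ g') ->
  rx P g a = rx P g' a.
Proof.
move=> /proof_irrelevantP irr gg'.
have le (h h' : Hom A w) : (forall i, wpr w i ∘ h = wpr w i ∘ h') ->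
    rx P h a ⊑ rx P h' a.
  move=> hh'; apply: ile_trans (irr _ h h'); apply: imeet_glb.
    exact: ile_refl.
  apply/ile_bigP => i; rewrite hh'; exact: ile_top_trans (deq_refl _).
by apply: ile_anti; apply: le.
Qed.

Lemma proof_irrelevant_top (l : seq C) (w : weak_prod l) :
  proof_irrelevant (itop : P w).
Proof. by apply/proof_irrelevantP => A g g'; rewrite !rx_top; apply: ile_top. Qed.

Lemma proof_irrelevant_meet (l : seq C) (w : weak_prod l) (a b : P w) :
  proof_irrelevant a -> proof_irrelevant b -> proof_irrelevant (a ⊓ b).
Proof.
move=> /proof_irrelevantP ia /proof_irrelevantP ib.
apply/proof_irrelevantP => A g g'; rewrite !rx_meet; apply: imeet_glb.
  by apply: ile_trans (ia _ g g'); apply: imeetS; [apply: imeet_l | apply: ile_refl].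
by apply: ile_trans (ib _ g g'); apply: imeetS; [apply: imeet_r | apply: ile_refl].
Qed.

End BiasedTheory.

Section ProductCompletion.
Variable C : Category.

(** An arrow [(f, s) : l -> m] is presented as the function [j |-> (s j; f_j)]. *)
Definition pc_hom (l m : seq C) : Type :=
  forall j : pos m, {i : pos l & Hom (at_ i) (at_ j)}.

Definition pc_id (l : seq C) : pc_hom l l :=
  fun j => existT (fun i => Hom (at_ i) (at_ j)) j (idm (at_ j)).

Definition pc_cmp (l m n : seq C) (g : pc_hom m n) (f : pc_hom l m)
    : pc_hom l n :=
  fun k => existT (fun i => Hom (at_ i) (at_ k)) (tag (f (tag (g k))))
             (tagged (g k) ∘ tagged (f (tag (g k)))).

Program Definition prod_completion : Category :=
  @MkCategory (seq C) pc_hom pc_id pc_cmp _ _ _.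
Next Obligation.
apply: functional_extensionality_dep => j; rewrite /pc_cmp /=.
by case: (f j) => i g /=; rewrite cmp1m.
Qed.
Next Obligation.
apply: functional_extensionality_dep => j; rewrite /pc_cmp /=.
by case: (f j) => i g /=; rewrite cmpm1.
Qed.
Next Obligation.
by apply: functional_extensionality_dep => j; rewrite /pc_cmp /= cmpA.
Qed.

Definition pc_sing (X Y : C) (f : Hom X Y) : pc_hom [:: X] [:: Y] :=
  fun j => match j as j0
             return {i : pos [:: X] & Hom (at_ i) (@at_ C [:: Y] j0)} with
           | None => existT (fun i : pos [:: X] => Hom (at_ i) Y) None f
           | Some v => match v with end
           end.

Definition pc_bang (l : seq C) : pc_hom l [::] :=
  fun j => match (j : void) with end.

Fixpoint pc_pr1 (l m : seq C) : pc_hom (l ++ m) l :=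
  match l return pc_hom (l ++ m) l with
  | [::] => fun j => match (j : void) with end
  | X :: l' => fun j =>
      match j as j0
        return {i : pos (X :: l' ++ m) & Hom (at_ i) (@at_ C (X :: l') j0)} with
      | None => existT (fun i : pos (X :: l' ++ m) => Hom (at_ i) X) None (idm X)
      | Some k =>
          existT (fun i : pos (X :: l' ++ m) => Hom (at_ i) (at_ k))
            (Some (tag (pc_pr1 m k))) (tagged (pc_pr1 m k))
      end
  end.

Fixpoint pc_pr2 (l m : seq C) : pc_hom (l ++ m) m :=
  match l return pc_hom (l ++ m) m with
  | [::] => @pc_id m
  | X :: l' => fun j =>
      existT (fun i : pos (X :: l' ++ m) => Hom (at_ i) (at_ j))
        (Some (tag (pc_pr2 l' j))) (tagged (pc_pr2 l' j))
  end.

Fixpoint pc_pair (n l m : seq C) : pc_hom n l -> pc_hom n m -> pc_hom n (l ++ m) :=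
  match l return pc_hom n l -> pc_hom n m -> pc_hom n (l ++ m) with
  | [::] => fun _ g => g
  | X :: l' => fun f g j =>
      match j as j0
        return {i : pos n & Hom (at_ i) (@at_ C (X :: l' ++ m) j0)} with
      | None => f None
      | Some k => pc_pair (fun i : pos l' => f (Some i)) g k
      end
  end.

Program Definition pc_fp : FinProd prod_completion :=
  @MkFinProd prod_completion [::] pc_bang _ (fun l m => l ++ m)
    pc_pr1 pc_pr2 pc_pair _ _ _.
Next Obligation. by apply: functional_extensionality_dep => -[]. Qed.
Next Obligation.
apply: functional_extensionality_dep.
elim: X f => [f [] | X l IHl f [j|]] /=.
  by have /= <- := IHl (fun i => f (Some i)) j.
by rewrite /pc_cmp /=; case: (f None) => i h /=; rewrite cmp1m.
Qed.
Next Obligation.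
apply: functional_extensionality_dep.
elim: X f => [f j | X l IHl f j] /=.
  by rewrite /pc_cmp /=; case: (g j) => i h /=; rewrite cmp1m.
exact: (IHl (fun i => f (Some i)) j).
Qed.
Next Obligation.
apply: functional_extensionality_dep.
elim: X h => [h j | X l IHl h [j|]] /=.
- by rewrite /pc_cmp /=; case: (h j) => i k /=; rewrite cmp1m.
- exact: (IHl (fun i => h (Some i)) j).
- by rewrite /pc_cmp /=; case: (h None) => i k /=; rewrite cmp1m.
Qed.

End ProductCompletion.

Section Strictification.
Variables (C : Category) (P : BiasedElem C).

(** A class of proof-irrelevant elements, identified along the [P_h], has
    exactly one member over each weak product of [l]: it is presented as the
    family of its members. *)
Record pi_class (l : seq C) := MkPiClass {
  pic :> forall w : weak_prod l, P w;
  pic_irr : forall w : weak_prod l, proof_irrelevant (pic w);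
  pic_compat : forall (w w' : weak_prod l) (h : Hom w w'),
    (forall i, wpr w' i ∘ h = wpr w i) -> rx P h (pic w') = pic w }.

Lemma pi_class_eq (l : seq C) (a b : pi_class l) : (forall w, a w = b w) -> a = b.
Proof.
case: a b => [a ai ac] [b bi bc] /= ab.
have {}ab : a = b by apply: functional_extensionality_dep.
by subst b; congr MkPiClass; apply: Prop_irrelevance.
Qed.

Program Definition pi_class_isl (l : seq C) : InfSL :=
  @MkInfSL (pi_class l) (fun a b => forall w, a w ⊑ b w)
    (@MkPiClass l (fun w => itop) _ _)
    (fun a b => @MkPiClass l (fun w => a w ⊓ b w) _ _) _ _ _ _ _ _ _.
Next Obligation. exact: proof_irrelevant_top. Qed.
Next Obligation. by rewrite rx_top. Qed.
Next Obligation. by apply: proof_irrelevant_meet; apply: pic_irr. Qed.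
Next Obligation. by rewrite rx_meet !pic_compat. Qed.
Next Obligation. exact: ile_refl. Qed.
Next Obligation. exact: ile_trans (H w) (H0 w). Qed.
Next Obligation. by apply: pi_class_eq => w; apply: ile_anti. Qed.
Next Obligation. exact: ile_top. Qed.
Next Obligation. exact: imeet_l. Qed.
Next Obligation. exact: imeet_r. Qed.
Next Obligation. exact: imeet_glb. Qed.

Definition pev (l : seq C) (a : pi_class l) (A : C)
    (f : forall i : pos l, Hom A (at_ i)) : P A :=
  rx P (wlift (wpc P l) f) (a (wpc P l)).

Lemma pevE (l : seq C) (a : pi_class l) (A : C) (w : weak_prod l) (h : Hom A w) :
  rx P h (a w) = pev a (fun i => wpr w i ∘ h).
Proof.
rewrite -(@pic_compat _ a w (wpc P l) (wlift (wpc P l) (wpr w))); last first.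
  by move=> i; rewrite wliftE.
rewrite -rxM; apply: proof_irrelevant_eq; first exact: pic_irr.
by move=> i; rewrite cmpA !wliftE.
Qed.

Lemma pev_ext (l : seq C) (a : pi_class l) (A : C)
    (f g : forall i : pos l, Hom A (at_ i)) :
  (forall i, f i = g i) -> pev a f = pev a g.
Proof. by move=> fg; congr pev; apply: functional_extensionality_dep. Qed.

Lemma pevP (l : seq C) (a : pi_class l) (A : C) (w : weak_prod l) (h : Hom A w)
    (f : forall i : pos l, Hom A (at_ i)) :
  (forall i, wpr w i ∘ h = f i) -> rx P h (a w) = pev a f.
Proof. by move=> hf; rewrite pevE; apply: pev_ext. Qed.

Lemma pev_rx (l : seq C) (a : pi_class l) (A B : C) (k : Hom B A)
    (f : forall i : pos l, Hom A (at_ i)) :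
  rx P k (pev a f) = pev a (fun i => f i ∘ k).
Proof. by rewrite -rxM; apply: pevP => i; rewrite cmpA wliftE. Qed.

Lemma pic_pev (l : seq C) (a : pi_class l) (w : weak_prod l) :
  a w = pev a (wpr w).
Proof. by rewrite -{1}(rx1 (a w)); apply: pevP => i; rewrite cmpm1. Qed.

Lemma pev_irr (l : seq C) (a : pi_class l) (A : C)
    (f g : forall i : pos l, Hom A (at_ i)) :
  pev a f ⊓ \big[imeet/itop]_(i : pos l) deq P (f i) (g i) ⊑ pev a g.
Proof.
have /proof_irrelevantP := pic_irr a (wpc P l).
move=> /(_ A (wlift (wpc P l) f) (wlift (wpc P l) g)).
by under eq_bigr => i _ do rewrite !wliftE.
Qed.

Lemma pic_leP (l : seq C) (a b : pi_class_isl l) :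
  a ⊑ b <-> forall A (f : forall i : pos l, Hom A (at_ i)), pev a f ⊑ pev b f.
Proof.
split=> [ab A f | ab w]; first exact/rx_mono/ab.
by rewrite !pic_pev.
Qed.

(** [pi_rx] is computed with a choice of [V] and [g]; [pi_rxE] shows that any
    other choice gives the same result. *)
Definition pi_rx_fun (l m : seq C) (f : pc_hom l m) (a : pi_class m)
    (w : weak_prod l) : P w :=
  let g := wlift (wpc P m) (fun j => tagged (f j) ∘ wpr w (tag (f j))) in
  rx P g (a (wpc P m)).

Program Definition pi_rx (l m : seq C) (f : pc_hom l m) (a : pi_class m)
    : pi_class l := @MkPiClass l (pi_rx_fun f a) _ _.
Next Obligation.
apply/proof_irrelevantP => A g g'; rewrite /pi_rx_fun /= -/(pev _ _) !pev_rx.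
apply: ile_trans (pev_irr a _ _); apply: imeetS; first exact: ile_refl.
apply/ile_bigP => j; rewrite -!cmpA; apply: ile_trans (deq_arr _ _ _ _).
exact: (big_ile (fun i => deq P (wpr w i ∘ g) (wpr w i ∘ g')) (tag (f j))).
Qed.
Next Obligation.
rewrite /pi_rx_fun -/(pev _ _) pev_rx; apply: pev_ext => j.
by rewrite -cmpA H.
Qed.

Lemma pi_rxE (l m : seq C) (f : pc_hom l m) (a : pi_class m)
    (w : weak_prod l) (v : weak_prod m) (g : Hom w v) :
  (forall j, wpr v j ∘ g = tagged (f j) ∘ wpr w (tag (f j))) ->
  pi_rx f a w = rx P g (a v).
Proof. by move=> /(pevP a) ->. Qed.

Lemma pev_pi_rx (l m : seq C) (f : pc_hom l m) (a : pi_class m) (A : C)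
    (h : forall i : pos l, Hom A (at_ i)) :
  pev (pi_rx f a) h = pev a (fun j => tagged (f j) ∘ h (tag (f j))).
Proof.
rewrite {1}/pev /= /pi_rx_fun -/(pev _ _) pev_rx; apply: pev_ext => j.
by rewrite -cmpA wliftE.
Qed.

Lemma pi_rx_hom (l m : seq C) (f : pc_hom l m) :
  @isl_hom (pi_class_isl m) (pi_class_isl l) (pi_rx f).
Proof.
split=> [|a b]; apply: pi_class_eq => w /=; rewrite /pi_rx_fun /=.
  by rewrite rx_top.
by rewrite rx_meet.
Qed.

Definition strict_fib (l : seq C) : InfSL :=
  if l is [::] then unit_isl else pi_class_isl l.

(** The inner [[::]] branch is unreachable: there is no arrow from [[::]] to a
    non-empty list. *)
Definition strict_rx (l m : seq C) :
    pc_hom l m -> strict_fib m -> strict_fib l :=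
  match m return pc_hom l m -> strict_fib m -> strict_fib l with
  | [::] => fun _ _ => itop
  | Y :: m' =>
      match l return
        pc_hom l (Y :: m') -> strict_fib (Y :: m') -> strict_fib l with
      | [::] => fun _ _ => itop
      | X :: l' => fun f a => pi_rx f a
      end
  end.

Program Definition strictification : Doctrine (prod_completion C) :=
  @MkDoctrine (prod_completion C) strict_fib strict_rx _ _ _.
Next Obligation.
case: Y f => [|Y m] f; last case: X f => [|X l] f.
- split=> // a b; apply: ile_anti; last exact: ile_top.
  by apply: imeet_glb; apply: ile_refl.
- by case: (f None) => -[].
- exact: pi_rx_hom.
Qed.
Next Obligation.
case: X a => [|X l] a /=; first by case: a.
apply: pi_class_eq => w; rewrite [LHS]pic_pev pev_pi_rx [RHS]pic_pev.
by apply: pev_ext => j /=; rewrite cmp1m.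
Qed.
Next Obligation.
case: Z g a => [|Z n] g a.
  case: Y f g => [|Y m] f g; case: X f => [|X l] f //=.
  by have [-> _] := pi_rx_hom f.
case: Y f g => [|Y m] f g; first by case: (g None) => -[].
case: X f => [|X l] f; first by case: (f None) => -[].
apply: pi_class_eq => w.
change (pi_rx (pc_cmp g f) a w = pi_rx f (pi_rx g a) w).
rewrite [LHS]pic_pev [RHS]pic_pev !pev_pi_rx.
by apply: pev_ext => j /=; rewrite cmpA.
Qed.

(** [P^s [X] = P X]: an element [a] is identified with the class whose member
    over the weak product [id : X -> X] is [a]. *)
Program Definition sing_class (X : C) (a : P X) : pi_class [:: X] :=
  @MkPiClass [:: X] (fun w => rx P (@wpr C [:: X] w None) a) _ _.
Next Obligation.
apply/proof_irrelevantP => A g g'; rewrite -!rxM.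
apply: ile_trans (deq_subst _ _ a); apply: imeetS; first exact: ile_refl.
exact: (@big_ile _ (pos [:: X]) (fun i => deq P (wpr w i ∘ g) (wpr w i ∘ g')) None).
Qed.
Next Obligation. by rewrite -rxM (H None). Qed.

Lemma pev_sing (X : C) (a : P X) (A : C) (f : forall i : pos [:: X], Hom A (at_ i)) :
  pev (sing_class a) f = rx P (f None : Hom A X) a.
Proof. by rewrite /pev /= -rxM (wliftE (wpc P [:: X]) f None). Qed.

Program Definition delta_class (X : C) : pi_class [:: X; X] :=
  @MkPiClass [:: X; X] (fun w => bd P w) _ _.
Next Obligation.
apply/proof_irrelevantP => A g g'; rewrite !deqE.
apply: ile_trans (deq_irr P (wp1 w ∘ g) (wp2 w ∘ g) _ _).
have bigP := @big_ile _ (pos [:: X; X]) (fun i => deq P (wpr w i ∘ g) (wpr w i ∘ g')).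
apply: imeet_glb; first apply: imeetS; first exact: ile_refl.
  exact: (bigP None).
apply: ile_meetr; exact: (bigP (Some None)).
Qed.
Next Obligation.
rewrite deqE (H None : wp1 _ ∘ h = _) (H (Some None) : wp2 _ ∘ h = _).
by rewrite -[RHS]rx1 deqE !cmpm1.
Qed.

Lemma pev_delta_class (X A : C) (f : forall i : pos [:: X; X], Hom A (at_ i)) :
  pev (delta_class X) f = deq P (f None : Hom A X) (f (Some None) : Hom A X).
Proof.
rewrite /pev /= deqE; congr deq; first exact: (wliftE (wpc P [:: X; X]) f None).
exact: (wliftE (wpc P [:: X; X]) f (Some None)).
Qed.

End Strictification.

Section PEquivalence.
Variables (C : Category) (P : BiasedElem C).

Definition P_eqrel (X : C) (r : pi_class P [:: X; X]) : Prop :=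
  @is_eqrel (prod_completion C) (pc_fp C) (strictification P) [:: X] r.

Definition P_des (X : C) (r : pi_class P [:: X; X]) (a : P X) : Prop :=
  @is_des (prod_completion C) (pc_fp C) (strictification P) [:: X] r
    (sing_class a).

Definition P_rel_rx (X Y : C) (f g : Hom X Y) (s : pi_class P [:: Y; Y])
    : pi_class P [:: X; X] :=
  @rx _ (strictification P) [:: X; X] [:: Y; Y]
    (@pmap _ (pc_fp C) [:: X] [:: X] [:: Y] [:: Y] (pc_sing f) (pc_sing g)) s.

Definition P_rel_le (X Y : C) (r : pi_class P [:: X; X])
    (s : pi_class P [:: Y; Y]) (f g : Hom X Y) : Prop :=
  @ile (strictification P [:: X; X]) r (P_rel_rx f g s).

Definition bev (X Y A : C) (r : pi_class P [:: X; Y])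
    (f : Hom A X) (g : Hom A Y) : P A := pev r (two f g).

Lemma pev_bev (X Y A : C) (r : pi_class P [:: X; Y])
    (f : forall i : pos [:: X; Y], Hom A (at_ i)) :
  pev r f = bev r (f None : Hom A X) (f (Some None) : Hom A Y).
Proof. by apply: pev_ext; apply: pos2P. Qed.

Lemma bev_rx (X Y A B : C) (r : pi_class P [:: X; Y])
    (f : Hom A X) (g : Hom A Y) (k : Hom B A) :
  rx P k (bev r f g) = bev r (f ∘ k) (g ∘ k).
Proof. by rewrite /bev pev_rx pev_bev. Qed.

Lemma bevE (X Y A : C) (r : pi_class P [:: X; Y]) (w : weak_prod [:: X; Y])
    (h : Hom A w) : rx P h (r w) = bev r (wp1 w ∘ h) (wp2 w ∘ h).
Proof. by rewrite pevE pev_bev. Qed.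

Lemma pev_top (l : seq C) (A : C) (f : forall i : pos l, Hom A (at_ i)) :
  pev (itop : pi_class_isl P l) f = itop.
Proof. by rewrite /pev rx_top. Qed.

Lemma pev_meet (l : seq C) (A : C) (f : forall i : pos l, Hom A (at_ i))
    (a b : pi_class_isl P l) : pev (a ⊓ b) f = pev a f ⊓ pev b f.
Proof. by rewrite /pev rx_meet. Qed.

Lemma pev_rel_rx (X Y A : C) (f g : Hom X Y) (s : pi_class P [:: Y; Y])
    (h : forall i : pos [:: X; X], Hom A (at_ i)) :
  pev (P_rel_rx f g s) h = bev s (f ∘ h None) (g ∘ h (Some None)).
Proof. by rewrite pev_pi_rx pev_bev /= !cmpm1. Qed.

Lemma P_rel_leP (X Y : C) (r : pi_class P [:: X; X]) (s : pi_class P [:: Y; Y])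
    (f g : Hom X Y) :
  P_rel_le r s f g <->
  forall A (a b : Hom A X), bev r a b ⊑ bev s (f ∘ a) (g ∘ b).
Proof.
split=> [/pic_leP le A a b | le].
  by rewrite /bev; move: (le A (two a b)); rewrite pev_rel_rx.
by apply/pic_leP => A h; rewrite pev_rel_rx pev_bev.
Qed.

Lemma P_desP (X : C) (r : pi_class P [:: X; X]) (a : P X) :
  P_des r a <-> forall A (f g : Hom A X), rx P f a ⊓ bev r f g ⊑ rx P g a.
Proof.
rewrite /P_des /is_des.
set l := rx _ _ _; set m := rx _ _ _.
have lE A h : pev (l : pi_class P [:: X; X]) (A := A) h = rx P (h None : Hom A X) a.
  by rewrite pev_pi_rx pev_sing /= cmp1m.
have mE A h : pev (m : pi_class P [:: X; X]) (A := A) h =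
    rx P (h (Some None) : Hom A X) a.
  by rewrite pev_pi_rx pev_sing /= cmp1m.
split=> [/pic_leP le A f g | le].
  by move: (le A (two f g)); rewrite pev_meet lE mE.
by apply/pic_leP => A h; rewrite pev_meet lE mE pev_bev.
Qed.

Lemma P_eqrelP (X : C) (r : pi_class P [:: X; X]) :
  P_eqrel r <->
  [/\ forall A (f : Hom A X), itop ⊑ bev r f f,
      forall A (f g : Hom A X), bev r f g ⊑ bev r g f &
      forall A (f g h : Hom A X), bev r f g ⊓ bev r g h ⊑ bev r f h].
Proof.
pose S := strictification P.
have E1 A h : pev (rx S (diag (pc_fp C) [:: X]) r : pi_class P [:: X])
    (A := A) h = bev r (h None) (h None).
  by rewrite pev_pi_rx pev_bev /= !cmp1m.
have E2 A h : pev (rx S (pair (pc_fp C) (pr2 (pc_fp C) [:: X] [:: X])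
    (pr1 (pc_fp C) [:: X] [:: X])) r : pi_class P [:: X; X])
    (A := A) h = bev r (h (Some None)) (h None).
  by rewrite pev_pi_rx pev_bev /= !cmp1m.
split=> [[/pic_leP r1 /pic_leP r2 /pic_leP r3] | [r1 r2 r3]].
  split=> [A f | A f g | A f g h].
  - by move: (r1 A (fun i => match i with None => f | Some v => match v with end end));
      rewrite pev_top E1.
  - by move: (r2 A (two g f)); rewrite E2.
  - pose k : forall i : pos [:: X; X; X], Hom A (at_ i) :=
      fun i => match i as i0 return Hom A (@at_ C [:: X; X; X] i0) with
               | None => f | Some i' => two g h i' end.
    by move: (r3 A k); rewrite pev_meet !pev_pi_rx !pev_bev /= ?cmp1m.
split; apply/pic_leP => A h.
- by rewrite pev_top E1.
- by rewrite E2 pev_bev.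
- by rewrite pev_meet !pev_pi_rx !pev_bev /= ?cmp1m.
Qed.

Lemma delta_class_eqrel (X : C) : P_eqrel (delta_class P X).
Proof.
apply/P_eqrelP; split=> *; rewrite /bev !pev_delta_class.
- exact: deq_refl.
- exact: deq_sym.
- exact: deq_trans.
Qed.

Lemma delta_class_des (X : C) (a : P X) : P_des (delta_class P X) a.
Proof. by apply/P_desP => A f g; rewrite /bev pev_delta_class; apply: deq_subst. Qed.

Lemma P_des_top (X : C) (r : pi_class P [:: X; X]) : P_des r itop.
Proof. by apply/P_desP => A f g; rewrite !rx_top; apply: ile_top. Qed.

Lemma P_des_meet (X : C) (r : pi_class P [:: X; X]) (a b : P X) :
  P_des r a -> P_des r b -> P_des r (a ⊓ b).
Proof.
move=> /P_desP da /P_desP db; apply/P_desP => A f g.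
rewrite !rx_meet; apply: imeet_glb.
  apply: ile_trans (da A f g); apply: imeetS; [exact: imeet_l | exact: ile_refl].
apply: ile_trans (db A f g); apply: imeetS; [exact: imeet_r | exact: ile_refl].
Qed.

End PEquivalence.

Section QuotientCompletion.
Variables (C : Category) (P : BiasedElem C).

Record qc_ob := MkQcOb {
  qc_car :> C;
  qc_rel : pi_class P [:: qc_car; qc_car];
  qc_eqrel : P_eqrel qc_rel }.

Definition qc_sim (A B : qc_ob) (f g : Hom A B) : Prop :=
  P_rel_le (qc_rel A) (qc_rel B) f g.

(** The arrows [f] with [qc_sim f f], up to [qc_sim]; an equivalence class is a
    predicate on arrows. *)
Definition qc_hom (A B : qc_ob) : Type :=
  {c : Hom A B -> Prop |
    exists f, qc_sim f f /\ c = (fun g => qc_sim g g /\ qc_sim f g)}.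

Lemma qc_refl (A : qc_ob) Z (a : Hom Z A) : itop ⊑ bev (qc_rel A) a a.
Proof. by have /P_eqrelP[] := qc_eqrel A. Qed.

Lemma qc_sym (A : qc_ob) Z (a b : Hom Z A) :
  bev (qc_rel A) a b ⊑ bev (qc_rel A) b a.
Proof. by have /P_eqrelP[] := qc_eqrel A. Qed.

Lemma qc_trans (A : qc_ob) Z (b a c : Hom Z A) :
  bev (qc_rel A) a b ⊓ bev (qc_rel A) b c ⊑ bev (qc_rel A) a c.
Proof. by have /P_eqrelP[] := qc_eqrel A. Qed.

Lemma qc_simP (A B : qc_ob) (f g : Hom A B) :
  qc_sim f f -> (qc_sim f g <-> itop ⊑ bev (qc_rel B) f g).
Proof.
move=> /P_rel_leP ff; split=> [/P_rel_leP fg | fg].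
  have := fg _ (idm A) (idm A); rewrite !cmpm1.
  by apply: ile_trans; apply: qc_refl.
apply/P_rel_leP => Z a b; apply: ile_trans (@qc_trans B _ (f ∘ b) _ _).
apply: imeet_glb; first exact: ff.
by rewrite -bev_rx; apply: ile_top_trans; apply: rx_ge_top.
Qed.

Lemma qc_sim_sym (A B : qc_ob) (f g : Hom A B) :
  qc_sim f f -> qc_sim g g -> qc_sim f g -> qc_sim g f.
Proof.
move=> ff gg /(qc_simP _ ff) fg; apply/(qc_simP _ gg).
by apply: (ile_trans fg); apply: qc_sym.
Qed.

Lemma qc_sim_trans (A B : qc_ob) (g f h : Hom A B) :
  qc_sim f f -> qc_sim g g -> qc_sim f g -> qc_sim g h -> qc_sim f h.
Proof.
move=> ff gg /(qc_simP _ ff) fg /(qc_simP _ gg) gh; apply/(qc_simP _ ff).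
by apply: ile_trans (@qc_trans B _ g _ _); apply: imeet_glb.
Qed.

Lemma qc_sim_id (A : qc_ob) : qc_sim (idm (qc_car A) : Hom A A) (idm (qc_car A)).
Proof. by apply/P_rel_leP => Z a b; rewrite !cmp1m; apply: ile_refl. Qed.

Lemma qc_sim_comp (A B D : qc_ob) (f f' : Hom A B) (g g' : Hom B D) :
  qc_sim f f' -> qc_sim g g' -> qc_sim (g ∘ f) (g' ∘ f').
Proof.
move=> /P_rel_leP ff' /P_rel_leP gg'; apply/P_rel_leP => Z a b.
by rewrite -!cmpA; apply: (ile_trans (ff' Z a b)); apply: gg'.
Qed.

Definition qc_class (A B : qc_ob) (f : Hom A B) (ff : qc_sim f f) : qc_hom A B :=
  exist _ (fun g => qc_sim g g /\ qc_sim f g) 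
    (ex_intro _ f (conj ff erefl)).

Definition qc_repr (A B : qc_ob) (c : qc_hom A B) : Hom A B :=
  sval (cid (proj2_sig c)).

Lemma qc_repr_sim (A B : qc_ob) (c : qc_hom A B) :
  qc_sim (qc_repr c) (qc_repr c).
Proof. by rewrite /qc_repr; case: cid => f []. Qed.

Lemma qc_reprK (A B : qc_ob) (c : qc_hom A B) : qc_class (qc_repr_sim c) = c.
Proof.
move: (qc_repr_sim c); rewrite /qc_repr.
by case: c => c cP /=; case: cid => f /= [ff cE] ff'; apply: eq_exist.
Qed.

Lemma qc_class_eq (A B : qc_ob) (f g : Hom A B) (ff : qc_sim f f)
    (gg : qc_sim g g) : qc_class ff = qc_class gg <-> qc_sim f g.
Proof.
split=> [[/(congr1 (fun c => c g)) E] | fg].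
  by have [] : qc_sim g g /\ qc_sim f g by rewrite E.
apply: eq_exist; apply: funext => h; apply: propext.
have gf := qc_sim_sym ff gg fg.
by split=> -[hh fh]; split=> //; [apply: qc_sim_trans gf fh | apply: qc_sim_trans fg fh].
Qed.

Lemma qc_repr_class (A B : qc_ob) (f : Hom A B) (ff : qc_sim f f) :
  qc_sim (qc_repr (qc_class ff)) f.
Proof. by apply/(qc_class_eq (qc_repr_sim _) ff); rewrite qc_reprK. Qed.

Definition qc_id (A : qc_ob) : qc_hom A A := qc_class (@qc_sim_id A).

Definition qc_cmp (A B D : qc_ob) (g : qc_hom B D) (f : qc_hom A B)
    : qc_hom A D :=
  qc_class (qc_sim_comp (qc_repr_sim f) (qc_repr_sim g)).

Lemma qc_cmpE (A B D : qc_ob) (g : Hom B D) (f : Hom A B)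
    (gg : qc_sim g g) (ff : qc_sim f f) (gf : qc_sim (g ∘ f) (g ∘ f)) :
  qc_cmp (qc_class gg) (qc_class ff) = qc_class gf.
Proof. by apply/qc_class_eq; apply: qc_sim_comp; apply: qc_repr_class. Qed.

Lemma qc_homP (A B : qc_ob) (c : qc_hom A B) :
  exists (f : Hom A B) (ff : qc_sim f f), c = qc_class ff.
Proof. by exists (qc_repr c), (qc_repr_sim c); rewrite qc_reprK. Qed.

Program Definition quot_compl : Category :=
  @MkCategory qc_ob qc_hom qc_id qc_cmp _ _ _.
Next Obligation.
have [g [gg ->]] := qc_homP f; rewrite (qc_cmpE _ _ (qc_sim_comp gg (@qc_sim_id Y))).
by apply/qc_class_eq; rewrite cmp1m.
Qed.
Next Obligation.
have [g [gg ->]] := qc_homP f; rewrite (qc_cmpE _ _ (qc_sim_comp (@qc_sim_id X) gg)).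
by apply/qc_class_eq; rewrite cmpm1.
Qed.
Next Obligation.
have [f' [ff ->]] := qc_homP f; have [g' [gg ->]] := qc_homP g.
have [h' [hh ->]] := qc_homP h.
have gf := qc_sim_comp ff gg; have hg := qc_sim_comp gg hh.
rewrite (qc_cmpE _ _ gf) (qc_cmpE _ _ hg).
rewrite (qc_cmpE _ _ (qc_sim_comp gf hh)) (qc_cmpE _ _ (qc_sim_comp ff hg)).
by apply/qc_class_eq; rewrite cmpA; apply: qc_sim_comp ff hg.
Qed.

Definition qc_fib (A : qc_ob) : InfSL :=
  sub_isl (P_des_top (qc_rel A)) (@P_des_meet _ _ _ (qc_rel A)).

Lemma P_des_rx (A B : qc_ob) (f : Hom A B) (b : P B) :
  qc_sim f f -> P_des (qc_rel B) b -> P_des (qc_rel A) (rx P f b).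
Proof.
move=> /P_rel_leP ff /P_desP db; apply/P_desP => Z a a'; rewrite -!rxM.
by apply: ile_trans (db _ _ _); apply: imeetS; [apply: ile_refl | apply: ff].
Qed.

Lemma qc_sim_rx (A B : qc_ob) (f g : Hom A B) (b : P B) :
  qc_sim f f -> qc_sim g g -> qc_sim f g -> P_des (qc_rel B) b ->
  rx P f b = rx P g b.
Proof.
move=> ff gg fg /P_desP db.
have le (h k : Hom A B) : qc_sim h h -> qc_sim h k -> rx P h b ⊑ rx P k b.
  move=> hh /(qc_simP _ hh) hk; apply: ile_trans (db _ h k).
  by apply: imeet_glb; [apply: ile_refl | apply: ile_top_trans].
by apply: ile_anti; apply: le => //; apply: qc_sim_sym.
Qed.

(** [P_f] for a representative [f]; see [qc_rxE]. *)
Definition qc_rx (A B : qc_ob) (c : qc_hom A B) (b : qc_fib B) : qc_fib A :=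
  exist _ (rx P (qc_repr c) (sval b))
    (P_des_rx (qc_repr_sim c) (proj2_sig b)).

Lemma qc_rxE (A B : qc_ob) (f : Hom A B) (ff : qc_sim f f) (b : qc_fib B) :
  sval (qc_rx (qc_class ff) b) = rx P f (sval b).
Proof.
apply: qc_sim_rx => //; [exact: qc_repr_sim | exact: qc_repr_class |].
exact: proj2_sig b.
Qed.

Program Definition qc_doc : Doctrine quot_compl :=
  @MkDoctrine quot_compl qc_fib qc_rx _ _ _.
Next Obligation.
by split=> [|b b']; apply: eq_exist; rewrite /= ?rx_top ?rx_meet.
Qed.
Next Obligation.
apply: eq_exist; rewrite -[RHS]rx1.
exact: (qc_rxE (@qc_sim_id X) (exist _ a H)).
Qed.
Next Obligation.
apply: eq_exist; rewrite -rxM.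
exact: (qc_rxE (qc_sim_comp (qc_repr_sim f) (qc_repr_sim g)) (exist _ a H)).
Qed.

Program Definition qc_one : qc_ob :=
  @MkQcOb (wpc P [::]) (itop : pi_class_isl P [:: _; _]) _.
Next Obligation.
by apply/P_eqrelP; split=> *; rewrite /bev !pev_top; apply: ile_top.
Qed.

Definition qc_prd_rel (A B : qc_ob)
    : pi_class P [:: wp_ob (wpc P [:: qc_car A; qc_car B]);
                     wp_ob (wpc P [:: qc_car A; qc_car B])] :=
  let w := wpc P [:: qc_car A; qc_car B] in
  (P_rel_rx (wp1 w) (wp1 w) (qc_rel A) : pi_class_isl P [:: _; _])
    ⊓ P_rel_rx (wp2 w) (wp2 w) (qc_rel B).

Lemma bev_prd (A B : qc_ob) (Z : C)
    (f g : Hom Z (wpc P [:: qc_car A; qc_car B])) :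
  bev (qc_prd_rel A B) f g =
    bev (qc_rel A) (wp1 _ ∘ f) (wp1 _ ∘ g)
    ⊓ bev (qc_rel B) (wp2 _ ∘ f) (wp2 _ ∘ g).
Proof. by rewrite /bev pev_meet !pev_rel_rx. Qed.

Program Definition qc_prd (A B : qc_ob) : qc_ob :=
  @MkQcOb (wpc P [:: qc_car A; qc_car B]) (qc_prd_rel A B) _.
Next Obligation.
apply/P_eqrelP; split=> [Z f | Z f g | Z f g h]; rewrite !bev_prd.
- by apply: imeet_glb; apply: qc_refl.
- by apply: imeetS; apply: qc_sym.
- apply: imeet_glb.
    apply: ile_trans (@qc_trans A _ (wp1 _ ∘ g) _ _).
    by apply: imeetS; apply: imeet_l.
  apply: ile_trans (@qc_trans B _ (wp2 _ ∘ g) _ _).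
  by apply: imeetS; apply: imeet_r.
Qed.

Lemma qc_sim_one (A : qc_ob) (f g : Hom A qc_one) : qc_sim f g.
Proof. by apply/P_rel_leP => Z a b; rewrite {2}/bev pev_top; apply: ile_top. Qed.

Lemma qc_sim_pr1 (A B : qc_ob) :
  @qc_sim (qc_prd A B) A (wp1 (wpc P [:: qc_car A; qc_car B])) (wp1 _).
Proof. by apply/P_rel_leP => Z a b; rewrite bev_prd; apply: imeet_l. Qed.

Lemma qc_sim_pr2 (A B : qc_ob) :
  @qc_sim (qc_prd A B) B (wp2 (wpc P [:: qc_car A; qc_car B])) (wp2 _).
Proof. by apply/P_rel_leP => Z a b; rewrite bev_prd; apply: imeet_r. Qed.

Lemma qc_sim_prd (Z A B : qc_ob) (h k : Hom Z (qc_prd A B)) :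
  @qc_sim Z A (wp1 _ ∘ h) (wp1 _ ∘ k) -> @qc_sim Z B (wp2 _ ∘ h) (wp2 _ ∘ k) ->
  qc_sim h k.
Proof.
move=> /P_rel_leP hk1 /P_rel_leP hk2; apply/P_rel_leP => U a b.
rewrite bev_prd !cmpA; apply: imeet_glb; [exact: hk1 | exact: hk2].
Qed.

Lemma qc_sim_pair (Z A B : qc_ob) (f f' : Hom Z A) (g g' : Hom Z B) :
  qc_sim f f' -> qc_sim g g' ->
  @qc_sim Z (qc_prd A B) (wlift2 (wpc P [:: qc_car A; qc_car B]) f g)
    (wlift2 (wpc P [:: qc_car A; qc_car B]) f' g').
Proof.
by move=> ff' gg'; apply: qc_sim_prd; rewrite ?wlift21 ?wlift22.
Qed.

Definition qc_pair (Z A B : qc_ob) (f : qc_hom Z A) (g : qc_hom Z B)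
    : qc_hom Z (qc_prd A B) :=
  qc_class (qc_sim_pair (qc_repr_sim f) (qc_repr_sim g)).

Lemma qc_pairE (Z A B : qc_ob) (f : Hom Z A) (g : Hom Z B)
    (ff : qc_sim f f) (gg : qc_sim g g) (h : Hom Z (qc_prd A B)) (hh : qc_sim h h) :
  wp1 _ ∘ h = f -> wp2 _ ∘ h = g ->
  qc_pair (qc_class ff) (qc_class gg) = qc_class hh.
Proof.
move=> h1 h2; apply/qc_class_eq; apply: qc_sim_prd.
  by rewrite wlift21 h1; apply: qc_repr_class.
by rewrite wlift22 h2; apply: qc_repr_class.
Qed.

Program Definition qc_fp : FinProd quot_compl :=
  @MkFinProd quot_compl qc_one
    (fun A => qc_class
      (@qc_sim_one A (wlift (wpc P [::]) (fun i : pos [::] => match i with end))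
         (wlift (wpc P [::]) (fun i : pos [::] => match i with end)))) _
    qc_prd (fun A B => qc_class (@qc_sim_pr1 A B))
    (fun A B => qc_class (@qc_sim_pr2 A B)) qc_pair _ _ _.
Next Obligation.
by have [g [gg ->]] := qc_homP f; apply/qc_class_eq; apply: qc_sim_one.
Qed.
Next Obligation.
rewrite -[RHS]qc_reprK.
rewrite (qc_cmpE _ _ (qc_sim_comp (qc_sim_pair (qc_repr_sim f) (qc_repr_sim g))
  (@qc_sim_pr1 X Y))).
by apply/qc_class_eq; rewrite wlift21; apply: qc_repr_sim.
Qed.
Next Obligation.
rewrite -[RHS]qc_reprK.
rewrite (qc_cmpE _ _ (qc_sim_comp (qc_sim_pair (qc_repr_sim f) (qc_repr_sim g))
  (@qc_sim_pr2 X Y))).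
by apply/qc_class_eq; rewrite wlift22; apply: qc_repr_sim.
Qed.
Next Obligation.
have [k [kk ->]] := qc_homP h.
rewrite (qc_cmpE _ _ (qc_sim_comp kk (@qc_sim_pr1 X Y))).
rewrite (qc_cmpE _ _ (qc_sim_comp kk (@qc_sim_pr2 X Y))).
by rewrite (qc_pairE _ _ kk).
Qed.

(** The equality of [(X, rho)] is the member of [rho] over the product of
    [(X, rho)] with itself. *)
Lemma qc_eq_des (A : qc_ob) :
  P_des (qc_rel (qc_prd A A)) (qc_rel A (wpc P [:: qc_car A; qc_car A])).
Proof.
apply/P_desP => Z f g; rewrite !bevE bev_prd.
apply: ile_trans (@qc_trans A _ (wp1 _ ∘ f) _ _); apply: imeet_glb.
  by apply: ile_meetr; apply: ile_meetl; apply: qc_sym.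
apply: ile_trans (@qc_trans A _ (wp2 _ ∘ f) _ _).
by apply: imeetS; [apply: ile_refl | apply: imeet_r].
Qed.

Definition qc_eq (A : qc_ob) : qc_fib (qc_prd A A) :=
  exist _ (qc_rel A (wpc P [:: qc_car A; qc_car A])) (@qc_eq_des A).

Lemma qc_eq_pair (Z A : qc_ob) (f g : qc_hom Z A) (f' g' : Hom Z A)
    (ff : qc_sim f' f') (gg : qc_sim g' g') :
  f = qc_class ff -> g = qc_class gg ->
  sval (rx qc_doc (pair qc_fp f g : Hom (Z : quot_compl) _) (qc_eq A)) =
    bev (qc_rel A) f' g'.
Proof.
move=> -> ->; set h := wlift2 (wpc P [:: qc_car A; qc_car A]) f' g'.
have hh : @qc_sim Z (qc_prd A A) h h by apply: qc_sim_pair.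
change (sval (qc_rx (qc_pair (qc_class ff) (qc_class gg)) (qc_eq A)) =
  bev (qc_rel A) f' g').
rewrite (qc_pairE _ _ hh) ?wlift21 ?wlift22 //.
by rewrite qc_rxE bevE wlift21 wlift22.
Qed.

Program Definition quot_doctrine : ElemDoctrine quot_compl :=
  @MkElemDoctrine quot_compl qc_doc qc_fp qc_eq _ _ _.
Next Obligation.
have L := qc_eq_pair (erefl (qc_class (@qc_sim_id X))) (erefl (qc_id X)).
rewrite /= in L; rewrite L; exact: qc_refl.
Qed.
Next Obligation.
change (rx P (qc_repr (qc_class (@qc_sim_pr1 X X))) a
  ⊓ qc_rel X (wpc P [:: qc_car X; qc_car X])
  ⊑ rx P (qc_repr (qc_class (@qc_sim_pr2 X X))) a).
have E1 := @qc_rxE _ _ _ (@qc_sim_pr1 X X) (exist _ a H).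
have E2 := @qc_rxE _ _ _ (@qc_sim_pr2 X X) (exist _ a H).
rewrite /= in E1 E2; rewrite E1 E2 -[qc_rel X _]rx1 bevE !cmpm1.
by move/P_desP: H; apply.
Qed.
Next Obligation.
pose XY := qc_prd X Y; pose w := wpc P [:: qc_car X; qc_car Y].
pose v := wpc P [:: qc_car XY; qc_car XY].
have e1 : @qc_sim (qc_prd XY XY) X (wp1 w ∘ wp1 v) (wp1 w ∘ wp1 v).
  exact: qc_sim_comp (@qc_sim_pr1 _ _) (@qc_sim_pr1 _ _).
have e2 : @qc_sim (qc_prd XY XY) Y (wp2 w ∘ wp1 v) (wp2 w ∘ wp1 v).
  exact: qc_sim_comp (@qc_sim_pr1 _ _) (@qc_sim_pr2 _ _).
have e3 : @qc_sim (qc_prd XY XY) X (wp1 w ∘ wp2 v) (wp1 w ∘ wp2 v).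
  exact: qc_sim_comp (@qc_sim_pr2 _ _) (@qc_sim_pr1 _ _).
have e4 : @qc_sim (qc_prd XY XY) Y (wp2 w ∘ wp2 v) (wp2 w ∘ wp2 v).
  exact: qc_sim_comp (@qc_sim_pr2 _ _) (@qc_sim_pr2 _ _).
have L1 := qc_eq_pair (ff := e1) (gg := e3)
  (qc_cmpE (@qc_sim_pr1 X Y) (@qc_sim_pr1 XY XY) e1)
  (qc_cmpE (@qc_sim_pr1 X Y) (@qc_sim_pr2 XY XY) e3).
have L2 := qc_eq_pair (ff := e2) (gg := e4)
  (qc_cmpE (@qc_sim_pr2 X Y) (@qc_sim_pr1 XY XY) e2)
  (qc_cmpE (@qc_sim_pr2 X Y) (@qc_sim_pr2 XY XY) e4).
rewrite /= in L1 L2; rewrite L1 L2; apply: ile_eq.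
rewrite -[RHS]rx1 -[RHS]/(rx P (idm (wp_ob v)) (qc_prd_rel X Y v)).
by rewrite bevE !cmpm1 bev_prd.
Qed.

Definition J_ob (X : C) : qc_ob := MkQcOb (delta_class_eqrel P X).

Lemma J_sim (X Y : C) (f : Hom X Y) : @qc_sim (J_ob X) (J_ob Y) f f.
Proof.
by apply/P_rel_leP => Z a b; rewrite /bev !pev_delta_class; apply: deq_arr.
Qed.

Program Definition J_fun : Functor C quot_compl :=
  @MkFunctor C quot_compl J_ob (fun X Y f => qc_class (J_sim f)) _ _.
Next Obligation. by apply/qc_class_eq; apply: J_sim. Qed.
Next Obligation. exact/esym/(@qc_cmpE (J_ob X) (J_ob Y) (J_ob Z) g f (J_sim g) (J_sim f)
  (J_sim (g ∘ f))). Qed.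

Program Definition J_arrow : OneArrow P quot_doctrine :=
  @MkOneArrow C quot_compl P quot_doctrine J_fun
    (fun X a => exist _ a (delta_class_des a)) _ _.
Next Obligation. by split=> [|x y]; apply: eq_exist. Qed.
Next Obligation.
by apply: eq_exist; rewrite -(qc_rxE (J_sim f) (exist _ a (delta_class_des a))).
Qed.

End QuotientCompletion.

Section LeftCovering.
Variables (C D : Category) (P : BiasedElem C) (R : ElemDoctrine D).

Record is_lco (F : OneArrow P R) : Prop := MkIsLco {
  lco_prod : forall (X Y : C) (w : weak_prod [:: X; Y]),
    is_quotient_map R (pair (ed_fp R) (fmap F (wp1 w)) (fmap F (wp2 w)));
  lco_one : forall w : weak_prod (C := C) [::],
    is_quotient_map R (bang (ed_fp R) (F w));
  lco_eq : forall (X : C) (w : weak_prod [:: X; X]),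
    oa_map F (bd P w) =
      rx R (pair (ed_fp R) (fmap F (wp1 w)) (fmap F (wp2 w))) (eqd R (F X));
  lco_comprehension : forall (X A : C) (a : P A) (c : Hom X A),
    is_weak_comprehension a c ->
    forall (E : D) (e : Hom E (F A)), is_comprehension (oa_map F a) e ->
      exists q : Hom (F X) E, is_quotient_map R q /\ fmap F c = e ∘ q }.

End LeftCovering.

Definition Lco (C : Category) (P : BiasedElem C) (R : QD) : Category :=
  full_sub (A := OneArrowCat P R) (@is_lco _ _ P R).

(* Main.v *)
(** Full comprehensions and comprehensive diagonals reduce every inequality of the
    fibres to a statement about generalized elements, [z ⊩ a] meaning that the
    reindexing of [a] along [z] is the top; in particular [δ] is equality.  In a
    doctrine of QD the quotient maps are then the coequalizers of their kernels,
    and they are stable, so that identities may be checked locally along them.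

    In the completion, the quotient maps are the arrows along which the objects
    [J X] are projective, and each object [(X, rho)] is a quotient of [J X].  Hence a
    2-arrow is determined by its restriction along [J], and one defined on the
    objects [J X] descends to the quotients.  A left covering [(F, f)] extends to
    [(X, rho)] by the quotient of [F X] by the relation induced by [f rho]: this
    relation lives on [F X * F X] because [F W], for a weak product [W] of [X] with
    itself, is a quotient cover of it along which [f rho] descends by proof
    irrelevance. *)

From mathcomp Require Import all_boot.
From mathcomp Require Import boolp.
Require Import Defs.

Set Implicit Arguments.
Unset Strict Implicit.
Unset Printing Implicit Defensive.

Local Open Scope cat_scope.

(** * Regular epimorphisms and quotient maps *)

Definition epi (C : Category) (X Y : C) (q : Hom X Y) : Prop :=
  forall (Z : C) (h k : Hom Y Z), h ∘ q = k ∘ q -> h = k.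

Definition mono (C : Category) (X Y : C) (m : Hom X Y) : Prop :=
  forall (Z : C) (h k : Hom Z X), m ∘ h = m ∘ k -> h = k.

(** The coequalizer property of the kernel pair, phrased through all parallel pairs identified by
    [q], so that it makes sense in a category without pullbacks. *)
Definition reg_epi (C : Category) (X Y : C) (q : Hom X Y) : Prop :=
  forall (Z : C) (g : Hom X Z),
    (forall (T : C) (a b : Hom T X), q ∘ a = q ∘ b -> g ∘ a = g ∘ b) ->
    exists! h : Hom Y Z, g = h ∘ q.

Section RegularEpis.
Variable C : Category.

Lemma reg_epi_epi (X Y : C) (q : Hom X Y) : reg_epi q -> epi q.
Proof.
move=> qr Z h k hk; have [|l [_ lu]] := qr Z (h ∘ q).
  by move=> T a b ab; rewrite -!cmpA ab.
by rewrite -(lu h erefl) -(lu k hk).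
Qed.

Lemma is_iso_reg_epi (X Y : C) (q : Hom X Y) : is_iso q -> reg_epi q.
Proof.
case=> r [rq qr] Z g gq; exists (g ∘ r); split=> [|h ->]; last first.
  by rewrite -cmpA qr cmpm1.
by rewrite -cmpA -[LHS]cmpm1; apply: gq; rewrite cmpm1 cmpA qr cmp1m.
Qed.

Lemma reg_epi_mono_iso (X Y : C) (q : Hom X Y) : reg_epi q -> mono q -> is_iso q.
Proof.
move=> qr qm; have [|h [hq _]] := qr X (idm X).
  by move=> T a b /qm ->.
exists h; split=> //; apply: (reg_epi_epi qr).
by rewrite -cmpA -hq cmpm1 cmp1m.
Qed.

(** Regular epimorphisms are orthogonal to monomorphisms: [x] identifies whatever [t] does because
    [m] is mono, so it descends along [t] to the filler. *)
Lemma mono_factor (X Y T S : C) (m : Hom X Y) (y : Hom T Y) (t : Hom S T)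
    (x : Hom S X) : mono m -> reg_epi t -> m ∘ x = y ∘ t ->
  exists h, y = m ∘ h.
Proof.
move=> mm tr mx; have [|h [xh _]] := tr X x.
  by move=> Z a b ab; apply: mm; rewrite !cmpA mx -!cmpA ab.
by exists h; apply: (reg_epi_epi tr); rewrite -mx xh cmpA.
Qed.

Lemma comprehension_mono (P : Doctrine C) (X A : C) (a : P A) (c : Hom X A) :
  is_comprehension a c -> mono c.
Proof.
case=> c1 cu Z h k hk; have [|l [_ lu]] := cu Z (c ∘ h).
  by rewrite rxM; apply: rx_ge_top.
by rewrite -(lu h erefl) -(lu k hk).
Qed.

End RegularEpis.

Section Products.
Variables (C : Category) (FP : FinProd C).

Lemma pair_ext (Z X Y : C) (h k : Hom Z (prd FP X Y)) :
  pr1 FP X Y ∘ h = pr1 FP X Y ∘ k -> pr2 FP X Y ∘ h = pr2 FP X Y ∘ k -> h = k.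
Proof. by move=> e1 e2; rewrite (pair_uniq h) (pair_uniq k) e1 e2. Qed.

Lemma pair_cmp (Z T X Y : C) (f : Hom Z X) (g : Hom Z Y) (k : Hom T Z) :
  pair FP f g ∘ k = pair FP (f ∘ k) (g ∘ k).
Proof. by apply: pair_ext; rewrite cmpA ?pair1 ?pair2. Qed.

Lemma pmap_pair (Z X Y X' Y' : C) (f : Hom Z X) (g : Hom Z Y) (h : Hom X X')
    (k : Hom Y Y') : pmap FP h k ∘ pair FP f g = pair FP (h ∘ f) (k ∘ g).
Proof. by rewrite /pmap pair_cmp -!cmpA pair1 pair2. Qed.

Lemma bang_ext (X : C) (f g : Hom X (one FP)) : f = g.
Proof. by rewrite (bang_uniq f) (bang_uniq g). Qed.

End Products.

(** * Generalized elements of a doctrine *)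

Definition forces (C : Category) (P : Doctrine C) (Z X : C) (z : Hom Z X)
  (a : P X) : Prop := itop ⊑ rx P z a.

Notation "z ⊩ a" := (forces z a) (at level 70, no associativity) : cat_scope.

Section Forcing.
Variables (C : Category) (P : Doctrine C).

Lemma forces_rx (Z X Y : C) (z : Hom Z X) (f : Hom X Y) (a : P Y) :
  z ⊩ rx P f a <-> f ∘ z ⊩ a.
Proof. by rewrite /forces rxM. Qed.

Lemma forces_cmp (Z X T : C) (z : Hom Z X) (k : Hom T Z) (a : P X) :
  z ⊩ a -> z ∘ k ⊩ a.
Proof. by rewrite /forces rxM; apply: rx_ge_top. Qed.

Lemma forces_le (Z X : C) (z : Hom Z X) (a b : P X) : a ⊑ b -> z ⊩ a -> z ⊩ b.
Proof. by move=> ab za; apply: ile_trans za _; apply: rx_mono. Qed.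

Lemma forces_meet (Z X : C) (z : Hom Z X) (a b : P X) :
  z ⊩ a ⊓ b <-> z ⊩ a /\ z ⊩ b.
Proof.
split=> [ab | [za zb]].
  by split; apply: forces_le ab; [apply: imeet_l | apply: imeet_r].
by rewrite /forces rx_meet; apply: imeet_glb.
Qed.

Lemma forces_top (Z X : C) (z : Hom Z X) : z ⊩ (itop : P X).
Proof. by rewrite /forces rx_top; apply: ile_refl. Qed.

Hypothesis full : forall (A : C) (a : P A),
  exists (X : C) (c : Hom X A), c ⊩ a /\ is_full a c.

(** Test on a full comprehension of [a], the generic element forcing it. The hypothesis [full] is
    what strict and weak full comprehensions have in common, so the lemma serves both [R] and
    [P]. *)
Lemma forces_leP (X : C) (a b : P X) :
  (forall (Z : C) (z : Hom Z X), z ⊩ a -> z ⊩ b) -> a ⊑ b.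
Proof. by move=> ab; have [Z [c [ca cf]]] := full a; apply/cf/ab. Qed.

Lemma forces_eq (X : C) (a b : P X) :
  (forall (Z : C) (z : Hom Z X), z ⊩ a <-> z ⊩ b) -> a = b.
Proof. by move=> ab; apply: ile_anti; apply: forces_leP => Z z; apply ab. Qed.

End Forcing.

Lemma full_comprehension (C : Category) (P : Doctrine C) :
  has_full_comprehensions P -> forall (A : C) (a : P A),
  exists (X : C) (c : Hom X A), c ⊩ a /\ is_full a c.
Proof. by move=> H A a; have [X [c [[c1 _] c2]]] := H A a; exists X, c. Qed.

Lemma full_weak_comprehension (C : Category) (P : Doctrine C) :
  has_full_weak_comprehensions P -> forall (A : C) (a : P A),
  exists (X : C) (c : Hom X A), c ⊩ a /\ is_full a c.
Proof. by move=> H A a; have [X [c [[c1 _] c2]]] := H A a; exists X, c. Qed.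

(** * Kernels and pullbacks from comprehensions and comprehensive diagonals *)

Section Kernels.
Variables (D : Category) (R : ElemDoctrine D).
Hypothesis Rcompr : has_full_comprehensions R.
Hypothesis Rdiag : comprehensive_diagonals R.
Local Notation FP := (ed_fp R).

Let leP := forces_leP (full_comprehension Rcompr).

Definition ker (X Y : D) (q : Hom X Y) : R (prd FP X X) :=
  rx R (pmap FP q q) (eqd R Y).

Lemma forces_eqd (Z X : D) (f g : Hom Z X) : pair FP f g ⊩ eqd R X <-> f = g.
Proof. exact: Rdiag. Qed.

Lemma forces_ker (Z X Y : D) (q : Hom X Y) (f g : Hom Z X) :
  pair FP f g ⊩ ker q <-> q ∘ f = q ∘ g.
Proof. by rewrite forces_rx pmap_pair; apply: forces_eqd. Qed.

Lemma rel_leP (X Y : D) (r s : R (prd FP X Y)) :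
  (forall (Z : D) (f : Hom Z X) (g : Hom Z Y),
    pair FP f g ⊩ r -> pair FP f g ⊩ s) -> r ⊑ s.
Proof. by move=> rs; apply: leP => Z z; rewrite (pair_uniq z); apply: rs. Qed.

Lemma is_eqrelP (X : D) (r : R (prd FP X X)) :
  is_eqrel r <->
  [/\ forall (Z : D) (f : Hom Z X), pair FP f f ⊩ r,
      forall (Z : D) (f g : Hom Z X), pair FP f g ⊩ r -> pair FP g f ⊩ r &
      forall (Z : D) (f g h : Hom Z X),
        pair FP f g ⊩ r -> pair FP g h ⊩ r -> pair FP f h ⊩ r].
Proof.
split=> [[r1 r2 r3] | [r1 r2 r3]].
  split=> [Z f | Z f g fg | Z f g h fg gh].
  - have := forces_cmp f (r1 : diag FP X ⊩ r).
    by rewrite /diag pair_cmp !cmp1m.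
  - apply: (forces_le r2); rewrite forces_rx pair_cmp pair1 pair2.
    exact: fg.
  - have : pair FP (pair FP f g) h ⊩
      rx R (pair FP (pr1 FP X X ∘ pr1 FP (prd FP X X) X)
             (pr2 FP (prd FP X X) X)) r.
      apply: (forces_le r3); apply/forces_meet; rewrite !forces_rx.
      by rewrite !pair_cmp -!cmpA !pair1 !pair2 ?pair1; split.
    by rewrite forces_rx !pair_cmp -!cmpA !pair1 !pair2 ?pair1.
split.
- exact: r1.
- by apply: rel_leP => Z f g; rewrite forces_rx pair_cmp pair1 pair2 => /r2.
- apply: leP => Z z; rewrite forces_meet !forces_rx !pair_cmp -!cmpA => -[].
  exact: r3.
Qed.

Lemma ker_eqrel (X Y : D) (q : Hom X Y) : is_eqrel (ker q).
Proof.
apply/is_eqrelP; split=> [Z f | Z f g | Z f g h]; rewrite !forces_ker //.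
by move=> -> ->.
Qed.

Lemma ker_leP (X Y : D) (r : R (prd FP X X)) (q : Hom X Y) :
  r ⊑ ker q <->
  forall (Z : D) (f g : Hom Z X), pair FP f g ⊩ r -> q ∘ f = q ∘ g.
Proof.
split=> [rq Z f g fg | rq]; first by apply/forces_ker; apply: forces_le fg.
by apply: rel_leP => Z f g /rq /forces_ker.
Qed.

Lemma reg_epi_quotient (X Y : D) (q : Hom X Y) :
  reg_epi q -> is_quotient (ker q) q.
Proof.
move=> qr; split=> [|Z g /ker_leP gq]; first exact: ile_refl.
by apply: qr => T a b /forces_ker /gq.
Qed.

Lemma reg_epi_quotient_map (X Y : D) (q : Hom X Y) :
  reg_epi q -> is_quotient_map R q.
Proof.
by move=> qr; exists (ker q); split; [apply: ker_eqrel | apply: reg_epi_quotient].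
Qed.

Lemma ker_is_quotient_reg_epi (X Y : D) (q : Hom X Y) :
  is_quotient (ker q) q -> reg_epi q.
Proof.
case=> _ qu Z g gq; apply: qu; apply/ker_leP => T a b /forces_ker.
exact: gq.
Qed.

(** The pullback is the comprehension of the relation [f x = g y] on the product of [X] and [Y],
    obtained by reindexing the equality of [Z]. *)
Lemma pullback_exists (X Y Z : D) (f : Hom X Z) (g : Hom Y Z) :
  exists (W : D) (p : Hom W X) (q : Hom W Y), is_pullback f g p q.
Proof.
have [W [c [[c1 cu] _]]] := Rcompr
  (rx R (pair FP (f ∘ pr1 FP X Y) (g ∘ pr2 FP X Y)) (eqd R Z)).
exists W, (pr1 FP X Y ∘ c), (pr2 FP X Y ∘ c); split.
  move: (c1 : c ⊩ _); rewrite forces_rx pair_cmp -!cmpA.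
  by move/forces_eqd.
move=> V a b ab; have [|h [hc hu]] := cu V (pair FP a b).
  change (pair FP a b ⊩ rx R (pair FP (f ∘ pr1 FP X Y) (g ∘ pr2 FP X Y)) (eqd R Z)).
  by rewrite forces_rx pair_cmp -!cmpA pair1 pair2; apply/forces_eqd.
exists h; split=> [|k [ka kb]]; first by rewrite -!cmpA -hc pair1 pair2.
by apply: hu; apply: (@pair_ext _ FP); rewrite ?pair1 ?pair2 cmpA.
Qed.

End Kernels.

(** * Regular epimorphisms in a doctrine of QD *)

Section QDTheory.
Variables (D : Category) (R : ElemDoctrine D).
Hypothesis RQD : in_QD R.
Local Notation FP := (ed_fp R).

Let Rcompr := QD_comprehension RQD.
Let Rdiag := QD_diagonals RQD.

Lemma quotient_ker (X Y : D) (r : R (prd FP X X)) (q : Hom X Y) :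
  is_eqrel r -> is_quotient r q -> r = ker R q.
Proof. by move=> re rq; have [_ ? _] := QD_good_quotient RQD re rq. Qed.

(** By effectiveness the relation can only be the kernel of [q], so the existential over relations
    disappears. *)
Lemma quotient_mapP (X Y : D) (q : Hom X Y) :
  is_quotient_map R q <-> reg_epi q.
Proof.
split=> [[r [re rq]] | ]; last exact: reg_epi_quotient_map.
apply: (ker_is_quotient_reg_epi Rcompr Rdiag).
by rewrite -(quotient_ker re rq).
Qed.

Lemma reg_epi_good (X Y : D) (q : Hom X Y) : reg_epi q ->
  is_stable R q /\ is_effective_descent (ker R q) q.
Proof.
move=> /(reg_epi_quotient Rcompr Rdiag) qq.
by have [? _ ?] := QD_good_quotient RQD (ker_eqrel Rcompr Rdiag q) qq.
Qed.

(** Stability in terms of elements: the cover [t] is the pullback of [q] along [z]. *)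
Lemma reg_epi_lift (X Y T : D) (q : Hom X Y) (z : Hom T Y) : reg_epi q ->
  exists (S : D) (t : Hom S T) (x : Hom S X), reg_epi t /\ q ∘ x = z ∘ t.
Proof.
move=> /reg_epi_good[qs _].
have [W [p [t pb]]] := pullback_exists Rcompr Rdiag q z.
exists W, t, p; split; last by case: pb.
exact/quotient_mapP/(qs _ _ _ _ _ pb).
Qed.

(** Effective descent makes reindexing along [q] injective; the order follows since [a ⊑ b] amounts
    to [a ⊓ b = a]. *)
Lemma reg_epi_rx_le (X Y : D) (q : Hom X Y) (a b : R Y) : reg_epi q ->
  rx R q a ⊑ rx R q b -> a ⊑ b.
Proof.
move=> /reg_epi_good[_ [qdes [_ [g [_ [qg _]]]]]] ab.
have <- : a ⊓ b = a; last exact: imeet_r.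
apply: (can_inj qg); apply: eq_exist; rewrite rx_meet.
by apply: ile_anti; [apply: imeet_l | apply: imeet_glb; [apply: ile_refl|]].
Qed.

Lemma reg_epi_rx_inj (X Y : D) (q : Hom X Y) (a b : R Y) : reg_epi q ->
  rx R q a = rx R q b -> a = b.
Proof.
by move=> qr ab; apply: ile_anti; apply: (reg_epi_rx_le qr); rewrite ab;
  apply: ile_refl.
Qed.

Lemma forces_local (T Z X : D) (t : Hom T Z) (z : Hom Z X) (a : R X) :
  reg_epi t -> z ∘ t ⊩ a -> z ⊩ a.
Proof.
by move=> tr; rewrite /forces rxM -(rx_top R t); apply: reg_epi_rx_le.
Qed.

(** The surjective half of effective descent: the hypothesis says on elements that [a] is a descent
    datum for the kernel of [q]. *)
Lemma descent (X Y : D) (q : Hom X Y) (a : R X) : reg_epi q ->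
  (forall (T : D) (x y : Hom T X), q ∘ x = q ∘ y -> x ⊩ a -> y ⊩ a) ->
  exists b : R Y, rx R q b = a.
Proof.
move=> /reg_epi_good[_ [qdes [_ [g [_ [_ gq]]]]]] qa.
have ad : is_des (ker R q) a.
  apply: (rel_leP Rcompr) => Z x y; rewrite forces_meet !forces_rx pair1 pair2.
  rewrite -forces_rx => -[xa /(forces_ker Rdiag) xy].
  exact: qa xy xa.
by exists (g (exist _ a ad)); have [] := gq (exist _ a ad).
Qed.

(** Regular epimorphisms compose because of stability: two elements of [Y] identified by [p] are
    lifted along [q] over successive covers, and compared there. *)
Lemma reg_epi_comp (X Y Z : D) (p : Hom Y Z) (q : Hom X Y) :
  reg_epi p -> reg_epi q -> reg_epi (p ∘ q).
Proof.
move=> pr qr T g gpq.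
have [|h [gh hu]] := qr T g.
  by move=> S a b ab; apply: gpq; rewrite -!cmpA ab.
have [|k [hk ku]] := pr T h.
  move=> S a b ab.
  have [S1 [t1 [x1 [t1r x1E]]]] := reg_epi_lift a qr.
  have [S2 [t2 [x2 [t2r x2E]]]] := reg_epi_lift (b ∘ t1) qr.
  apply: (reg_epi_epi t1r); apply: (reg_epi_epi t2r).
  rewrite -!cmpA [b ∘ _]cmpA -x2E [a ∘ _]cmpA -x1E !cmpA -gh -cmpA.
  by apply: gpq; rewrite cmpA -[p ∘ q ∘ x1]cmpA x1E -[p ∘ q ∘ x2]cmpA x2E !cmpA ab.
exists k; split; first by rewrite cmpA -hk.
by move=> k' gk'; apply: ku; apply: hu; rewrite gk' cmpA.
Qed.

(** The candidate [h] comes from [g ∘ q]. Since [q] need not be epi, [g = h ∘ p] is checked on a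
    cover of [Y] over which [p] lifts through [p ∘ q]. *)
Lemma reg_epi_cancel (X Y Z : D) (p : Hom Y Z) (q : Hom X Y) :
  reg_epi (p ∘ q) -> reg_epi p.
Proof.
move=> pqr T g gp.
have [|h [gh hu]] := pqr T (g ∘ q).
  by move=> S a b; rewrite -!cmpA; apply: gp.
exists h; split; last by move=> k gk; apply: hu; rewrite gk cmpA.
have [S [t [x [tr xE]]]] := reg_epi_lift p pqr.
apply: (reg_epi_epi tr); rewrite -[RHS]cmpA -xE cmpA -gh -cmpA.
by apply: gp; rewrite cmpA xE.
Qed.

(** At the generic element [idm Y] the hypothesis writes a regular epimorphism as [p ∘ x], and [x]
    can be cancelled. *)
Lemma reg_epi_local (X Y : D) (p : Hom X Y) :
  (forall (T : D) (z : Hom T Y),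
    exists (S : D) (t : Hom S T) (x : Hom S X), reg_epi t /\ p ∘ x = z ∘ t) ->
  reg_epi p.
Proof.
move=> /(_ Y (idm Y))[S [t [x [tr xE]]]]; apply: (@reg_epi_cancel _ _ _ _ x).
by rewrite xE cmp1m.
Qed.

End QDTheory.

(** * The quotient completion *)

Lemma isl_isoP (L M : InfSL) (phi : L -> M) :
  isl_hom phi -> (forall x y, phi x ⊑ phi y -> x ⊑ y) ->
  (forall y, exists x, phi x = y) -> isl_iso phi.
Proof.
move=> phiH phi_le phi_surj; split=> //; have [psi psiK] := choice phi_surj.
have phi_inj x y : phi x = phi y -> x = y.
  by move=> xy; apply: ile_anti; apply: phi_le; rewrite xy; apply: ile_refl.
have [phi1 phiM] := phiH.
exists psi; split; last by split=> [x|//]; apply/phi_inj/psiK.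
by split=> [|x y]; apply: phi_inj; rewrite ?phiM !psiK ?phi1.
Qed.

(** * Generalized elements of a biased doctrine *)

Section WeakForcing.
Variables (C : Category) (P : BiasedElem C).
Hypothesis Pcompr : has_full_weak_comprehensions P.
Hypothesis Pdiag : biased_comprehensive_diagonals P.

Let leP := forces_leP (full_weak_comprehension Pcompr).

Definition related (X Y Z : C) (r : pi_class P [:: X; Y]) (a : Hom Z X)
  (b : Hom Z Y) : Prop := itop ⊑ bev r a b.

Lemma forces_bev (X Y Z T : C) (r : pi_class P [:: X; Y]) (a : Hom Z X)
    (b : Hom Z Y) (k : Hom T Z) :
  k ⊩ bev r a b <-> related r (a ∘ k) (b ∘ k).
Proof. by rewrite /forces bev_rx. Qed.

Lemma forces_pic (X Y Z : C) (r : pi_class P [:: X; Y]) (w : weak_prod [:: X; Y])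
    (h : Hom Z w) : h ⊩ r w <-> related r (wp1 w ∘ h) (wp2 w ∘ h).
Proof. by rewrite /forces bevE. Qed.

Lemma bev_leP (X Y X' Y' Z : C) (r : pi_class P [:: X; Y]) (a : Hom Z X)
    (b : Hom Z Y) (s : pi_class P [:: X'; Y']) (a' : Hom Z X') (b' : Hom Z Y') :
  bev r a b ⊑ bev s a' b' <->
  forall (T : C) (k : Hom T Z),
    related r (a ∘ k) (b ∘ k) -> related s (a' ∘ k) (b' ∘ k).
Proof.
split=> [le T k /forces_bev ab | le]; first exact/forces_bev/(forces_le le).
by apply: leP => T k /forces_bev /le /forces_bev.
Qed.

Lemma related_delta (X Z : C) (a b : Hom Z X) :
  related (delta_class P X) a b <-> a = b.
Proof.
rewrite /related /bev pev_delta_class /=; split=> [ab | ->]; last exact: deq_refl.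
apply/Pdiag; exists (wpc P [:: X; X]), (wlift2 (wpc P [:: X; X]) a b).
by rewrite wlift21 wlift22.
Qed.

Lemma qc_sim_relatedP (A B : qc_ob P) (f g : Hom (qc_car A) B) :
  qc_sim f g <-> forall (Z : C) (a b : Hom Z A),
    related (qc_rel A) a b -> related (qc_rel B) (f ∘ a) (g ∘ b).
Proof.
split=> [/P_rel_leP fg Z a b ab | fg]; first exact: ile_trans ab (fg Z a b).
apply/P_rel_leP => Z a b; apply/bev_leP => T k ab.
by rewrite -!cmpA; apply: fg.
Qed.

Lemma P_des_relatedP (X : C) (r : pi_class P [:: X; X]) (a : P X) :
  P_des r a <-> forall (Z : C) (f g : Hom Z X), related r f g -> f ⊩ a -> g ⊩ a.
Proof.
split=> [/P_desP ra Z f g fg fa | ra].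
  by apply: ile_trans (ra Z f g); apply: imeet_glb.
apply/P_desP => Z f g; apply: leP => T k /forces_meet[].
by rewrite forces_bev !forces_rx => fa fg; apply: ra fa.
Qed.

Lemma P_eqrel_relatedP (X : C) (r : pi_class P [:: X; X]) :
  P_eqrel r <->
  [/\ forall Z (f : Hom Z X), related r f f,
      forall Z (f g : Hom Z X), related r f g -> related r g f &
      forall Z (f g h : Hom Z X), related r f g -> related r g h -> related r f h].
Proof.
rewrite P_eqrelP; split=> -[r1 r2 r3]; split=> //.
- by move=> Z f g fg; apply: ile_trans fg (r2 _ _ _).
- by move=> Z f g h fg gh; apply: ile_trans (r3 _ _ g _); apply: imeet_glb.
- by move=> Z f g; apply/bev_leP => T k; apply: r2.
- by move=> Z f g h; apply: leP => T k /forces_meet[]; rewrite !forces_bev; apply: r3.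
Qed.

Lemma related_refl (A : qc_ob P) (Z : C) (f : Hom Z A) : related (qc_rel A) f f.
Proof. exact: qc_refl. Qed.

(** An irrelevant element over a single weak product spreads to all of them by reindexing along any
    comparison arrow; irrelevance makes the choice immaterial. *)
Program Definition pi_class_of (l : seq C) (w : weak_prod l) (a : P w)
    (ai : proof_irrelevant a) : pi_class P l :=
  @MkPiClass C P l (fun v => rx P (wlift w (wpr v)) a) _ _.
Next Obligation.
apply/proof_irrelevantP => A g g'; rewrite -!rxM.
move/proof_irrelevantP: ai => /(_ A (wlift w (wpr w0) ∘ g) (wlift w (wpr w0) ∘ g')).
by under eq_bigr => i _ do rewrite !cmpA wliftE.
Qed.
Next Obligation.
rewrite -rxM; apply: proof_irrelevant_eq => // i.
by rewrite cmpA !wliftE.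
Qed.

Lemma pi_class_ofE (l : seq C) (w : weak_prod l) (a : P w)
    (ai : proof_irrelevant a) : pi_class_of ai w = a.
Proof.
rewrite /= -[RHS]rx1; apply: proof_irrelevant_eq => // i.
by rewrite wliftE cmpm1.
Qed.

(** Where the equalities in the definition are forced, the projections of the two elements really
    coincide, by comprehensive diagonals. So only elements with equal projections have to be
    compared. *)
Lemma proof_irrelevant_forcesP (l : seq C) (w : weak_prod l) (a : P w) :
  proof_irrelevant a <->
  forall (Z : C) (g g' : Hom Z w),
    (forall i, wpr w i ∘ g = wpr w i ∘ g') -> g ⊩ a -> g' ⊩ a.
Proof.
split=> [ai Z g g' gg' | ai].
  by rewrite /forces (proof_irrelevant_eq ai gg').
apply/proof_irrelevantP => Z g g'; apply: leP => T k /forces_meet[].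
rewrite !forces_rx => gk kk; apply: ai gk => i.
apply/related_delta; rewrite /related /bev pev_delta_class /= !cmpA -deq_rx.
apply: (forces_le _ kk); exact: (big_ile (fun i => deq P (wpr w i ∘ g) (wpr w i ∘ g'))).
Qed.

End WeakForcing.

(** What is needed of the quotient completion, where [cov A] is the class of the
    identity, seen as an arrow from [J X] to [A = (X, rho)].  The arguments below
    run over an arbitrary presentation because unification of terms over the
    concrete category of classes of arrows is prohibitively slow. *)
Record presentation (C E : Category) (P : BiasedElem C) (Q : ElemDoctrine E)
    (J : OneArrow P Q) (car : E -> C)
    (rel : forall A : E, pi_class P [:: car A; car A])
    (cov : forall A : E, Hom (J (car A)) A) : Prop := MkPresentation {
  pre_compr : has_full_comprehensions Q;
  pre_diag : comprehensive_diagonals Q;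
  pre_J_le : forall (X : C) (a b : P X), oa_map J a ⊑ oa_map J b -> a ⊑ b;
  pre_J_faithful : forall (X Y : C) (f g : Hom X Y),
    fmap J f = fmap J g -> f = g;
  pre_J_full : forall (X Y : C) (z : Hom (J X) (J Y)), exists f, z = fmap J f;
  pre_cov_lift : forall (X : C) (A : E) (z : Hom (J X) A),
    exists f : Hom X (car A), z = cov A ∘ fmap J f;
  pre_cov_related : forall (X : C) (A : E) (f g : Hom X (car A)),
    cov A ∘ fmap J f = cov A ∘ fmap J g <-> related (rel A) f g;
  pre_cov_epi : forall A : E, epi (cov A);
  pre_cov_desc : forall (A B : E) (f : Hom (car A) (car B)),
    (forall (Z : C) (a b : Hom Z (car A)),
      related (rel A) a b -> related (rel B) (f ∘ a) (f ∘ b)) ->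
    exists c : Hom A B, c ∘ cov A = cov B ∘ fmap J f;
  pre_forces_cov : forall (Z A : E) (z : Hom Z A) (a : Q A),
    z ∘ cov Z ⊩ a -> z ⊩ a;
  pre_val : forall (A : E) (a : Q A),
    exists b : P (car A), P_des (rel A) b /\ rx Q (cov A) a = oa_map J b;
  pre_des : forall (A : E) (b : P (car A)), P_des (rel A) b ->
    exists a : Q A, rx Q (cov A) a = oa_map J b;
  pre_quotient : forall (A : E) (r : Q (prd (ed_fp Q) A A)), is_eqrel r ->
    exists (B : E) (q : Hom A B),
    (exists x : Hom (J (car B)) A, cov B = q ∘ x) /\
    forall (X : C) (f g : Hom X (car A)),
      q ∘ (cov A ∘ fmap J f) = q ∘ (cov A ∘ fmap J g) <->
      pair (ed_fp Q) (cov A ∘ fmap J f) (cov A ∘ fmap J g) ⊩ r }.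

Arguments presentation {C E P Q} J {car} rel cov.

(** * The concrete completion satisfies the presentation *)

Section QuotientCompletionTheory.
Variables (C : Category) (P : BiasedElem C).
Hypothesis Pcompr : has_full_weak_comprehensions P.
Hypothesis Pdiag : biased_comprehensive_diagonals P.
Local Notation Cbar := (quot_compl P).
Local Notation Pbar := (quot_doctrine P).
Local Notation FP := (ed_fp Pbar).
Local Notation J := (J_fun P).

Let rel_delta := related_delta Pdiag.
Let simP := qc_sim_relatedP Pcompr.
Let desP := P_des_relatedP Pcompr.
Let eqrelP := P_eqrel_relatedP Pcompr.
Let irrP := proof_irrelevant_forcesP Pcompr Pdiag.

Definition represents (A B : Cbar) (c : Hom A B) (f : Hom (qc_car A) (qc_car B))
    : Prop :=
  exists ff : @qc_sim _ P A B f f, c = qc_class ff.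

Lemma represents_ex (A B : Cbar) (c : Hom A B) :
  exists f : Hom (qc_car A) (qc_car B), represents c f.
Proof. by have [f [ff ->]] := qc_homP c; exists f, ff. Qed.

Lemma represented (A B : Cbar) (f : Hom (qc_car A) (qc_car B)) :
  (forall (Z : C) (a b : Hom Z (qc_car A)),
    related (qc_rel A) a b -> related (qc_rel B) (f ∘ a) (f ∘ b)) ->
  exists c : Hom A B, represents c f.
Proof.
move=> fr; have ff : @qc_sim _ _ A B f f by apply/simP.
by exists (qc_class ff), ff.
Qed.

Lemma represents_related (A B : Cbar) (f : Hom (qc_car A) (qc_car B)) (c : Hom A B)
    (Z : C) (a b : Hom Z (qc_car A)) :
  represents c f -> related (qc_rel A) a b ->
  related (qc_rel B) (f ∘ a) (f ∘ b).
Proof. by case=> /simP fr _; apply: fr. Qed.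

Lemma represents_eq (A B : Cbar) (f g : Hom (qc_car A) (qc_car B)) (c d : Hom A B) :
  represents c f -> represents d g -> (c = d <-> related (qc_rel B) f g).
Proof.
by move=> [ff ->] [gg ->]; rewrite (qc_class_eq ff gg) (qc_simP _ ff).
Qed.

Lemma represents_cmp (A B E : Cbar) (f : Hom (qc_car A) (qc_car B))
    (g : Hom (qc_car B) (qc_car E)) (c : Hom A B) (d : Hom B E) :
  represents c f -> represents d g -> represents (d ∘ c) (g ∘ f).
Proof.
move=> [ff ->] [gg ->]; exists (qc_sim_comp ff gg); exact: qc_cmpE.
Qed.

Lemma represents_J (X Y : C) (f : Hom X Y) : represents (fmap J f) f.
Proof. by exists (J_sim f). Qed.

Lemma represents_pair (Z A B : Cbar) (f : Hom (qc_car Z) (qc_car A))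
    (g : Hom (qc_car Z) (qc_car B)) (c : Hom Z A) (d : Hom Z B) :
  represents c f -> represents d g ->
  represents (pair FP c d) (wlift2 (wpc P [:: qc_car A; qc_car B]) f g).
Proof.
move=> [ff ->] [gg ->].
exists (qc_sim_pair ff gg); exact: (qc_pairE _ _ _ (wlift21 _ _ _) (wlift22 _ _ _)).
Qed.

Lemma represents_rx (A B : Cbar) (f : Hom (qc_car A) (qc_car B)) (c : Hom A B)
    (a : Pbar B) : represents c f -> sval (rx Pbar c a) = rx P f (sval a).
Proof. by move=> [ff ->]; apply: qc_rxE. Qed.

Lemma forces_represents (A B : Cbar) (f : Hom (qc_car A) (qc_car B)) (c : Hom A B)
    (a : Pbar B) : represents c f -> (c ⊩ a <-> f ⊩ sval a).
Proof. by move=> fc; rewrite /forces -(represents_rx a fc). Qed.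

Lemma forces_qc_eq (Z A : Cbar) (f g : Hom (qc_car Z) (qc_car A)) (c d : Hom Z A) :
  represents c f -> represents d g ->
  (pair FP c d ⊩ eqd Pbar A <-> related (qc_rel A) f g).
Proof.
move=> fc gd; rewrite (forces_represents _ (represents_pair fc gd)).
by rewrite /= forces_pic wlift21 wlift22.
Qed.

Lemma qc_comprehensive_diagonals : comprehensive_diagonals Pbar.
Proof.
move=> A X f g; have [f' ff'] := represents_ex f; have [g' gg'] := represents_ex g.
by rewrite (represents_eq ff' gg') -(forces_qc_eq ff' gg').
Qed.

Lemma qc_cov_represented (A : Cbar) :
  exists c : Hom (J (qc_car A)) A, represents c (idm (qc_car A)).
Proof.
apply: represented => Z a b; rewrite !cmp1m => /rel_delta ->.
exact: related_refl.
Qed.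

Definition qc_cov (A : Cbar) : Hom (J (qc_car A)) A := sval (cid (qc_cov_represented A)).

Lemma represents_qc_cov (A : Cbar) : represents (qc_cov A) (idm (qc_car A)).
Proof. by rewrite /qc_cov; case: cid. Qed.

Lemma represents_qc_cov_J (X : C) (A : Cbar) (f : Hom X (qc_car A)) :
  represents (qc_cov A ∘ fmap J f) f.
Proof.
rewrite -{2}(cmp1m f); apply: represents_cmp; [apply: represents_J | apply: represents_qc_cov].
Qed.

Lemma qc_cov_lift (X : C) (A : Cbar) (z : Hom (J X) A) :
  exists f : Hom X (qc_car A), z = qc_cov A ∘ fmap J f.
Proof.
have [f fz] := represents_ex z; exists f.
by rewrite (represents_eq fz (represents_qc_cov_J f)); apply: related_refl.
Qed.

Lemma qc_cov_related (X : C) (A : Cbar) (f g : Hom X (qc_car A)) :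
  qc_cov A ∘ fmap J f = qc_cov A ∘ fmap J g <-> related (qc_rel A) f g.
Proof. by rewrite (represents_eq (represents_qc_cov_J f) (represents_qc_cov_J g)). Qed.

Lemma qc_cov_represents (A B : Cbar) (f : Hom (qc_car A) (qc_car B)) (c : Hom A B) :
  represents c f -> c ∘ qc_cov A = qc_cov B ∘ fmap J f.
Proof.
move=> fc; have H := represents_cmp (represents_qc_cov A) fc; rewrite cmpm1 in H.
by rewrite (represents_eq H (represents_qc_cov_J f)); apply: related_refl.
Qed.

Lemma qc_cov_epi (A : Cbar) : epi (qc_cov A).
Proof.
move=> Z h k; have [f fh] := represents_ex h; have [g gk] := represents_ex k.
rewrite (qc_cov_represents fh) (qc_cov_represents gk).
by rewrite (represents_eq fh gk) qc_cov_related.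
Qed.

(** An arrow and its composite with the cover have a common representative, and forcing depends only
    on the representative. *)
Lemma qc_forces_cov (Z A : Cbar) (z : Hom Z A) (a : Pbar A) :
  z ∘ qc_cov Z ⊩ a <-> z ⊩ a.
Proof.
split; last exact: forces_cmp.
have [f fz] := represents_ex z.
rewrite (qc_cov_represents fz) (forces_represents _ fz).
by rewrite (forces_represents _ (represents_qc_cov_J f)).
Qed.

(** A weak comprehension [c] of the underlying element becomes strict once its domain carries the
    relation of [A] pulled back along [c]: all factorizations through [c] are then identified. *)
Lemma qc_has_full_comprehensions : has_full_comprehensions Pbar.
Proof.
move=> A a; have [X [c [[ca cu] cf]]] := Pcompr (sval a).
have re : P_eqrel (P_rel_rx c c (qc_rel A)).
  apply/P_eqrelP; split=> [Z f | Z f g | Z f g h]; rewrite /bev !pev_rel_rx /=.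
  - exact: qc_refl.
  - exact: qc_sym.
  - exact: qc_trans.
pose E : Cbar := MkQcOb re.
have relE Z (f g : Hom Z X) :
    related (qc_rel E) f g <-> related (qc_rel A) (c ∘ f) (c ∘ g).
  by rewrite /related /bev pev_rel_rx.
have [|e ce] := @represented E A c; first by move=> Z f g /relE.
exists E, e; split; last first.
  by move=> b /(forces_represents _ ce); apply: cf.
split; first exact/(forces_represents _ ce).
move=> Y f; have [f' ff'] := represents_ex f.
move=> /(forces_represents _ ff') /cu[h hE].
have [|k hk] := @represented Y E h.
  by move=> Z x y xy; apply/relE; rewrite !cmpA -hE; apply: represents_related ff' xy.
have ek := represents_cmp hk ce.
exists k; split; first by rewrite (represents_eq ff' ek) hE; apply: related_refl.
move=> k'; have [h' hk'] := represents_ex k'.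
rewrite (represents_eq ff' (represents_cmp hk' ce)) (represents_eq hk hk') hE.
by move/relE.
Qed.

Section EquivalenceRelationQuotient.
Variables (A : Cbar) (r : Pbar (prd FP A A)).
Hypothesis re : is_eqrel r.

(** Elements with equal projections are related in the product of [A] with itself, and [r] is a
    descent datum for that relation. *)
Lemma qc_rel_irr :
  proof_irrelevant (sval r : P (wp_ob (wpc P [:: qc_car A; qc_car A]))).
Proof.
apply/irrP => Z g g' gg'.
have /desP := proj2_sig r; apply.
rewrite /related bev_prd; apply: imeet_glb.
  by rewrite (gg' None : wp1 _ ∘ g = wp1 _ ∘ g'); apply: related_refl.
by rewrite (gg' (Some None) : wp2 _ ∘ g = wp2 _ ∘ g'); apply: related_refl.
Qed.

Let rt := pi_class_of qc_rel_irr.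

Lemma related_quotient (X : C) (f g : Hom X (qc_car A)) :
  related rt f g <-> pair FP (qc_cov A ∘ fmap J f) (qc_cov A ∘ fmap J g) ⊩ r.
Proof.
rewrite (forces_represents _ (represents_pair (represents_qc_cov_J f) (represents_qc_cov_J g))).
rewrite -(pi_class_ofE qc_rel_irr) -/rt.
by rewrite forces_pic wlift21 wlift22.
Qed.

Lemma quotient_eqrel : P_eqrel rt.
Proof.
have /(is_eqrelP qc_has_full_comprehensions)[r1 r2 r3] := re.
apply/eqrelP; split=> [Z f | Z f g | Z f g h];
  rewrite !related_quotient; [exact: r1 | exact: r2 | exact: r3].
Qed.

(** The quotient keeps the object underlying [A] and replaces its relation by [r]; the quotient
    arrow is represented by the identity. *)
Lemma qc_quotient_exists :
  exists (B : Cbar) (q : Hom A B),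
    (exists x : Hom (J (qc_car B)) A, qc_cov B = q ∘ x) /\
    forall (X : C) (f g : Hom X (qc_car A)),
      q ∘ (qc_cov A ∘ fmap J f) = q ∘ (qc_cov A ∘ fmap J g) <->
      pair FP (qc_cov A ∘ fmap J f) (qc_cov A ∘ fmap J g) ⊩ r.
Proof.
pose B : Cbar := MkQcOb quotient_eqrel.
have [|q qE] := @represented A B (idm (qc_car A)).
  (* The relation of [A] is contained in [r]: related elements become equal in [A], and [r] is
     reflexive. *)
  move=> Z a b /qc_cov_related ab; rewrite !cmp1m; apply/related_quotient; rewrite ab.
  have /(is_eqrelP qc_has_full_comprehensions)[r1 _ _] := re.
  exact: r1.
have qcov : q ∘ qc_cov A = qc_cov B.
  by rewrite (qc_cov_represents qE) fmap1 cmpm1.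
exists B, q; split=> [|X f g]; first by exists (qc_cov A).
rewrite -related_quotient.
rewrite (represents_eq (represents_cmp (represents_qc_cov_J f) qE)
  (represents_cmp (represents_qc_cov_J g) qE)).
by rewrite !cmp1m.
Qed.

End EquivalenceRelationQuotient.

Theorem quot_compl_presentation :
  presentation (J_arrow P) (fun A : Cbar => qc_rel A) qc_cov.
Proof.
split.
- exact: qc_has_full_comprehensions.
- exact: qc_comprehensive_diagonals.
- by [].
- move=> X Y f g; rewrite (represents_eq (represents_J f) (represents_J g)).
  by move/rel_delta.
- move=> X Y z; have [f fz] := represents_ex z; exists f.
  by rewrite (represents_eq fz (represents_J f)); apply: related_refl.
- exact: qc_cov_lift.
- exact: qc_cov_related.
- exact: qc_cov_epi.
- move=> A B f fr; have [c cf] := represented fr.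
  by exists c; apply: qc_cov_represents.
- by move=> Z A z a /qc_forces_cov.
- move=> A a; exists (sval a); split; first exact: proj2_sig a.
  by apply: eq_exist; have := represents_rx a (represents_qc_cov A); rewrite rx1.
- move=> A a ad; exists (exist _ a ad); apply: eq_exist.
  by have := represents_rx (exist _ a ad : Pbar A) (represents_qc_cov A); rewrite rx1.
- exact: qc_quotient_exists.
Qed.

End QuotientCompletionTheory.

(** * A presented doctrine belongs to QD *)

Section PresentationTheory.
Variables (C E : Category) (P : BiasedElem C) (Q : ElemDoctrine E).
Variables (J : OneArrow P Q) (car : E -> C).
Variable rel : forall A : E, pi_class P [:: car A; car A].
Variable cov : forall A : E, Hom (J (car A)) A.
Hypothesis Pcompr : has_full_weak_comprehensions P.
Hypothesis Pdiag : biased_comprehensive_diagonals P.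
Hypothesis pres : presentation J rel cov.
Local Notation FP := (ed_fp Q).

Let compr := pre_compr pres.
Let diagc := pre_diag pres.
Let cov_lift := pre_cov_lift pres.
Let cov_related := pre_cov_related pres.
Let cov_epi := pre_cov_epi pres.
Let leP := forces_leP (full_comprehension compr).
Let feqP := forces_eq (full_comprehension compr).

Lemma cov_repr (A B : E) (c : Hom A B) :
  exists f : Hom (car A) (car B), c ∘ cov A = cov B ∘ fmap J f.
Proof. exact: cov_lift. Qed.

Lemma rel_eqrel (A : E) : P_eqrel (rel A).
Proof.
apply/(P_eqrel_relatedP Pcompr); split=> [Z f | Z f g | Z f g h];
  rewrite -!cov_related //.
by move=> -> ->.
Qed.

Lemma forces_cov (Z A : E) (z : Hom Z A) (a : Q A) : z ∘ cov Z ⊩ a <-> z ⊩ a.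
Proof. by split; [apply: (pre_forces_cov pres) | apply: forces_cmp]. Qed.

Lemma forces_J (X Y : C) (f : Hom X Y) (a : P Y) : fmap J f ⊩ oa_map J a <-> f ⊩ a.
Proof.
rewrite /forces -oa_nat; have [<- _] := oa_hom J X.
split=> [|le]; first exact: (pre_J_le pres).
by apply: isl_hom_mono le; apply: oa_hom.
Qed.

(** Projectivity of [J (car A)] represents [g] by an arrow [f] of [C]; if [g] respects the kernel of
    [cov A], then [f] respects the relations and descends. *)
Lemma cov_reg_epi (A : E) : reg_epi (cov A).
Proof.
move=> Z g gA; have [f gE] := cov_lift g.
have [|c fc] := @pre_cov_desc _ _ _ _ _ _ _ _ pres A Z f.
  move=> T a b ab; rewrite -cov_related !fmapM !cmpA -gE; apply: gA.
  exact/cov_related.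
exists c; split=> [|k gk]; first by rewrite fc.
by apply: cov_epi; rewrite fc -gE.
Qed.

(** Precomposed with a cover, every element of [J X] has the form [fmap J k], so both sides may be
    tested on such elements, where they say that [f ∘ k] and [g ∘ k] become equal in [A]. *)
Lemma eqd_bev (X : C) (A : E) (f g : Hom X (car A)) :
  rx Q (pair FP (cov A ∘ fmap J f) (cov A ∘ fmap J g)) (eqd Q A) =
    oa_map J (bev (rel A) f g).
Proof.
apply: feqP => Z z; rewrite -!(forces_cov z).
have [k ->] := pre_J_full pres (z ∘ cov Z).
rewrite forces_J forces_bev forces_rx pair_cmp (forces_eqd diagc).
by rewrite -!cmpA -!fmapM cov_related.
Qed.

Lemma eqd_J_bd (X : C) (w : weak_prod [:: X; X]) :
  oa_map J (bd P w) =
    rx Q (pair FP (fmap J (wp1 w)) (fmap J (wp2 w))) (eqd Q (J X)).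
Proof.
apply: feqP => Z z; rewrite -!(forces_cov z).
have [k ->] := pre_J_full pres (z ∘ cov Z).
rewrite forces_J forces_rx pair_cmp (forces_eqd diagc) -!fmapM.
rewrite -[bd P w]/(delta_class P X w) forces_pic (related_delta Pdiag).
by split=> [-> | /(pre_J_faithful pres)].
Qed.

(** The regular epimorphisms of the completion are the arrows along which the
    objects [J X] are projective. *)
Definition J_surjective (A B : E) (q : Hom A B) : Prop :=
  forall (X : C) (z : Hom (J X) B), exists x : Hom (J X) A, z = q ∘ x.

Lemma J_surjective_cov (A B : E) (q : Hom A B) (x : Hom (J (car B)) A) :
  cov B = q ∘ x -> J_surjective q.
Proof.
move=> qx X z; have [f ->] := cov_lift z.
by exists (x ∘ fmap J f); rewrite qx cmpA.
Qed.

(** A lift [x] of [cov B] acts as a section of [q] on the cover: [g ∘ x] descends to the required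
    arrow, and the equation is checked after [cov A]. *)
Lemma J_surjective_reg_epi (A B : E) (q : Hom A B) :
  J_surjective q -> reg_epi q.
Proof.
move=> qs Z g gq; have [x xE] := qs _ (cov B).
have [|h [hE hu]] := @cov_reg_epi B Z (g ∘ x).
  by move=> T a b; rewrite xE -!cmpA; apply: gq.
exists h; split=> [|k gk]; last by apply: hu; rewrite gk -cmpA -xE.
apply: cov_epi; have [f fE] := cov_repr q.
rewrite -cmpA fE cmpA -hE -cmpA; apply: gq.
by rewrite cmpA -xE fE.
Qed.

Lemma quotient_exists (A : E) (r : Q (prd FP A A)) : is_eqrel r ->
  exists (B : E) (q : Hom A B), J_surjective q /\ r = ker Q q.
Proof.
move=> re; have [B [q [[x xE] qr]]] := pre_quotient pres re.
exists B, q; split; first exact: J_surjective_cov xE.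
apply: feqP => Z z; rewrite (pair_uniq z) (forces_ker diagc).
set a := _ ∘ z; set b := _ ∘ z.
rewrite -forces_cov pair_cmp.
have [f fE] := cov_repr a; have [g gE] := cov_repr b.
rewrite fE gE -qr -fE -gE (cmpA q a) (cmpA q b).
by split=> [/cov_epi | ->].
Qed.

(** The constructed quotient [p] of the kernel of [q] is surjective on elements from the objects
    [J X] and identifies the same pairs as [q]. Each factors through the other, so this surjectivity
    passes to [q]. *)
Lemma reg_epi_J_surjective (A B : E) (q : Hom A B) :
  reg_epi q -> J_surjective q.
Proof.
move=> qr; have [M [p [ps pE]]] := quotient_exists (ker_eqrel compr diagc q).
have kerE Z (a b : Hom Z A) : q ∘ a = q ∘ b <-> p ∘ a = p ∘ b.
  by rewrite -!(forces_ker diagc) pE.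
have [|h [hE _]] := qr M p; first by move=> T a b /kerE.
have [|i [iE _]] := J_surjective_reg_epi ps (g := q); first by move=> T a b /kerE.
have ih : i ∘ h = idm B.
  by apply: (reg_epi_epi qr); rewrite -cmpA -hE -iE cmp1m.
have [x xE] := ps _ (h ∘ cov B).
apply: (@J_surjective_cov _ _ q x).
by rewrite iE -cmpA -xE cmpA ih cmp1m.
Qed.

Lemma J_surjective_rx_le (A B : E) (q : Hom A B) (a b : Q B) :
  J_surjective q -> rx Q q a ⊑ rx Q q b -> a ⊑ b.
Proof.
move=> qs ab; apply: leP => T z; rewrite -!(forces_cov z).
by have [x ->] := qs _ (z ∘ cov T); rewrite -!forces_rx; apply: forces_le.
Qed.

Theorem presentation_in_QD : in_QD Q.
Proof.
split=> // [A r re | A B r q re [/(ker_leP compr diagc) rq qu]].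
  have [B [q [qs ->]]] := quotient_exists re; exists B, q.
  exact/reg_epi_quotient/J_surjective_reg_epi.
(* An arbitrary quotient [q] is compared with the constructed one: [p] has kernel [r] and factors
   through [q], so [q] identifies no more than [r]. This gives effectiveness. *)
have [M [p [ps pE]]] := quotient_exists re.
have [|h [hE _]] := qu M p; first by rewrite pE; apply: ile_refl.
have rE : r = ker Q q.
  apply: feqP => Z z; rewrite (pair_uniq z).
  rewrite (forces_ker diagc); split=> [/rq // | qz].
  by rewrite pE (forces_ker diagc) hE -!cmpA qz.
have qr : reg_epi q.
  by apply: (ker_is_quotient_reg_epi compr diagc); rewrite -rE; split=> //; apply/ker_leP.
have qs := reg_epi_J_surjective qr.
split=> //.
- move=> A' B' f f' q' [sq pb].
  apply: reg_epi_quotient_map => //; apply: J_surjective_reg_epi => X z.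
  have [x xE] := qs _ (f ∘ z).
  by have [|y [[_ yE] _]] := pb _ x z; [rewrite xE | exists y].
- have qdes b : is_des r (rx Q q b).
    apply: (rel_leP compr) => Z f g; rewrite forces_meet !forces_rx pair1 pair2.
    by move=> [fb /rq <-].
  exists qdes; apply: isl_isoP.
  + by split=> [|x y]; apply: eq_exist; rewrite ?rx_top ?rx_meet.
  + by move=> x y; apply: J_surjective_rx_le qs.
  + case=> a ad.
    have ad' Z (f g : Hom Z A) : q ∘ f = q ∘ g -> f ⊩ a -> g ⊩ a.
      move=> fg fa; have : pair FP f g ⊩ rx Q (pr2 FP A A) a.
        apply: (forces_le ad); rewrite forces_meet forces_rx pair1; split=> //.
        by rewrite rE (forces_ker diagc).
      by rewrite forces_rx pair2.
    (* The descended element is built over [car B] by pulling [a] back along a lift [x] of [cov B].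
       It is a descent datum because related elements have images under [x] that [q] identifies. *)
    have [x xE] := qs _ (cov B).
    have [a' [_ aE]] := pre_val pres a.
    have [f fE] := cov_lift x.
    have xaE Z (k : Hom Z (car B)) : k ⊩ rx P f a' <-> x ∘ fmap J k ⊩ a.
      by rewrite forces_rx -forces_J -aE forces_rx fmapM cmpA -fE.
    have [|b bE] := @pre_des _ _ _ _ _ _ _ _ pres B (rx P f a').
      apply/(P_des_relatedP Pcompr) => Z k l /cov_related.
      by rewrite !xaE xE -!cmpA; apply: ad'.
    exists b; apply: eq_exist; apply: feqP => Z z.
    have [k kE] := cov_repr (q ∘ z).
    rewrite forces_rx -(forces_cov (q ∘ z)) -(forces_cov z) kE.
    rewrite -forces_rx bE forces_J xaE.
    by split; apply: ad'; rewrite !cmpA -xE -kE.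
Qed.

End PresentationTheory.

(** * Left covering arrows *)

Section LeftCoveringTheory.
Variables (C D : Category) (P : BiasedElem C) (R : ElemDoctrine D).
Hypothesis Pcompr : has_full_weak_comprehensions P.
Hypothesis Pdiag : biased_comprehensive_diagonals P.
Hypothesis RQD : in_QD R.
Variable F : OneArrow P R.
Hypothesis Flco : is_lco F.
Local Notation FP := (ed_fp R).

Let compr := QD_comprehension RQD.
Let diagc := QD_diagonals RQD.

Lemma forces_map (Z X : C) (T : D) (f : Hom Z X) (a : P X) (u : Hom T (F Z)) :
  u ⊩ oa_map F (rx P f a) <-> fmap F f ∘ u ⊩ oa_map F a.
Proof. by rewrite oa_nat forces_rx. Qed.

Lemma forces_map_le (X : C) (T : D) (a b : P X) (u : Hom T (F X)) :
  a ⊑ b -> u ⊩ oa_map F a -> u ⊩ oa_map F b.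
Proof. by move=> ab; apply: forces_le; apply: isl_hom_mono ab; apply: oa_hom. Qed.

Lemma forces_map_top (X : C) (T : D) (a : P X) (u : Hom T (F X)) :
  itop ⊑ a -> u ⊩ oa_map F a.
Proof.
move=> a1; apply: (forces_map_le a1); have [-> _] := oa_hom F X.
exact: forces_top.
Qed.

Lemma forces_map_meet (X : C) (T : D) (a b : P X) (u : Hom T (F X)) :
  u ⊩ oa_map F (a ⊓ b) <-> u ⊩ oa_map F a /\ u ⊩ oa_map F b.
Proof. by have [_ ->] := oa_hom F X; apply: forces_meet. Qed.

Lemma forces_map_delta (X Z : C) (T : D) (a b : Hom Z X) (u : Hom T (F Z)) :
  u ⊩ oa_map F (bev (delta_class P X) a b) <-> fmap F a ∘ u = fmap F b ∘ u.
Proof.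
pose w := wpc P [:: X; X]; pose h := wlift2 w a b.
have -> : bev (delta_class P X) a b = rx P h (bd P w).
  by rewrite -[bd P w]/(delta_class P X w) bevE wlift21 wlift22.
rewrite forces_map (lco_eq Flco) forces_rx pair_cmp (forces_eqd diagc) !cmpA -!fmapM.
by rewrite wlift21 wlift22.
Qed.

(** Although [F] need not preserve products, a pair of elements comes from a single element of [F w]
    after passing to a cover. *)
Lemma lco_lift (X Y : C) (w : weak_prod [:: X; Y]) (T : D) (x : Hom T (F X))
    (y : Hom T (F Y)) :
  exists (S : D) (t : Hom S T) (u : Hom S (F w)),
    [/\ reg_epi t, x ∘ t = fmap F (wp1 w) ∘ u & y ∘ t = fmap F (wp2 w) ∘ u].
Proof.
have /(quotient_mapP RQD) wr := lco_prod Flco w.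
have [S [t [u [tr uE]]]] := reg_epi_lift RQD (pair FP x y) wr.
exists S, t, u; split=> //.
  by move/(congr1 (cmp (pr1 FP _ _))): uE; rewrite !cmpA !pair1.
by move/(congr1 (cmp (pr2 FP _ _))): uE; rewrite !cmpA !pair2.
Qed.

(** [q] is a quotient of [F X] by the relation which the class [r] induces on
    it along the cover of [F X * F X] by a weak product. *)
Definition covers (X : C) (r : pi_class P [:: X; X]) (Y : D) (q : Hom (F X) Y)
    : Prop :=
  reg_epi q /\
  forall (Z : C) (a b : Hom Z X) (T : D) (u : Hom T (F Z)),
    q ∘ fmap F a ∘ u = q ∘ fmap F b ∘ u <-> u ⊩ oa_map F (bev r a b).

Section Induced.
Variables (X : C) (r : pi_class P [:: X; X]).
Let w := wpc P [:: X; X].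

Lemma induced_rel : exists s : R (prd FP (F X) (F X)),
  forall (Z : C) (a b : Hom Z X) (T : D) (u : Hom T (F Z)),
    pair FP (fmap F a ∘ u) (fmap F b ∘ u) ⊩ s <-> u ⊩ oa_map F (bev r a b).
Proof.
have wr : reg_epi (pair FP (fmap F (wp1 w)) (fmap F (wp2 w))).
  by apply/(quotient_mapP RQD); exact: (lco_prod Flco).
have [|s sE] := descent RQD (a := oa_map F (r w)) wr.
  move=> T x y xy xr.
  have xy1 : fmap F (wp1 w) ∘ x = fmap F (wp1 w) ∘ y.
    by move/(congr1 (cmp (pr1 FP _ _))): xy; rewrite !cmpA !pair1.
  have xy2 : fmap F (wp2 w) ∘ x = fmap F (wp2 w) ∘ y.
    by move/(congr1 (cmp (pr2 FP _ _))): xy; rewrite !cmpA !pair2.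
  have [S [t [v [tr xE yE]]]] := lco_lift (wpc P [:: wp_ob w; wp_ob w]) x y.
  apply: (forces_local RQD tr); rewrite yE -forces_map.
  pose u1 := wp1 (wpc P [:: wp_ob w; wp_ob w]).
  pose u2 := wp2 (wpc P [:: wp_ob w; wp_ob w]).
  (* Proof irrelevance is put as an inequality of [P] over a weak product of [w] with itself, so
     that [F], being monotone on fibres and sending δ to equality, carries it to [R]. *)
  have irr : rx P u1 (r w) ⊓ bev (delta_class P X) (wp1 w ∘ u1) (wp1 w ∘ u2)
      ⊓ bev (delta_class P X) (wp2 w ∘ u1) (wp2 w ∘ u2) ⊑ rx P u2 (r w).
    apply: (forces_leP (full_weak_comprehension Pcompr)) => Z k.
    rewrite !forces_meet !forces_bev !(related_delta Pdiag) !forces_rx !forces_pic.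
    by rewrite !cmpA => -[[ur <-] <-].
  apply: (forces_map_le irr); rewrite !forces_map_meet !forces_map_delta.
  rewrite forces_map !fmapM -!cmpA -xE -yE !cmpA xy1 xy2; split=> //; split=> //.
  exact: forces_cmp.
exists s => Z a b T u; pose h := wlift2 w a b.
have -> : bev r a b = rx P h (r w) by rewrite bevE wlift21 wlift22.
rewrite forces_map -sE forces_rx pair_cmp !cmpA -!fmapM.
by rewrite wlift21 wlift22.
Qed.

Lemma covers_exists : P_eqrel r -> exists (Y : D) (q : Hom (F X) Y), covers r q.
Proof.
move=> /P_eqrelP[r1 r2 r3]; have [s sE] := induced_rel.
have se : is_eqrel s.
  apply/(is_eqrelP compr); split=> [T f | T f g fg | T f g h fg gh].
  - rewrite -(cmp1m f) -fmap1 sE; exact: forces_map_top.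
  - have [S [t [u [tr fE gE]]]] := lco_lift w f g.
    apply: (forces_local RQD tr); rewrite pair_cmp fE gE sE.
    apply: (forces_map_le (r2 _ _ _)); rewrite -sE -fE -gE -pair_cmp.
    exact: forces_cmp.
  - have [S [t [u [tr fE gE]]]] := lco_lift w f g.
    (* A triple is lifted in two stages: [f] and [g] to [F w], then the result together with [h] to
       [F v]. *)
    pose v := wpc P [:: wp_ob w; X].
    have [S' [t' [u' [tr' uE hE]]]] := lco_lift v u (h ∘ t).
    have {}fE : f ∘ (t ∘ t') = fmap F (wp1 w ∘ wp1 v) ∘ u'.
      by rewrite cmpA fE -cmpA uE cmpA fmapM.
    have {}gE : g ∘ (t ∘ t') = fmap F (wp2 w ∘ wp1 v) ∘ u'.
      by rewrite cmpA gE -cmpA uE cmpA fmapM.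
    rewrite -cmpA in hE.
    apply: (forces_local RQD (reg_epi_comp RQD tr tr')).
    rewrite pair_cmp fE hE sE; apply: (forces_map_le (r3 _ _ (wp2 w ∘ wp1 v) _)).
    rewrite forces_map_meet -!sE -fE -gE -hE -!pair_cmp.
    by split; apply: forces_cmp.
have [Y [q sq]] := QD_quotient RQD se; exists Y, q.
have sker := quotient_ker RQD se sq.
split=> [|Z a b T u].
  by apply: (ker_is_quotient_reg_epi compr diagc); rewrite -sker.
by rewrite -!cmpA -sE sker (forces_ker diagc).
Qed.

End Induced.

(** Any two elements of [F X] are locally the projections of one element of [F] of a weak product,
    so compatibility need only be known for pairs arising from arrows of [C]. *)
Lemma covers_desc (X : C) (r : pi_class P [:: X; X]) (Y Z : D) (q : Hom (F X) Y)
    (g : Hom (F X) Z) :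
  covers r q ->
  (forall (U : C) (a b : Hom U X) (T : D) (u : Hom T (F U)),
    u ⊩ oa_map F (bev r a b) -> g ∘ fmap F a ∘ u = g ∘ fmap F b ∘ u) ->
  exists! h : Hom Y Z, g = h ∘ q.
Proof.
move=> [qr qE] gr; apply: qr => T x y xy.
have [S [t [u [tr xE yE]]]] := lco_lift (wpc P [:: X; X]) x y.
apply: (reg_epi_epi tr); rewrite -!cmpA xE yE !cmpA; apply: gr.
by rewrite -qE -!cmpA -xE -yE !cmpA xy.
Qed.

Lemma covers_lift (X X' : C) (Y Y' : D) (q : Hom (F X) Y) (q' : Hom (F X') Y')
    (w : weak_prod [:: X; X']) (T : D) (x : Hom T Y) (y : Hom T Y') :
  reg_epi q -> reg_epi q' ->
  exists (S : D) (t : Hom S T) (u : Hom S (F w)),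
    [/\ reg_epi t, x ∘ t = q ∘ fmap F (wp1 w) ∘ u
      & y ∘ t = q' ∘ fmap F (wp2 w) ∘ u].
Proof.
move=> qr qr'.
have [S [t [x1 [tr xE]]]] := reg_epi_lift RQD x qr.
have [S' [t' [y1 [tr' yE]]]] := reg_epi_lift RQD (y ∘ t) qr'.
have [S'' [t'' [u [tr'' x1E y1E]]]] := lco_lift w (x1 ∘ t') y1.
exists S'', (t ∘ t' ∘ t''), u; split.
- by do !apply: (reg_epi_comp RQD).
- by rewrite !cmpA -xE -!cmpA -x1E !cmpA.
- by rewrite !cmpA -yE -!cmpA -y1E !cmpA.
Qed.

Lemma covers_descent (X : C) (r : pi_class P [:: X; X]) (Y : D) (q : Hom (F X) Y)
    (a : P X) :
  covers r q -> P_des r a -> exists b : R Y, rx R q b = oa_map F a.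
Proof.
move=> [qr qE] /P_desP ra; apply: (descent RQD qr) => T x y xy xa.
pose w := wpc P [:: X; X].
have [S [t [u [tr xtE ytE]]]] := lco_lift w x y.
apply: (forces_local RQD tr); rewrite ytE -forces_map.
apply: (forces_map_le (ra _ (wp1 w) _)); rewrite forces_map_meet forces_map -xtE.
split; first exact: forces_cmp.
by rewrite -qE -!cmpA -xtE -ytE !cmpA xy.
Qed.

Lemma covers_mono (X : C) (r : pi_class P [:: X; X]) (Y Z : D) (q : Hom (F X) Y)
    (m : Hom Y Z) :
  covers r q ->
  (forall (U : C) (a b : Hom U X) (T : D) (u : Hom T (F U)),
    m ∘ q ∘ fmap F a ∘ u = m ∘ q ∘ fmap F b ∘ u -> u ⊩ oa_map F (bev r a b)) ->
  mono m.
Proof.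
move=> [qr qE] mr T x y xy.
have [S [t [u [tr xE yE]]]] := covers_lift (wpc P [:: X; X]) x y qr qr.
apply: (reg_epi_epi tr); rewrite xE yE; apply/qE/mr.
by rewrite -!cmpA !(cmpA q) -xE -yE !cmpA xy.
Qed.

End LeftCoveringTheory.

Arguments covers {C D P R} F {X} r {Y} q.

(** * Restriction along J *)

Section ProductComparison.
Variables (E D : Category) (Q : ElemDoctrine E) (R : ElemDoctrine D).

Lemma prod_cmp_pair (G : Functor E D) (Z X Y : E) (f : Hom Z X) (g : Hom Z Y) :
  prod_cmp Q R G X Y ∘ fmap G (pair (ed_fp Q) f g) =
    pair (ed_fp R) (fmap G f) (fmap G g).
Proof. by rewrite /prod_cmp pair_cmp -!fmapM pair1 pair2. Qed.

Lemma prod_cmp_pmap (G : Functor E D) (X Y : E) (q : Hom X Y) :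
  prod_cmp Q R G Y Y ∘ fmap G (pmap (ed_fp Q) q q) =
    pmap (ed_fp R) (fmap G q) (fmap G q) ∘ prod_cmp Q R G X X.
Proof. by rewrite prod_cmp_pair !fmapM /prod_cmp pmap_pair. Qed.

Lemma map_ker (G : OneArrow Q R) (X Y : E) (q : Hom X Y) :
  oa_map G (eqd Q Y) = rx R (prod_cmp Q R G Y Y) (eqd R (G Y)) ->
  oa_map G (ker Q q) = rx R (prod_cmp Q R G X X) (ker R (fmap G q)).
Proof. by move=> Geqd; rewrite oa_nat Geqd -!rxM prod_cmp_pmap. Qed.

End ProductComparison.

Lemma is_iso_rx_inj (D : Category) (R : Doctrine D) (X Y : D) (f : Hom X Y)
    (a b : R Y) : is_iso f -> rx R f a = rx R f b -> a = b.
Proof.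
by case=> g [_ fg] /(congr1 (rx R g)); rewrite -!rxM fg !rx1.
Qed.

Section QDArrowTheory.
Variables (C E D : Category) (P : BiasedElem C) (Q : ElemDoctrine E).
Variable R : ElemDoctrine D.
Variables (J : OneArrow P Q) (car : E -> C).
Variable rel : forall A : E, pi_class P [:: car A; car A].
Variable cov : forall A : E, Hom (J (car A)) A.
Hypothesis Pdiag : biased_comprehensive_diagonals P.
Hypothesis pres : presentation J rel cov.
Hypothesis RQD : in_QD R.

Let compr := QD_comprehension RQD.
Let diagc := QD_diagonals RQD.
Let Qcompr := pre_compr pres.
Let Qdiag := pre_diag pres.

Section OneQDArrow.
Variable G : OneArrow Q R.
Hypothesis GQD : is_QD_arrow G.

(** [G] preserves the quotient of the kernel of [q], and preservation of equality makes the image of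
    that kernel the kernel of [fmap G q]. *)
Lemma QD_arrow_reg_epi (X Y : E) (q : Hom X Y) : reg_epi q -> reg_epi (fmap G q).
Proof.
move=> qr; apply: (ker_is_quotient_reg_epi compr diagc).
apply: (oa_quotient GQD (ker_eqrel Qcompr Qdiag q)).
  exact: (reg_epi_quotient Qcompr Qdiag).
by rewrite (map_ker q (oa_eqd GQD Y)).
Qed.

(** In the completion, the arrows from [J w] to the product or terminal object, and from the domain
    of a weak comprehension to the strict one, are regular epimorphisms because [J] is full. [G]
    preserves these, and preserves their codomains up to isomorphism. *)
Lemma QD_arrow_lco : is_lco (oa_comp G J).
Proof.
have [G1 GM] := oa_products GQD; split=> [X Y w | w | X w | X A a c [ca cu]].
- apply/(quotient_mapP RQD); rewrite /= -(prod_cmp_pair Q).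
  apply: (reg_epi_comp RQD); first exact: is_iso_reg_epi.
  apply: QD_arrow_reg_epi; apply: (J_surjective_reg_epi pres) => Z z.
  have [f fE] := pre_J_full pres (pr1 (ed_fp Q) _ _ ∘ z).
  have [g gE] := pre_J_full pres (pr2 (ed_fp Q) _ _ ∘ z).
  exists (fmap J (wlift2 w f g)); rewrite pair_cmp -!fmapM wlift21 wlift22.
  by rewrite -fE -gE -pair_uniq.
- apply/(quotient_mapP RQD).
  have -> : bang (ed_fp R) (oa_comp G J w) =
      bang (ed_fp R) (G (one (ed_fp Q))) ∘ fmap G (bang (ed_fp Q) (J w)).
    exact: bang_ext.
  apply: (reg_epi_comp RQD); first exact: is_iso_reg_epi.
  apply: QD_arrow_reg_epi; apply: (J_surjective_reg_epi pres) => Z z.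
  exists (fmap J (wlift w (fun i : pos [::] => match i with end))).
  exact: bang_ext.
- by rewrite /= (eqd_J_bd Pdiag pres) oa_nat (oa_eqd GQD) -rxM prod_cmp_pair.
- move=> M e ec; have [N [n [nc _]]] := Qcompr (oa_map J a).
  have [n1 nu] := nc; have [e1 eu] := ec.
  have [Gn1 Gnu] := oa_comprehension GQD nc.
  have [|p [pE _]] := nu _ (fmap J c); first exact/(forces_J pres).
  have [i [iE _]] := eu _ _ Gn1; have [j [jE _]] := Gnu _ _ e1.
  exists (i ∘ fmap G p); rewrite /= pE fmapM iE cmpA; split=> //.
  apply/(quotient_mapP RQD)/(reg_epi_comp RQD).
    apply: is_iso_reg_epi; exists j; split.
      apply: (comprehension_mono (oa_comprehension GQD nc)).
      by rewrite cmpA -jE -iE cmpm1.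
    by apply: (comprehension_mono ec); rewrite cmpA -iE -jE cmpm1.
  apply: QD_arrow_reg_epi; apply: (J_surjective_reg_epi pres) => Z z.
  have [k kE] := pre_J_full pres (n ∘ z).
  have [|h hE] := cu _ k.
    by apply/(forces_J pres); rewrite -kE; apply: forces_cmp.
  exists (fmap J h); apply: (comprehension_mono nc).
  by rewrite kE hE fmapM pE cmpA.
Qed.

(** Presents [G A] as the quotient of [G (J (car A))] by the relation induced by [rel A], so that
    arrows out of it can be defined by [covers_desc]. *)
Lemma cov_covers (A : E) : covers (oa_comp G J) (rel A) (fmap G (cov A)).
Proof.
split=> [|Z a b T u]; first exact/QD_arrow_reg_epi/(cov_reg_epi pres).
rewrite /= -(eqd_bev pres) oa_nat (oa_eqd GQD) -rxM prod_cmp_pair forces_rx.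
by rewrite pair_cmp (forces_eqd diagc) !fmapM.
Qed.

End OneQDArrow.

(** * Restriction along [J] is faithful and full on 2-arrows *)

Section TwoQDArrows.
Variables G H : OneArrow Q R.
Hypothesis GQD : is_QD_arrow G.
Hypothesis HQD : is_QD_arrow H.

Lemma QD_two_arrow_eq (s s' : TwoArrow G H) :
  (forall X : C, s (J X) = s' (J X)) -> s = s'.
Proof.
move=> ss'; apply: ta_eq => A.
have /reg_epi_epi Gc : reg_epi (fmap G (cov A)).
  exact/(QD_arrow_reg_epi GQD)/(cov_reg_epi pres).
apply: Gc.
by rewrite !ntN ss'.
Qed.

Lemma QD_two_arrow_ext (t : TwoArrow (oa_comp G J) (oa_comp H J)) :
  exists s : TwoArrow G H, forall X : C, s (J X) = t X.
Proof.
have Gc A : reg_epi (fmap G (cov A)).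
  exact/(QD_arrow_reg_epi GQD)/(cov_reg_epi pres).
have sP A : exists h : Hom (G A) (H A),
    fmap H (cov A) ∘ t (car A) = h ∘ fmap G (cov A).
  have [|h [hE _]] := covers_desc RQD (QD_arrow_lco GQD) (cov_covers GQD A)
    (g := fmap H (cov A) ∘ t (car A)); last by exists h.
  move=> U a b T u ur.
  have Ht := ntN t; rewrite /= in Ht.
  rewrite -!(cmpA (fmap H (cov A))) !Ht !(cmpA (fmap H (cov A))) -!(cmpA _ (t U)).
  (* The inequality of the 2-arrow [t] at the relation of [A] says exactly that pairs related
     through [G] are sent to pairs related through [H]. *)
  have [_ HA] := cov_covers HQD A; apply/HA; rewrite -forces_rx.
  exact: forces_le (ta_le t _) ur.
pose s A := sval (cid (sP A)).
have sE A : fmap H (cov A) ∘ t (car A) = s A ∘ fmap G (cov A).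
  by rewrite /s; case: cid.
have sN A B (c : Hom A B) : s B ∘ fmap G c = fmap H c ∘ s A.
  apply: (reg_epi_epi (Gc A)); have [f fE] := cov_repr pres c.
  have := ntN t f; rewrite /= => tN.
  rewrite -!cmpA -fmapM fE fmapM -(sE A) (cmpA (s B)) -sE -cmpA tN !cmpA -!fmapM.
  by rewrite fE.
have s_le A (a : Q A) : oa_map G a ⊑ rx R (s A) (oa_map H a).
  apply: (reg_epi_rx_le RQD (Gc A)); rewrite -rxM -sE rxM -!oa_nat.
  by have [b [_ ->]] := pre_val pres a; apply: (ta_le t).
exists (MkTwoArrow (ta_nat := MkNatTrans sN) s_le) => X /=.
apply: (reg_epi_epi (Gc (J X))); rewrite -sE.
(* In a presentation [cov (J X)] need not be an identity, but fullness makes it the image of some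
   [k], at which [t] is natural. *)
have [k ->] := pre_J_full pres (cov (J X)).
by have := ntN t k; rewrite /= => ->.
Qed.

End TwoQDArrows.

End QDArrowTheory.

(** * Extension of left covering arrows *)

Section Extension.
Variables (C E D : Category) (P : BiasedElem C) (Q : ElemDoctrine E).
Variable R : ElemDoctrine D.
Variables (J : OneArrow P Q) (car : E -> C).
Variable rel : forall A : E, pi_class P [:: car A; car A].
Variable cov : forall A : E, Hom (J (car A)) A.
Hypothesis Pcompr : has_full_weak_comprehensions P.
Hypothesis Pdiag : biased_comprehensive_diagonals P.
Hypothesis pres : presentation J rel cov.
Hypothesis RQD : in_QD R.
Variable F : OneArrow P R.
Hypothesis Flco : is_lco F.

Let compr := QD_comprehension RQD.
Let diagc := QD_diagonals RQD.
Let cov_related := pre_cov_related pres.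
Let cov_lift := pre_cov_lift pres.

Lemma ext_exists (A : E) :
  exists Yq : {Y : D & Hom (F (car A)) Y}, covers F (rel A) (tagged Yq).
Proof.
have [Y [q qc]] := covers_exists Pcompr Pdiag RQD Flco (rel_eqrel Pcompr pres A).
by exists (existT _ Y q).
Qed.

Definition ext_ob (A : E) : D := tag (sval (cid (ext_exists A))).

Definition quo (A : E) : Hom (F (car A)) (ext_ob A) :=
  tagged (sval (cid (ext_exists A))).

Lemma quo_covers (A : E) : covers F (rel A) (quo A).
Proof. exact: (proj2_sig (cid (ext_exists A))). Qed.

Lemma quo_reg_epi (A : E) : reg_epi (quo A).
Proof. by have [] := quo_covers A. Qed.

Lemma quo_epi (A : E) : epi (quo A).
Proof. exact/reg_epi_epi/quo_reg_epi. Qed.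

Lemma quo_eqP (A : E) (Z : C) (a b : Hom Z (car A)) (T : D) (u : Hom T (F Z)) :
  quo A ∘ fmap F a ∘ u = quo A ∘ fmap F b ∘ u <-> u ⊩ oa_map F (bev (rel A) a b).
Proof. by have [_] := quo_covers A; apply. Qed.

Lemma quo_eq (A : E) (Z : C) (a b : Hom Z (car A)) :
  cov A ∘ fmap J a = cov A ∘ fmap J b -> quo A ∘ fmap F a = quo A ∘ fmap F b.
Proof.
move=> /cov_related ab; rewrite -[LHS]cmpm1 -[RHS]cmpm1; apply/quo_eqP.
exact: forces_map_top.
Qed.

(** The property quantifies over all representatives [a] and [b], so that later computations may use
    any lift instead of the chosen [f]. *)
Lemma ext_map_exists (A B : E) (c : Hom A B) :
  exists h : Hom (ext_ob A) (ext_ob B),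
  forall (Z : C) (a : Hom Z (car A)) (b : Hom Z (car B)),
    c ∘ (cov A ∘ fmap J a) = cov B ∘ fmap J b ->
    h ∘ quo A ∘ fmap F a = quo B ∘ fmap F b.
Proof.
have [f fE] := cov_repr pres c.
have [|h [hE _]] := covers_desc RQD Flco (quo_covers A) (g := quo B ∘ fmap F f).
  move=> U a b T u abu; rewrite -!(cmpA (quo B) (fmap F f)) -!fmapM; apply/quo_eqP.
  apply: forces_map_le abu; apply/(bev_leP Pcompr) => S k /cov_related ab.
  by apply/cov_related; rewrite -!cmpA !fmapM !(cmpA (cov B)) -fE -!cmpA -!fmapM ab.
exists h => Z a b ab; rewrite -hE -cmpA -fmapM; apply: quo_eq.
by rewrite -ab cmpA fE fmapM cmpA.
Qed.

Definition ext_map (A B : E) (c : Hom A B) : Hom (ext_ob A) (ext_ob B) :=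
  sval (cid (ext_map_exists c)).

Lemma ext_mapE (A B : E) (c : Hom A B) (Z : C) (a : Hom Z (car A))
    (b : Hom Z (car B)) :
  c ∘ (cov A ∘ fmap J a) = cov B ∘ fmap J b ->
  ext_map c ∘ quo A ∘ fmap F a = quo B ∘ fmap F b.
Proof. by rewrite /ext_map; case: cid => h; apply. Qed.

Lemma ext_mapE1 (A B : E) (c : Hom A B) (f : Hom (car A) (car B)) :
  c ∘ cov A = cov B ∘ fmap J f -> ext_map c ∘ quo A = quo B ∘ fmap F f.
Proof.
move=> fE; rewrite -[LHS]cmpm1 -fmap1; apply: ext_mapE.
by rewrite fmap1 cmpm1.
Qed.

Lemma ext_map1 (A : E) : ext_map (idm A) = idm (ext_ob A).
Proof.
apply: quo_epi; rewrite cmp1m (@ext_mapE1 _ _ _ (idm _)).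
  by rewrite fmap1 cmpm1.
by rewrite fmap1 cmpm1 cmp1m.
Qed.

Lemma ext_mapM (A B M : E) (d : Hom B M) (c : Hom A B) :
  ext_map (d ∘ c) = ext_map d ∘ ext_map c.
Proof.
have [f fE] := cov_repr pres c; have [g gE] := cov_repr pres d.
apply: quo_epi; rewrite -cmpA (ext_mapE1 fE) cmpA (ext_mapE1 gE).
rewrite -cmpA -fmapM; apply: ext_mapE1.
by rewrite -cmpA fE cmpA gE fmapM cmpA.
Qed.

Definition ext_fun : Functor E D := MkFunctor ext_map1 ext_mapM.

(** The image under [F] of the descent datum representing [a] descends along [quo A]. The
    representative is unique because [J] reflects the order of fibres. *)
Lemma ext_val_exists (A : E) (a : Q A) :
  exists v : R (ext_ob A), forall b : P (car A),
    rx Q (cov A) a = oa_map J b -> rx R (quo A) v = oa_map F b.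
Proof.
have [b [bd bE]] := pre_val pres a.
have [v vE] := covers_descent RQD Flco (quo_covers A) bd.
exists v => b' b'E; rewrite vE; congr oa_map; apply: ile_anti;
  by apply: (pre_J_le pres); rewrite -bE -b'E; apply: ile_refl.
Qed.

Definition ext_val (A : E) (a : Q A) : R (ext_ob A) :=
  sval (cid (ext_val_exists a)).

Lemma ext_valE (A : E) (a : Q A) (b : P (car A)) :
  rx Q (cov A) a = oa_map J b -> rx R (quo A) (ext_val a) = oa_map F b.
Proof. by rewrite /ext_val; case: cid => v; apply. Qed.

Lemma ext_val_hom (A : E) : isl_hom (@ext_val A).
Proof.
have [J1 JM] := oa_hom J (car A); have [F1 FM] := oa_hom F (car A).
split=> [|a b]; apply: (reg_epi_rx_inj RQD (@quo_reg_epi A)).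
  by rewrite rx_top -F1; apply: ext_valE; rewrite rx_top J1.
have [a' [_ aE]] := pre_val pres a; have [b' [_ bE]] := pre_val pres b.
rewrite rx_meet (ext_valE aE) (ext_valE bE) -FM; apply: ext_valE.
by rewrite rx_meet aE bE JM.
Qed.

Lemma ext_val_nat (A B : E) (c : Hom A B) (a : Q B) :
  ext_val (rx Q c a) = rx R (fmap ext_fun c) (ext_val a).
Proof.
apply: (reg_epi_rx_inj RQD (@quo_reg_epi A)).
have [f fE] := cov_repr pres c; have [b [_ bE]] := pre_val pres a.
rewrite -rxM (ext_mapE1 fE) rxM (ext_valE bE) -oa_nat; apply: ext_valE.
by rewrite -rxM fE rxM bE oa_nat.
Qed.

Definition ext : OneArrow Q R :=
  @MkOneArrow E D Q R ext_fun ext_val ext_val_hom ext_val_nat.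

(** * The extension is an arrow of QD *)

Lemma quo_lift (A : E) (T : D) (z : Hom T (ext_ob A)) :
  exists (S : D) (t : Hom S T) (u : Hom S (F (car A))),
    reg_epi t /\ quo A ∘ u = z ∘ t.
Proof. exact: (reg_epi_lift RQD z (@quo_reg_epi A)). Qed.

(** By [covers_mono], injectivity is tested on elements coming from [F]. There it is an inequality
    of relations in [P], valid since [m] is mono, which [F] carries to [R]. *)
Lemma ext_map_mono (A B : E) (m : Hom A B) : mono m -> mono (ext_map m).
Proof.
move=> mm; apply: (covers_mono RQD Flco (quo_covers A)) => U a b T u.
have [a' aE] := cov_lift (m ∘ (cov A ∘ fmap J a)).
have [b' bE] := cov_lift (m ∘ (cov A ∘ fmap J b)).
rewrite (ext_mapE aE) (ext_mapE bE) => /quo_eqP; apply: forces_map_le.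
apply/(bev_leP Pcompr) => S k; rewrite -!cov_related !fmapM.
rewrite !(cmpA (cov _)) -aE -bE -!cmpA => /mm; rewrite !cmpA.
exact.
Qed.

Lemma ext_one : is_iso (bang (ed_fp R) (ext (one (ed_fp Q)))).
Proof.
apply: reg_epi_mono_iso.
  pose w := wpc P [::].
  have [m _] := cov_lift (bang (ed_fp Q) (J w)).
  apply: (@reg_epi_cancel _ _ RQD _ _ _ _ (quo (one (ed_fp Q)) ∘ fmap F m)).
  have /(quotient_mapP RQD) := lco_one Flco w.
  by congr reg_epi; apply: bang_ext.
apply: (covers_mono RQD Flco (quo_covers _)) => U a b T u _.
by apply: forces_map_top; apply/cov_related; apply: bang_ext.
Qed.

(** The comparison is a regular epimorphism because pairs lift locally to [F w], and mono because in
    [P] elements of the product with related components are related. *)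
Lemma ext_prd (A B : E) : is_iso (prod_cmp Q R ext A B).
Proof.
apply: reg_epi_mono_iso.
  apply: (reg_epi_local RQD) => T z; pose w := wpc P [:: car A; car B].
  have [S [t [u [tr xE yE]]]] := covers_lift RQD Flco w
    (pr1 (ed_fp R) _ _ ∘ z) (pr2 (ed_fp R) _ _ ∘ z)
    (@quo_reg_epi A) (@quo_reg_epi B).
  have [m mE] := cov_lift (pair (ed_fp Q) (cov A ∘ fmap J (wp1 w))
                                          (cov B ∘ fmap J (wp2 w))).
  exists S, t, (quo _ ∘ fmap F m ∘ u); split=> //.
  rewrite /prod_cmp pair_cmp; apply: (@pair_ext _ (ed_fp R)); rewrite ?pair1 ?pair2.
    rewrite !cmpA xE (@ext_mapE _ _ (pr1 (ed_fp Q) A B) _ m (wp1 w)) //.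
    by rewrite -mE pair1.
  rewrite !cmpA yE (@ext_mapE _ _ (pr2 (ed_fp Q) A B) _ m (wp2 w)) //.
  by rewrite -mE pair2.
apply: (covers_mono RQD Flco (quo_covers _)) => U a b T u ab.
have [a1 a1E] := cov_lift (pr1 (ed_fp Q) A B ∘ (cov _ ∘ fmap J a)).
have [a2 a2E] := cov_lift (pr2 (ed_fp Q) A B ∘ (cov _ ∘ fmap J a)).
have [b1 b1E] := cov_lift (pr1 (ed_fp Q) A B ∘ (cov _ ∘ fmap J b)).
have [b2 b2E] := cov_lift (pr2 (ed_fp Q) A B ∘ (cov _ ∘ fmap J b)).
have le : bev (rel A) a1 b1 ⊓ bev (rel B) a2 b2 ⊑ bev (rel (prd (ed_fp Q) A B)) a b.
  apply: (forces_leP (full_weak_comprehension Pcompr)) => S k /forces_meet[].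
  rewrite !forces_bev -!cov_related !fmapM !(cmpA (cov _)) -a1E -a2E -b1E -b2E.
  by rewrite -!(cmpA (pr1 _ _ _)) -!(cmpA (pr2 _ _ _)); apply: pair_ext.
apply: (forces_map_le le); rewrite forces_map_meet; split; apply/quo_eqP.
  rewrite -(ext_mapE a1E) -(ext_mapE b1E).
  by move/(congr1 (cmp (pr1 (ed_fp R) _ _))): ab; rewrite !cmpA !pair1.
rewrite -(ext_mapE a2E) -(ext_mapE b2E).
by move/(congr1 (cmp (pr2 (ed_fp R) _ _))): ab; rewrite !cmpA !pair2.
Qed.

(** On a cover by [F (car _)], both sides say that [quo A] identifies the images of representatives
    [f] and [g] of the two projections. *)
Lemma ext_eqd (A : E) :
  oa_map ext (eqd Q A) = rx R (prod_cmp Q R ext A A) (eqd R (ext A)).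
Proof.
apply: (forces_eq (full_comprehension compr)) => T z.
have [S [t [u [tr uE]]]] := quo_lift z.
have local a : z ⊩ a <-> u ⊩ rx R (quo _) a.
  by rewrite forces_rx uE; split; [apply: forces_cmp | apply: forces_local].
have [f fE] := cov_repr pres (pr1 (ed_fp Q) A A).
have [g gE] := cov_repr pres (pr2 (ed_fp Q) A A).
rewrite !local (@ext_valE _ _ (bev (rel A) f g)).
  rewrite -quo_eqP -(ext_mapE1 fE) -(ext_mapE1 gE) -rxM forces_rx.
  by rewrite /prod_cmp !pair_cmp (forces_eqd diagc).
rewrite -(eqd_bev pres) -fE -gE -pair_cmp rxM; congr rx.
by rewrite -[LHS]rx1 (pair_uniq (idm _)) !cmpm1.
Qed.

(** As [ext_map c] is mono, a factorization may be found locally. There [y] comes from an element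
    forcing [F b], which left covering lifts to the domain of a weak comprehension [c0] of [b]; and
    [cov A ∘ fmap J c0] factors through [c]. *)
Lemma ext_comprehension (X A : E) (a : Q A) (c : Hom X A) :
  is_comprehension a c -> is_comprehension (oa_map ext a) (fmap ext c).
Proof.
move=> cc; have [c1 cu] := cc.
have cm : mono (ext_map c) by apply/ext_map_mono/(comprehension_mono cc).
split=> [|T y ya].
  rewrite -oa_nat; have [<- _] := oa_hom ext X.
  by apply: isl_hom_mono c1; apply: oa_hom.
suff [h yE] : exists h, y = fmap ext c ∘ h.
  by exists h; split=> // k; rewrite yE => /cm.
have [S [t [u [tr uE]]]] := quo_lift y.
have [b [_ bE]] := pre_val pres a.
have ub : u ⊩ oa_map F b.
  by rewrite -(ext_valE bE) forces_rx uE; apply: forces_cmp.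
have [X0 [c0 [c0c _]]] := Pcompr b; have [c01 _] := c0c.
have [N [e [ec _]]] := compr (oa_map F b); have [_ eu] := ec.
have [q [/(quotient_mapP RQD) qr qE]] := lco_comprehension Flco c0c ec.
have [v [vE _]] := eu _ _ ub.
have [S' [t' [v' [tr' v'E]]]] := reg_epi_lift RQD v qr.
have [|d [dE _]] := cu _ (cov A ∘ fmap J c0).
  by rewrite rxM bE; apply/(forces_J pres).
have [d' d'E] := cov_lift d; rewrite d'E in dE.
apply: (@mono_factor _ _ _ _ _ _ _ (t ∘ t') (quo X ∘ fmap F d' ∘ v') cm).
  exact: (reg_epi_comp RQD).
rewrite cmpA cmpA (ext_mapE (esym dE)) qE -!cmpA v'E (cmpA e) -vE.
by rewrite !cmpA uE.
Qed.

(** The isomorphism [ext_prd] forces [s] to be the kernel of the image of [q]. That image is a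
    regular epimorphism: [cov Y] lifts along [q], so [quo Y] factors through it. *)
Lemma ext_quotient (X Y : E) (r : Q (prd (ed_fp Q) X X)) (q : Hom X Y) :
  is_eqrel r -> is_quotient r q ->
  forall s : R (prd (ed_fp R) (ext X) (ext X)),
    rx R (prod_cmp Q R ext X X) s = oa_map ext r -> is_quotient s (fmap ext q).
Proof.
move=> re rq s; have QQD := presentation_in_QD Pcompr pres.
have rE := quotient_ker QQD re rq.
have qr : reg_epi q by apply/(quotient_mapP QQD); exists r.
rewrite rE (map_ker q (ext_eqd Y)) => /(is_iso_rx_inj (ext_prd X X)) ->.
apply: (reg_epi_quotient compr diagc).
have [x xE] := reg_epi_J_surjective pres qr (cov Y); have [f fE] := cov_lift x.
apply: (@reg_epi_cancel _ _ RQD _ _ _ _ (quo X ∘ fmap F f)).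
rewrite cmpA (@ext_mapE _ _ q _ f (idm _)) ?fmap1 ?cmpm1; first exact: quo_reg_epi.
by rewrite xE fE.
Qed.

Theorem ext_QD_arrow : is_QD_arrow ext.
Proof.
split; [split; [exact: ext_one | exact: ext_prd] | exact: ext_eqd | |].
- exact: ext_comprehension.
- exact: ext_quotient.
Qed.

End Extension.

(** * Isomorphisms of 1-arrows and equivalences of categories *)

(** The equality on fibres, stronger than the inequality of a 2-arrow, is what makes the inverse
    transformation a 2-arrow. *)
Lemma two_arrow_iso (C D : Category) (P : Doctrine C) (R : Doctrine D)
    (G H : OneArrow P R) (t : TwoArrow G H) :
  (forall X, is_iso (t X)) ->
  (forall (X : C) (a : P X), oa_map G a = rx R (t X) (oa_map H a)) ->
  @is_iso (OneArrowCat P R) G H t.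
Proof.
move=> ti tE; pose s X := sval (cid (ti X)).
have sP X : s X ∘ t X = idm _ /\ t X ∘ s X = idm _ := proj2_sig (cid (ti X)).
have sN X Y (f : Hom X Y) : s Y ∘ fmap H f = fmap G f ∘ s X.
  have [sY _] := sP Y; have [_ tX] := sP X.
  by rewrite -[LHS]cmpm1 -tX !cmpA -(cmpA (s Y)) -ntN !cmpA sY cmp1m.
have s_le X (a : P X) : oa_map H a ⊑ rx R (s X) (oa_map G a).
  by have [_ tX] := sP X; rewrite tE -rxM tX rx1; apply: ile_refl.
exists (MkTwoArrow (ta_nat := MkNatTrans sN) s_le).
by split; apply: ta_eq => X /=; have [] := sP X.
Qed.

Lemma fully_faithful_equivalence (C D : Category) (F : Functor C D) :
  (forall (X Y : C) (g : Hom (F X) (F Y)), exists f, fmap F f = g) ->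
  (forall (X Y : C) (f f' : Hom X Y), fmap F f = fmap F f' -> f = f') ->
  (forall Y : D, exists (X : C) (i : Hom (F X) Y), is_iso i) ->
  is_equivalence F.
Proof.
move=> full faithful esurj.
pose G0 Y := sval (cid (esurj Y)).
pose i Y : Hom (F (G0 Y)) Y := sval (cid (proj2_sig (cid (esurj Y)))).
have iP Y : is_iso (i Y) := proj2_sig (cid (proj2_sig (cid (esurj Y)))).
pose j Y := sval (cid (iP Y)).
have [ji ij] : (forall Y, j Y ∘ i Y = idm _) /\ (forall Y, i Y ∘ j Y = idm _).
  by split=> Y; have [] := proj2_sig (cid (iP Y)).
pose pre X Y (g : Hom (F X) (F Y)) := sval (cid (full X Y g)).
have preE X Y g : fmap F (@pre X Y g) = g by rewrite /pre; case: cid.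
pose G1 Y Y' (g : Hom Y Y') := pre _ _ (j Y' ∘ g ∘ i Y).
have G1E Y Y' (g : Hom Y Y') : fmap F (G1 _ _ g) = j Y' ∘ g ∘ i Y by apply: preE.
have G1_id Y : G1 _ _ (idm Y) = idm (G0 Y).
  by apply: faithful; rewrite G1E cmpm1 ji fmap1.
have G1_cmp Y Y' Y'' (g : Hom Y' Y'') (f : Hom Y Y') :
    G1 _ _ (g ∘ f) = G1 _ _ g ∘ G1 _ _ f.
  apply: faithful; rewrite fmapM !G1E !cmpA.
  by rewrite -(cmpA _ (i Y')) ij cmpm1.
pose G := MkFunctor G1_id G1_cmp; exists G; split.
  pose u X : Hom X (G (F X)) := pre _ _ (j (F X)).
  have uE X : fmap F (u X) = j (F X) by apply: preE.
  have uN X Y (f : Hom X Y) : u Y ∘ fmap (idF C) f = fmap (compF G F) f ∘ u X.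
    apply: faithful; rewrite !fmapM !uE /= G1E -!cmpA.
    by rewrite ij cmpm1.
  exists (@MkNatTrans C C (idF C) (compF G F) u uN) => X; exists (pre _ _ (i (F X))).
  by split; apply: faithful; rewrite fmapM uE preE fmap1 ?ij ?ji.
have vN X Y (f : Hom X Y) : i Y ∘ fmap (compF F G) f = fmap (idF D) f ∘ i X.
  by rewrite /= G1E !cmpA ij cmp1m.
exists (@MkNatTrans D D (compF F G) (idF D) i vN) => Y.
by exists (j Y); split; [exact: ji | exact: ij].
Qed.

(** * The extension restricts to the given left covering *)

Section ExtensionRestriction.
Variables (C E D : Category) (P : BiasedElem C) (Q : ElemDoctrine E).
Variable R : ElemDoctrine D.
Variables (J : OneArrow P Q) (car : E -> C).
Variable rel : forall A : E, pi_class P [:: car A; car A].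
Variable cov : forall A : E, Hom (J (car A)) A.
Hypothesis Pcompr : has_full_weak_comprehensions P.
Hypothesis Pdiag : biased_comprehensive_diagonals P.
Hypothesis pres : presentation J rel cov.
Hypothesis RQD : in_QD R.
Variable F : OneArrow P R.
Hypothesis Flco : is_lco F.

Local Notation Fext := (ext Pcompr Pdiag pres RQD Flco).
Local Notation q := (quo Pcompr Pdiag pres RQD Flco).

Lemma ext_restrict : exists t : TwoArrow F (oa_comp Fext J),
  @is_iso (OneArrowCat P R) _ _ t.
Proof.
(* In a presentation [car (J X)] may differ from [X]. The arrow [l X] lifts the identity of [J X],
   and [k] represents [cov (J X)]; then [k ∘ l X] is the identity, while [l X ∘ k] is so only up to
   the relation. *)
pose l X := sval (cid (pre_cov_lift pres (idm (J X)))).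
have lE X : cov (J X) ∘ fmap J (l X) = idm (J X).
  exact: esym (proj2_sig (cid (pre_cov_lift pres (idm (J X))))).
have kP X := pre_J_full pres (cov (J X)).
have tN X Y (f : Hom X Y) :
    q (J Y) ∘ fmap F (l Y) ∘ fmap F f =
    fmap (oa_comp Fext J) f ∘ (q (J X) ∘ fmap F (l X)).
  rewrite -cmpA -fmapM cmpA /=; apply/esym/ext_mapE.
  by rewrite lE cmpm1 fmapM cmpA lE cmp1m.
have tE X (a : P X) : oa_map F a =
    rx R (q (J X) ∘ fmap F (l X)) (oa_map (oa_comp Fext J) a).
  have [k kE] := kP X.
  have kaE : rx Q (cov (J X)) (oa_map J a) = oa_map J (rx P k a).
    by rewrite kE oa_nat.
  have kl : k ∘ l X = idm X.
    by apply: (pre_J_faithful pres); rewrite fmapM -kE lE fmap1.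
  by rewrite rxM (ext_valE Pcompr Pdiag pres RQD Flco kaE) -oa_nat -rxM kl rx1.
have t_le X (a : P X) : oa_map F a ⊑
    rx R (q (J X) ∘ fmap F (l X)) (oa_map (oa_comp Fext J) a).
  by rewrite -tE; apply: ile_refl.
pose t := @MkTwoArrow _ _ P R F (oa_comp Fext J)
  (@MkNatTrans _ _ F (oa_comp Fext J) (fun X => q (J X) ∘ fmap F (l X)) tN) t_le.
exists t; apply: two_arrow_iso => //= X.
(* Regular epi since [quo] does not distinguish [l X ∘ k] from the identity; mono since the relation
   of [J X] pulled back along [l X] is contained in δ, which [F] sends to equality. *)
apply: reg_epi_mono_iso.
  have [k kE] := kP X; apply: (@reg_epi_cancel _ _ RQD _ _ _ _ (fmap F k)).
  have lk : cov (J X) ∘ fmap J (l X ∘ k) = cov (J X) ∘ fmap J (idm _).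
    by rewrite fmapM cmpA lE cmp1m fmap1 cmpm1.
  rewrite -cmpA -fmapM (quo_eq Pcompr Pdiag pres RQD Flco lk) fmap1 cmpm1.
  exact: quo_reg_epi.
move=> T x y xy.
have [S [p [u [pr xE yE]]]] := lco_lift RQD Flco (wpc P [:: X; X]) x y.
apply: (reg_epi_epi pr); rewrite xE yE; apply/(forces_map_delta RQD Flco).
have : q (J X) ∘ fmap F (l X ∘ wp1 _) ∘ u = q (J X) ∘ fmap F (l X ∘ wp2 _) ∘ u.
  by rewrite !fmapM !cmpA -!(cmpA _ _ u) -xE -yE !cmpA xy.
move/quo_eqP; apply: forces_map_le; apply/(bev_leP Pcompr) => Z k.
rewrite -(pre_cov_related pres) !fmapM !cmpA lE !cmp1m -!fmapM.
by move/(pre_J_faithful pres)/(related_delta Pdiag).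
Qed.

End ExtensionRestriction.

Unset Implicit Arguments.

Theorem theorem6p15 (C : Category) (P : BiasedElem C)
    (Pcompr : has_full_weak_comprehensions P)
    (Pdiag : biased_comprehensive_diagonals P) (R : QD) :
  exists (PbarQD : in_QD (quot_doctrine P))
         (J_lco : forall G : OneArrow (quot_doctrine P) R,
            is_QD_arrow G -> is_lco (oa_comp G (J_arrow P))),
    is_equivalence
      (@restrictF (OneArrowCat (quot_doctrine P) R) (OneArrowCat P R)
         (precomp R (J_arrow P)) _ _ J_lco
       : Functor (QD_hom (MkQD PbarQD) R) (Lco P R)).
Proof.
have pres := quot_compl_presentation Pcompr Pdiag.
have RQD := QD_ok R.
exists (presentation_in_QD Pcompr pres).
exists (fun G GQD => QD_arrow_lco Pdiag pres RQD GQD).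
apply: fully_faithful_equivalence => [[G GQD] [H HQD] t | [G GQD] [H HQD] s s' ss' | [F Flco]].
- have [s sE] := QD_two_arrow_ext Pdiag pres RQD GQD HQD t.
  by exists s; apply: ta_eq.
- apply: (QD_two_arrow_eq pres RQD GQD) => X.
  exact: (congr1 (fun t : TwoArrow _ _ => t X) ss').
(* The isomorphism [t] goes from [F] to the restricted extension; essential surjectivity asks for
   its inverse [s]. *)
- have [t [s [st ts]]] := ext_restrict Pcompr Pdiag pres RQD Flco.
  exists (exist _ _ (ext_QD_arrow Pcompr Pdiag pres RQD Flco)), s.
  by exists t.
Qed.
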